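(* Let $p$ be a prime number, let $K$ be a $p$-field, let $n>0$ be an integer, and let $L_n$, $G_n=\mathrm{Gal}(L_n|K)$ be as defined in the context. View $L_n^\times/L_n^{\times p}$ (if $K$ has characteristic $0$), respectively $L_n^+/\wp(L_n^+)$ (if $K$ has characteristic $p$), as an $\mathbf{F}_p[G_n]$-module. The set of $K$-isomorphism classes of primitive extensions $E$ of $K$ of degree $p^n$ is in canonical bijection with the set of simple $\mathbf{F}_p[G_n]$-submodules $D$ of $L_n^\times/L_n^{\times p}$, respectively of $L_n^+/\wp(L_n^+)$, of degree $n$ (that is, with $\dim_{\mathbf{F}_p}D=n$), under the correspondence $EL_n=L_n(\sqrt[p]{D})$, respectively $EL_n=L_n(\wp^{-1}(D))$.
   Context: A $p$-field is a local field (complete for a discrete valuation) with finite residue field of characteristic $p$. All extensions of $K$ are assumed separable over $K$ and contained in a fixed maximal galoisian extension (separable closure) $\tilde K$ of $K$. A finite extension $E$ of $K$ is called primitive if $[E:K]>1$ and the only extensions of $K$ contained in $E$ are $K$ and $E$. For $n>0$ put $e_n=p^n-1$, $K_n=K(\sqrt[e_n]{1})$, where $\sqrt[e_n]{1}$ denotes an element of order $e_n$ in the multiplicative group, and $L_n=K_n\bigl(\sqrt[e_n]{K_n^\times}\bigr)$, the field obtained by adjoining to $K_n$ all $e_n$-th roots of all elements of $K_n^\times$ (the maximal abelian extension of $K_n$ of exponent dividing $e_n$). $L_n$ is a finite tamely ramified galoisian extension of $K$; put $G_n=\mathrm{Gal}(L_n|K)$. If $K$ has characteristic $0$, then $L_n$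 contains a primitive $p$-th root of $1$. $L_n^+$ is the additive group of $L_n$ and $\wp(x)=x^p-x$. For a subspace $D$ of $L_n^\times/L_n^{\times p}$ (characteristic $0$), $L_n(\sqrt[p]{D})$ is the extension of $L_n$ obtained by adjoining all $p$-th roots of all $x\in L_n^\times$ whose class lies in $D$. For a subspace $D$ of $L_n^+/\wp(L_n^+)$ (characteristic $p$), $L_n(\wp^{-1}(D))$ is the extension of $L_n$ obtained by adjoining all $y$ with $\wp(y)\in L_n$ having class in $D$. *)

(* Defs.v *)
From HB Require Import structures.
From mathcomp Require Import all_boot all_order all_algebra all_field.
From mathcomp Require Import generic_quotient ring_quotient.
From mathcomp Require Import boolp classical_sets functions cardinality.

Set Implicit Arguments.
Unset Strict Implicit.
Unset Printing Implicit Defensive.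

Import Order.TTheory GRing.Theory Num.Theory.

Local Open Scope classical_set_scope.
Local Open Scope ring_scope.
Local Open Scope quotient_scope.

(* [D] has a basis of [n] vectors for the scalar action [scale].  This is only
   used for [D] stable under addition and [scale], where it says dim D = n. *)
Definition has_dim (F : Type) (V : zmodType) (scale : F -> V -> V)
    (D : set V) (n : nat) : Prop :=
  exists b : 'I_n -> V, (forall i, D (b i)) /\
    forall v, D v ->
      exists! c : {ffun 'I_n -> F}, v = \sum_(i < n) scale (c i) (b i).

(* A normalized discrete valuation; [dv 0] is a junk value, 0 having infinite
   valuation (see [dv_ge]). *)
Record discrete_valuation (K : fieldType) := DiscreteValuation {
  dv :> K -> int;
  dvM : forall x y, x != 0 -> y != 0 -> dv (x * y) = dv x + dv y;
  dvD : forall x y, x != 0 -> y != 0 -> x + y != 0 ->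
          Num.min (dv x) (dv y) <= dv (x + y);
  dv_surj : exists2 x, x != 0 & dv x = 1
}.

Section Valuation.
Variables (K : fieldType) (v : discrete_valuation K).
Implicit Types x y : K.

Definition dv_ge (m : int) : {pred K} := fun x => (x == 0) || (m <= v x).

Lemma dv1 : v 1 = 0.
Proof.
have := dvM v (oner_neq0 K) (oner_neq0 K).
by rewrite mulr1 => /esym/eqP; rewrite -subr_eq0 addrK => /eqP.
Qed.

Lemma dvN1 : v (-1) = 0.
Proof.
have n1 : (-1 : K) != 0 by rewrite oppr_eq0 oner_neq0.
have := dvM v n1 n1; rewrite mulrNN mulr1 dv1 => /esym/eqP.
by rewrite -mulr2n mulrn_eq0 => /eqP.
Qed.

Lemma dv_ge0 m : 0 \in dv_ge m. Proof. by rewrite unfold_in eqxx. Qed.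

Lemma dv_geN m x : x \in dv_ge m -> - x \in dv_ge m.
Proof.
rewrite !unfold_in oppr_eq0; have [//|x0 /=] := eqVneq x 0.
by rewrite -mulN1r dvM ?oppr_eq0 ?oner_neq0// dvN1 add0r.
Qed.

Lemma dv_geD m x y : x \in dv_ge m -> y \in dv_ge m -> x + y \in dv_ge m.
Proof.
rewrite !unfold_in; have [->|x0 /=] := eqVneq x 0; first by rewrite add0r.
have [->|y0 /= mx my] := eqVneq y 0; first by rewrite addr0 (negPf x0).
have [//|xy0 /=] := eqVneq (x + y) 0.
by apply: le_trans (dvD v x0 y0 xy0); rewrite le_min mx my.
Qed.

Lemma dv_geM m n x y : x \in dv_ge m -> y \in dv_ge n -> x * y \in dv_ge (m + n).
Proof.
rewrite !unfold_in mulf_eq0; have [//|x0 /=] := eqVneq x 0.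
have [//|y0 /= mx my] := eqVneq y 0.
by rewrite dvM// lerD.
Qed.

Definition dv_ring : {pred K} := dv_ge 0.

Fact dv_ring_subring : subring_closed dv_ring.
Proof.
split=> [|x y xO yO|x y xO yO].
- by rewrite unfold_in /dv_ge dv1 lexx orbT.
- by apply: dv_geD => //; apply: dv_geN.
- by have := dv_geM xO yO; rewrite addr0.
Qed.
HB.instance Definition _ := GRing.isSubringClosed.Build K dv_ring dv_ring_subring.

Record val_ring := ValRing { vr_val : K; _ : vr_val \in dv_ring }.
HB.instance Definition _ := [isSub for vr_val].
HB.instance Definition _ := [Choice of val_ring by <:].
HB.instance Definition _ := [SubChoice_isSubComNzRing of val_ring by <:].

Definition val_max : {pred val_ring} := fun a => vr_val a \in dv_ge 1.

Fact val_max_ideal : idealr_closed val_max.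
Proof.
split=> [||a x y].
- by rewrite unfold_in -[vr_val 0]/(\val (0 : val_ring)) rmorph0 dv_ge0.
- rewrite unfold_in -[vr_val 1]/(\val (1 : val_ring)) rmorph1.
  by rewrite unfold_in oner_eq0 dv1.
move=> x1 y1; rewrite unfold_in.
rewrite -[vr_val _]/(\val (a * x + y)) rmorphD rmorphM.
have aO : \val a \in dv_ge 0 := valP a.
by apply: dv_geD => //; have := dv_geM aO x1; rewrite add0r.
Qed.
HB.instance Definition _ := isIdealr.Build val_ring val_max val_max_ideal.

Definition residue_ring := {ideal_quot val_max}.
HB.instance Definition _ := GRing.ComNzRing.on residue_ring.

Definition dv_complete : Prop :=
  forall u : nat -> K,
    (forall m : int, exists N, forall i j, (N <= i)%N -> (N <= j)%N ->
        u i - u j \in dv_ge m) ->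
    exists l : K, forall m : int, exists N, forall i, (N <= i)%N ->
        u i - l \in dv_ge m.

End Valuation.

Definition is_p_field (p : nat) (K : fieldType) : Prop :=
  exists v : discrete_valuation K,
    [/\ dv_complete v, finite_set [set: residue_ring v]
      & p \in [pchar residue_ring v]].

Definition is_separable_closure (K Ks : fieldType) (iota : {rmorphism K -> Ks}) :=
  (forall x : Ks, exists2 q : {poly K},
      separable_poly q & root (map_poly iota q) x) /\
  (forall q : {poly Ks}, separable_poly q -> (1 < size q)%N ->
      exists x, root q x).

Section Extensions.
Variables (K Ks : fieldType) (iota : {rmorphism K -> Ks}).

(* The extensions of K (possibly infinite) contained in Ks. *)
Record subext := SubExt {
  se_set :> set Ks;
  se_base : forall a, se_set (iota a);
  se_B : forall x y, se_set x -> se_set y -> se_set (x - y);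
  se_div : forall x y, se_set x -> se_set y -> se_set (x / y)
}.
Implicit Types E F L : subext.

Section FieldStructure.
Variable E : subext.

Definition se_pred : {pred Ks} := fun x => `[< se_set E x >].

Fact se_pred_divring : divring_closed se_pred.
Proof.
split=> [|x y /asboolP xE /asboolP yE|x y /asboolP xE /asboolP yE]; apply/asboolP.
- by rewrite -(rmorph1 iota); apply: se_base.
- exact: se_B.
- exact: se_div.
Qed.
HB.instance Definition _ := GRing.isDivringClosed.Build Ks se_pred se_pred_divring.

Record field_of := SubExtType { se_val : Ks; _ : se_val \in se_pred }.
HB.instance Definition _ := [isSub for se_val].
HB.instance Definition _ := [Choice of field_of by <:].
HB.instance Definition _ := [SubChoice_isSubIntegralDomain of field_of by <:].
HB.instance Definition _ := [SubIntegralDomain_isSubField of field_of by <:].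
End FieldStructure.

Definition ext_degree E (m : nat) : Prop :=
  has_dim (fun (a : K) (x : Ks) => iota a * x) E m.

Fact base_ext_B (x y : Ks) : range iota x -> range iota y -> range iota (x - y).
Proof. by move=> [a _ <-] [b _ <-]; exists (a - b); rewrite ?rmorphB. Qed.
Fact base_ext_div (x y : Ks) : range iota x -> range iota y -> range iota (x / y).
Proof. by move=> [a _ <-] [b _ <-]; exists (a / b); rewrite ?fmorph_div. Qed.

(* K itself, as a subfield of Ks. *)
Definition base_ext : subext :=
  @SubExt (range iota) (fun a => imageT iota a) base_ext_B base_ext_div.

(* E(S): the intersection of all the extensions of K containing E and S. *)
Section Adjoin.
Variables (E : subext) (S : set Ks).

Definition adjoin_set : set Ks :=
  [set x | forall F, E `<=` F -> S `<=` F -> se_set F x].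

Fact adjoin_base a : adjoin_set (iota a).
Proof. by move=> F _ _; apply: se_base. Qed.
Fact adjoin_B x y : adjoin_set x -> adjoin_set y -> adjoin_set (x - y).
Proof. by move=> xS yS F EF SF; apply: se_B; [apply: xS | apply: yS]. Qed.
Fact adjoin_div x y : adjoin_set x -> adjoin_set y -> adjoin_set (x / y).
Proof. by move=> xS yS F EF SF; apply: se_div; [apply: xS | apply: yS]. Qed.

Definition adjoin : subext := SubExt adjoin_base adjoin_B adjoin_div.
End Adjoin.

Definition primitive_ext E : Prop :=
  (exists2 m, (1 < m)%N & ext_degree E m) /\
  (forall F, F `<=` E ->
     F = base_ext :> set Ks \/ F = E :> set Ks).

Definition fixes_base E F (f : {rmorphism field_of E -> field_of F}) : Prop :=
  forall (a : K) (x : field_of E), se_val x = iota a -> se_val (f x) = iota a.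

Definition K_isomorphic E F : Prop :=
  exists f : {rmorphism field_of E -> field_of F}, bijective f /\ fixes_base f.

Definition iso_class E : set subext := [set F | K_isomorphic E F].

Definition primitive_classes (d : nat) : set (set subext) :=
  [set iso_class E | E in [set E | primitive_ext E /\ ext_degree E d]].

Record Gal L := GalAut {
  gal_fun :> {rmorphism field_of L -> field_of L};
  gal_bij : bijective gal_fun;
  gal_fix : fixes_base gal_fun
}.

(* K_n and L_n, for z an element of order e = p^n - 1 of Ks^x. *)
Definition K_ z : subext := adjoin base_ext [set z].
Definition L_ (e : nat) z : subext :=
  adjoin (K_ z) [set y | se_set (K_ z) (y ^+ e) /\ y != 0].

End Extensions.

(* The multiplicative group F^x, as an additively written abelian group. *)
Section MulGroup.
Variable F : fieldType.

Record mul_group := MulGroup { mg_val : F; mg_neq0 : mg_val != 0 }.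
HB.instance Definition _ := [isSub for mg_val].
HB.instance Definition _ := [Choice of mul_group by <:].
Implicit Types x y z : mul_group.

Definition mg_one := MulGroup (oner_neq0 F).
Definition mg_mul x y := MulGroup (mulf_neq0 (mg_neq0 x) (mg_neq0 y)).
Definition mg_inv x := MulGroup (invr_neq0 (mg_neq0 x)).

Fact mg_mulA : associative mg_mul.
Proof. by move=> x y z; apply: val_inj; rewrite /= mulrA. Qed.
Fact mg_mulC : commutative mg_mul.
Proof. by move=> x y; apply: val_inj; rewrite /= mulrC. Qed.
Fact mg_mul1 : left_id mg_one mg_mul.
Proof. by move=> x; apply: val_inj; rewrite /= mul1r. Qed.
Fact mg_mulV : left_inverse mg_one mg_inv mg_mul.
Proof. by move=> x; apply: val_inj; rewrite /= mulVf ?mg_neq0. Qed.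
HB.instance Definition _ :=
  GRing.isZmodule.Build mul_group mg_mulA mg_mulC mg_mul1 mg_mulV.

Lemma mg_valMn x n : mg_val (x *+ n) = mg_val x ^+ n.
Proof. by elim: n => [|n IHn]; rewrite ?mulrS ?exprS /= ?IHn. Qed.
End MulGroup.

Definition mg_map (F F' : fieldType) (s : {rmorphism F -> F'})
    (x : mul_group F) : mul_group F' :=
  @MulGroup F' (s (mg_val x)) (etrans (congr1 negb (fmorph_eq0 s _)) (mg_neq0 x)).

(* The quotient A / f(A); the two modules of interest are instances of it. *)
Section Cokernel.
Variables (A : zmodType) (f : {additive A -> A}).

Definition im_pred : {pred A} := fun x => `[< exists y, f y = x >].

Fact im_pred_zmod : zmod_closed im_pred.
Proof.
split=> [|x y /asboolP[a <-] /asboolP[b <-]]; apply/asboolP.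
- by exists 0; rewrite raddf0.
- by exists (a - b); rewrite raddfB.
Qed.
HB.instance Definition _ := GRing.isZmodClosed.Build A im_pred im_pred_zmod.

Definition coker := {ideal_quot im_pred}.
HB.instance Definition _ := GRing.Zmodule.on coker.

Definition coker_class (x : A) : coker := \pi_({ideal_quot im_pred}) x.

(* The endomorphism of A / f(A) induced by [s]; the choice of representative
   is irrelevant when [s] is additive and commutes with [f]. *)
Definition coker_map (s : A -> A) (v : coker) : coker :=
  coker_class (s (repr v)).

Lemma coker_mapE (s : {additive A -> A}) :
  (forall x, s (f x) = f (s x)) ->
  forall x, coker_map s (coker_class x) = coker_class (s x).
Proof.
move=> sf x; apply/eqP; rewrite /coker_map /coker_class -Quotient.idealrBE.
rewrite -raddfB; set y := repr _.
have : y - x \in im_pred by rewrite Quotient.idealrBE reprK.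
by case/asboolP=> a ax; apply/asboolP; exists (s a); rewrite -sf ax.
Qed.
End Cokernel.

(* F_p[G]-modules: V is an abelian group killed by p, on which the scalar
   c : 'F_p acts as v |-> v *+ c, with an action [act] of G. *)
Section Modules.
Variables (p : nat) (V : zmodType) (G : Type) (act : G -> V -> V).

Definition Fp_scale (c : 'F_p) (v : V) : V := v *+ c.

Definition submodule (D : set V) : Prop :=
  [/\ D 0, (forall u v, D u -> D v -> D (u + v)),
      (forall c v, D v -> D (Fp_scale c v))
    & (forall g v, D v -> D (act g v))].

Definition simple_submodule (D : set V) : Prop :=
  [/\ submodule D, D <> [set 0]
    & forall D', submodule D' -> D' `<=` D -> D' = [set 0] \/ D' = D].

Definition simple_submodules (n : nat) : set (set V) :=
  [set D | simple_submodule D /\ has_dim Fp_scale D n].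
End Modules.

Section KummerModule.
Variables (K Ks : fieldType) (iota : {rmorphism K -> Ks}) (p : nat).
Variable L : subext iota.

Definition mg_pow (x : mul_group (field_of L)) : mul_group (field_of L) := x *+ p.
Fact mg_pow_additive : zmod_morphism mg_pow.
Proof. by move=> x y; rewrite /mg_pow mulrnBl. Qed.
HB.instance Definition _ :=
  GRing.isZmodMorphism.Build (mul_group (field_of L)) (mul_group (field_of L)) mg_pow mg_pow_additive.

(* L^x / L^x^p *)
Definition kummer_mod : zmodType := coker mg_pow.

Definition kummer_act (s : Gal L) : kummer_mod -> kummer_mod :=
  @coker_map _ mg_pow (mg_map s).

Lemma kummer_actE (s : Gal L) x :
  kummer_act s (coker_class mg_pow x) = coker_class mg_pow (mg_map s x).
Proof.
have sN : zmod_morphism (mg_map s).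
  by move=> a b; apply: val_inj; rewrite /= rmorphM fmorphV.
pose sA := GRing.isZmodMorphism.Build _ _ (mg_map s) sN.
pose S : {additive mul_group (field_of L) -> mul_group (field_of L)} :=
  HB.pack (mg_map s) sA.
apply: (@coker_mapE _ mg_pow S) => a; exact: (raddfMn S).
Qed.

Definition kummer_ext (D : set kummer_mod) : subext iota :=
  adjoin L [set y : Ks | exists x : mul_group (field_of L),
                D (coker_class mg_pow x) /\ y ^+ p = se_val (mg_val x)].
End KummerModule.

Section ArtinSchreierModule.
Variables (K Ks : fieldType) (iota : {rmorphism K -> Ks}) (p : nat).
Variables (charK : p \in [pchar K]) (L : subext iota).

Fact pchar_subext : p \in [pchar field_of L].
Proof.
rewrite -(fmorph_pchar (\val : {rmorphism field_of L -> Ks})).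
by rewrite (fmorph_pchar iota).
Qed.

(* [wp] depends on [charK] only so that it can be declared additive. *)
Definition wp of p \in [pchar K] := fun x : field_of L => x ^+ p - x.
Fact wp_additive : zmod_morphism (wp charK).
Proof.
move=> x y; rewrite /wp.
have := rmorphB (pFrobenius_aut pchar_subext) x y.
rewrite /= !pFrobenius_autE => ->.
by rewrite opprD addrACA -opprD.
Qed.
HB.instance Definition _ :=
  GRing.isZmodMorphism.Build (field_of L) (field_of L) (wp charK) wp_additive.

(* L^+ / wp(L^+) *)
Definition as_mod : zmodType := coker (wp charK).

Definition as_act (s : Gal L) : as_mod -> as_mod := @coker_map _ (wp charK) s.

Lemma as_actE (s : Gal L) x :
  as_act s (coker_class (wp charK) x) = coker_class (wp charK) (s x).
Proof.
by apply: (@coker_mapE _ (wp charK) s) => a; rewrite /= /wp rmorphB rmorphXn.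
Qed.

Definition as_ext (D : set as_mod) : subext iota :=
  adjoin L [set y : Ks | exists x : field_of L,
                D (coker_class (wp charK) x) /\ y ^+ p - y = se_val x].
End ArtinSchreierModule.

(* The K-isomorphism classes of primitive extensions of degree p^n are in bijection with
   the simple submodules of degree n of V by the rule E L = ext D. *)
Definition primitive_correspondence (K Ks : fieldType)
    (iota : {rmorphism K -> Ks}) (p n : nat) (L : subext iota) (V : zmodType)
    (act : Gal L -> V -> V) (ext : set V -> subext iota) : Prop :=
  exists Phi : set (subext iota) -> set V,
    set_bij (primitive_classes (p ^ n)) (simple_submodules p act n) Phi /\
    forall (E : subext iota) (D : set V),
      primitive_ext E -> ext_degree E (p ^ n) -> simple_submodules p act n D ->
      (Phi (iso_class E) = D <-> adjoin L E = ext D :> set Ks).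

(* Main.v *)
(* Everything takes place in a finite Galois extension of K with group G, in
   which B and R are the subgroups fixing K_n and L_n.

   Ramification theory (Hensel's lemma extends the valuation) gives G a normal
   series with cyclic quotients G/T and T/W above a p-group W, Frobenius acting
   on T/W by powers of p.  A primitive extension is the fixed field of a maximal
   subgroup U, and by solvability the quotient of G by the core of U has a
   unique minimal normal subgroup N, of order p^n, complemented by the image
   of U.  That image is tame: B acts on N through an abelian group of exponent
   dividing p^n - 1, so by Kummer theory R acts trivially on N, its image is
   exactly N, and S = R n U is normal in G with R/S elementary abelian of order
   p^n and simple under G.  Conversely, such an S has a complement U in G above
   R, unique up to conjugacy (Schur-Zassenhaus applied in B, and Frattini).  Thus
   classes of primitive E of degree p^n correspond to these S, with S the group
   of E L_n.

   The subgroups S in turn correspond to the submodules D by the pairing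
   between R/S and D coming from Kummer or Artin-Schreier theory over L_n, which
   contains a p-th root of 1 because L_n is the largest extension of K_n that is
   abelian of exponent dividing p^n - 1. *)

Require Import Defs.
From HB Require Import structures.
From mathcomp Require Import boolp classical_sets functions cardinality.
From mathcomp Require Import all_boot all_order all_fingroup all_algebra all_solvable all_field.
From mathcomp Require Import generic_quotient ring_quotient.
From mathcomp Require Import mxabelem.
From mathcomp Require Import zify ring.

Set Implicit Arguments.
Unset Strict Implicit.
Unset Printing Implicit Defensive.

Import Order.TTheory GRing.Theory Num.Theory.

Local Open Scope ring_scope.

(** * Hensel's lemma and valuations of Galois extensions *)

(** The field [Ks] is infinite over [K], so every assertion is proved in a model: a finite Galois
    extension [L] of [K] with an embedding [j] into [Ks] whose image contains the fields concerned.
    Two things follow. That L_n fits in a model must be proved: fixing any number of e-th roots,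
    with e = p^n - 1, cuts out a subgroup of index at most e^2 in B. And preimages of classes exist
    only as far as the model contains them, whence the lifting conditions in the duality.

    The constant p^n - 1 serves twice. An abelian group acts on a simple module of order q through a
    group of order dividing q - 1, and p^n is a power of q for the modules that occur, so p^n - 1 is
    an exponent. Being prime to p, it also makes N a Hall subgroup of B.

    The bound #|G : B| <= n expresses that Frobenius has order at most n on the roots of unity of
    order p^n - 1. It settles two degenerate cases: it prevents U from containing R, and it forces G
    = B when B centralizes N.

    The multiplicative and additive modules share one duality, which uses only an additive map with
    kernel cyclic of order p and a form of Hilbert 90. *)

Section DiscreteValuation.
Variables (K : fieldType) (v : discrete_valuation K).
Implicit Types (x y : K) (m n : int) (f g h u : {poly K}).

Lemma dvV x : x != 0 -> v x^-1 = - v x.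
Proof.
move=> x0; apply/eqP; rewrite -subr_eq0 opprK -dvM ?invr_neq0 //.
by rewrite mulVf // dv1.
Qed.

Lemma dvX x (k : nat) : x != 0 -> v (x ^+ k) = v x *+ k.
Proof.
move=> x0; elim: k => [|k IHk]; first by rewrite dv1.
by rewrite exprS dvM ?expf_neq0 // IHk mulrS.
Qed.

Lemma in_dv_ge m x : x != 0 -> (x \in dv_ge v m) = (m <= v x).
Proof. by move=> x0; rewrite unfold_in (negPf x0). Qed.

Lemma dv_ge_le m n x : m <= n -> x \in dv_ge v n -> x \in dv_ge v m.
Proof.
move=> mn; rewrite !unfold_in => /orP[->//|nx].
by rewrite (le_trans mn nx) orbT.
Qed.

Lemma dv_geB m x y : x \in dv_ge v m -> y \in dv_ge v m -> x - y \in dv_ge v m.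
Proof. by move=> xm ym; apply: dv_geD => //; apply: dv_geN. Qed.

Lemma dv_ge_sum m (I : Type) (r : seq I) (P : pred I) (F : I -> K) :
  (forall i, P i -> F i \in dv_ge v m) -> \sum_(i <- r | P i) F i \in dv_ge v m.
Proof.
by move=> FP; elim/big_ind: _ => //; [apply: dv_ge0 | move=> *; apply: dv_geD].
Qed.

Lemma dv_ge_all x : (forall j : nat, x \in dv_ge v j) -> x = 0.
Proof.
move=> xj; apply/eqP/negPn/negP => x0.
have := xj (absz (v x)).+1; rewrite in_dv_ge //; lia.
Qed.

Lemma dv_ge_1 : 1 \in dv_ge v 0.
Proof. by rewrite in_dv_ge ?oner_eq0 // dv1. Qed.

(** The Gauss valuation of [f] is at least [m]. *)
Definition pge m f := forall i, f`_i \in dv_ge v m.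

Lemma pgeD m f g : pge m f -> pge m g -> pge m (f + g).
Proof. by move=> fm gm i; rewrite coefD dv_geD. Qed.

Lemma pgeN m f : pge m f -> pge m (- f).
Proof. by move=> fm i; rewrite coefN dv_geN. Qed.

Lemma pgeB m f g : pge m f -> pge m g -> pge m (f - g).
Proof. by move=> fm gm; apply: pgeD => //; apply: pgeN. Qed.

Lemma pgeM m n f g : pge m f -> pge n g -> pge (m + n) (f * g).
Proof. by move=> fm gn i; rewrite coefM; apply: dv_ge_sum => j _; apply: dv_geM. Qed.

Lemma pge_le m n f : m <= n -> pge n f -> pge m f.
Proof. by move=> mn fn i; apply: dv_ge_le (fn i). Qed.

Lemma pge_1 : pge 0 1.
Proof. by move=> i; rewrite coef1; case: eqP => _; rewrite ?dv_ge_1 ?dv_ge0. Qed.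

(** Long division by a monic polynomial only multiplies and subtracts coefficients. *)
Lemma pge_divp m g u : g \is monic -> pge 0 g -> pge m u ->
  pge m (u %/ g) /\ pge m (u %% g).
Proof.
move=> gm g0; have [k] := ubnP (size u); elim: k u => // k IHk u ltuk um.
have [ltug|leug] := ltnP (size u) (size g).
  by rewrite divp_small // modp_small //; split => // i; rewrite coef0 dv_ge0.
have gn0 : g != 0 by apply: monic_neq0.
have sg : (0 < size g)%N by rewrite size_poly_gt0.
have un0 : u != 0 by rewrite -size_poly_gt0; apply: leq_trans leug.
pose q := lead_coef u *: 'X^(size u - size g) : {poly K}.
have qm : pge m q.
  move=> i; rewrite coefZ coefXn; case: eqP => _; rewrite ?mulr0 ?dv_ge0 //.
  by rewrite mulr1; apply: um.
have qn0 : q != 0 by rewrite scaler_eq0 lead_coef_eq0 (negPf un0) monic_neq0 ?monicXn.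
have sqg : size (q * g) = size u.
  rewrite size_proper_mul ?lead_coefZ ?lead_coefXn ?(monicP gm) ?mulr1 ?lead_coef_eq0 //.
  rewrite size_scale ?lead_coef_eq0 // size_polyXn; lia.
have lqg : lead_coef (q * g) = lead_coef u.
  by rewrite lead_coef_Mmonic // lead_coefZ lead_coefXn mulr1.
have su : (size (u - q * g)%R < size u)%N.
  rewrite -[X in (_ < X)%N](prednK (n := size u)) ?size_poly_gt0 // ltnS.
  apply/leq_sizeP => j lej; rewrite coefB.
  have [->|nej] := eqVneq j (size u).-1.
    by rewrite -lead_coefE -[in X in _ - X]sqg -lead_coefE lqg subrr.
  have ltj : (size u <= j)%N.
    by have := size_poly_gt0 u; rewrite un0; lia.
  by rewrite !nth_default ?subrr ?sqg.
have um' : pge m (u - q * g).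
  by apply: pgeB => //; rewrite -[m]addr0; apply: pgeM.
have [] := IHk _ _ um'; first by rewrite (leq_trans su).
move=> dm mm; rewrite -(subrK (q * g) u) modpD divpD modp_mull addr0 mulpK //.
by split => //; apply: pgeD.
Qed.

(** Division by [g] is additive, so the quotient of [f] differs from [h] by that of [u], and the
    remainder of [f] is that of [u]. *)
Lemma hensel_step m f g h u : g \is monic -> pge 0 g -> 1 <= m ->
    f = h * g + u -> pge 1 (1 - h) -> pge m u ->
  pge 1 (1 - f %/ g) /\ pge m (f %% g).
Proof.
move=> gm g0 m1 Df h1 um; have [dm mm] := pge_divp gm g0 um.
rewrite Df divpD modpD modp_mull add0r mulpK ?monic_neq0 //; split => //.
by rewrite opprD addrA; apply: pgeB => //; apply: pge_le dm.
Qed.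

(** Meant for [f] with monic reduction of degree [r], which is the starting divisor. A Newton step
    would add the remainder divided by the cofactor; the cofactor being congruent to 1, the
    remainder itself serves. *)
Fixpoint hensel_seq f (r j : nat) : {poly K} :=
  if j is i.+1 then hensel_seq f r i + f %% hensel_seq f r i
  else take_poly r f + 'X^r.

Section HenselFactor.
Hypothesis completeK : dv_complete v.
Variables (f : {poly K}) (r : nat).
Hypotheses (f0 : pge 0 f) (fr : f`_r = 1)
  (f1 : forall i, (r < i)%N -> f`_i \in dv_ge v 1).
Local Notation G := (hensel_seq f r).

Lemma hensel_seqP (j : nat) : [/\ G j \is monic, size (G j) = r.+1, pge 0 (G j),
  pge 1 (1 - f %/ G j) & pge j.+1 (f %% G j)].
Proof.
have mon (g : {poly K}) : (size g <= r)%N ->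
    (g + 'X^r \is monic) /\ size (g + 'X^r)%R = r.+1.
  move=> sg; have ltg : (size g < size ('X^r : {poly K}))%N by rewrite size_polyXn.
  by rewrite addrC monicE lead_coefDl // lead_coefXn size_polyDl // size_polyXn.
have Xr0 : pge 0 'X^r.
  by move=> i; rewrite coefXn; case: eqP => _; rewrite ?dv_ge_1 ?dv_ge0.
elim: j => [|j [gm sg g0 h1 rj]] /=.
  have [gm sg] := mon _ (size_take_poly r f).
  have g0 : pge 0 (take_poly r f + 'X^r).
    by apply: pgeD => // i; rewrite coef_take_poly; case: ifP => _ //; apply: dv_ge0.
  set g := _ + _ in gm sg g0 *.
  have h1 : pge 1 (1 - 1) by rewrite subrr => i; rewrite coef0 dv_ge0.
  have Df : f = 1 * g + (f - g) by rewrite mul1r addrC subrK.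
  have um : pge 1 (f - g).
    move=> i; rewrite coefB coefD coef_take_poly coefXn.
    have [ltir|ltri|->] := ltngtP i r.
    - by rewrite addr0 subrr dv_ge0.
    - by rewrite add0r subr0 f1.
    - by rewrite fr add0r subrr dv_ge0.
  by have [] := hensel_step gm g0 (lexx 1) Df h1 um.
have gn0 := monic_neq0 gm.
have sr : (size (f %% G j)%R <= r)%N by rewrite -ltnS -sg ltn_modp.
have gm' : G j + f %% G j \is monic.
  by rewrite monicE lead_coefDl ?(monicP gm) // sg.
have sg' : size (G j + f %% G j)%R = r.+1 by rewrite size_polyDl sg.
have g0' : pge 0 (G j + f %% G j) by apply: pgeD => //; apply: pge_le rj.
(* The new error is the old remainder times 1 minus the quotient, so its Gauss valuation grows by
   1. *)
have Df : f = (f %/ G j) * (G j + f %% G j) + ((f %% G j) * (1 - f %/ G j)).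
  by rewrite {1}(divp_eq f (G j)); ring.
have um : pge j.+2 ((f %% G j) * (1 - f %/ G j)).
  have -> : (j.+2 : int) = j.+1%:Z + 1 by rewrite -PoszD addn1.
  exact: pgeM.
have j1 : (1 : int) <= j.+2 by lia.
by have [] := hensel_step gm' g0' j1 Df h1 um.
Qed.

(** The divisors [G j] converge coefficientwise to [g], and the remainder of [f] modulo [g] has
    arbitrarily large valuation, hence vanishes. *)
Lemma hensel_factor : exists g, [/\ g \is monic, size g = r.+1 & g %| f].
Proof.
have GS j k : pge j.+1 (G (j + k)%N - G j).
  elim: k => [|k IHk]; first by rewrite addn0 subrr => i; rewrite coef0 dv_ge0.
  rewrite addnS /= addrAC; apply: pgeD => //.
  by have [_ _ _ _] := hensel_seqP (j + k); apply: pge_le; lia.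
have lim i : exists l : K, forall m : int, exists N, forall k, (N <= k)%N ->
    (G k)`_i - l \in dv_ge v m.
  apply: completeK => m; exists (absz m) => k1 k2 le1 le2.
  have H k : (absz m <= k)%N -> (G k)`_i - (G (absz m))`_i \in dv_ge v m.
    move=> lek; rewrite -coefB -(subnKC lek).
    by apply: pge_le (GS _ _) _; lia.
  have -> : (G k1)`_i - (G k2)`_i =
            ((G k1)`_i - (G (absz m))`_i) - ((G k2)`_i - (G (absz m))`_i) by ring.
  by apply: dv_geB; apply: H.
have [l lP] := choice lim.
pose g := \poly_(i < r) l i + 'X^r.
have gG (j : nat) : pge j.+1 (g - G j).
  move=> i; have [N NP] := lP i j.+1.
  have [gm sg _ _ _] := hensel_seqP j.
  rewrite coefB coefD coef_poly coefXn.
  have [ltir|ltri|->] := ltngtP i r.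
  - rewrite addr0.
    have -> : l i - (G j)`_i = ((G (j + N)%N)`_i - (G j)`_i) - ((G (j + N)%N)`_i - l i) by ring.
    by apply: dv_geB; [rewrite -coefB; apply: (GS j N) | apply: NP; rewrite leq_addl].
  - by rewrite nth_default ?sg // add0r subr0 dv_ge0.
  - by have := monicP gm; rewrite lead_coefE sg /= => ->; rewrite add0r subrr dv_ge0.
have sg : (size (\poly_(i < r) l i) < size ('X^r : {poly K}))%N.
  by rewrite size_polyXn ltnS size_poly.
have gm : g \is monic by rewrite monicE /g addrC lead_coefDl ?lead_coefXn.
have g0 : pge 0 g.
  rewrite -(subrK (G 0%N) g); apply: pgeD; first exact: pge_le (gG 0%N).
  by have [] := hensel_seqP 0.
exists g; split=> //; first by rewrite /g addrC size_polyDl // size_polyXn.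
apply/modp_eq0P/polyP => i; rewrite coef0; apply: dv_ge_all => j.
have [_ _ _ h1 rj] := hensel_seqP j.
have h0 : pge 0 (f %/ G j).
  rewrite -[_ %/ _](subKr 1); apply: pgeB; first exact: pge_1.
  exact: pge_le h1.
have Df : f = (f %/ G j) * g + ((f %/ G j) * - (g - G j) + f %% G j).
  by rewrite {1}(divp_eq f (G j)); ring.
rewrite Df modpD modp_mull add0r.
have um : pge j ((f %/ G j) * - (g - G j) + f %% G j).
  apply: pgeD; last by apply: pge_le rj; lia.
  by rewrite -[j%:Z]add0r; apply: pgeM => //; apply: pgeN; apply: pge_le (gG j); lia.
by have [_] := pge_divp gm g0 um; apply.
Qed.
End HenselFactor.

(** Otherwise the least valuation of a coefficient is negative. Scaling it to 0 gives a polynomial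
    whose reduction has a degree [r] other than 0, the constant term being integral, and other than
    the degree of [f], the leading coefficient being 1. Hensel's lemma then yields a proper factor
    of degree [r]. *)
Lemma irreducible_integral f : dv_complete v -> f \is monic -> irreducible_poly f ->
  f`_0 \in dv_ring v -> pge 0 f.
Proof.
move=> completeK fm [sf firr] f00.
have fn0 := monic_neq0 fm.
have lastP : ((size f).-1 < size f)%N by rewrite ltn_predL ltnW.
have lf : f`_(size f).-1 = 1 by rewrite -lead_coefE (monicP fm).
pose P (i : 'I_(size f)) := f`_i != 0.
have P0 : P (Ordinal lastP) by rewrite /P /= lf oner_eq0.
case: (@arg_minP _ _ _ (Ordinal lastP) P (fun i => v f`_i) P0) => i0 Pi0 min0.
(* The last index of minimal valuation: after scaling, all later coefficients lie in the maximal
   ideal. *)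
pose Q r := (r < size f)%N && (f`_r != 0) && (v f`_r == v f`_i0).
have exQ : exists r, Q r by exists i0; rewrite /Q ltn_ord [_ != 0]Pi0 eqxx.
have bQ r : Q r -> (r <= size f)%N by case/andP=> /andP[/ltnW].
case: (ex_maxnP exQ bQ) => r /andP[/andP[ltr fr] /eqP vr] maxr.
have minr k : f`_k != 0 -> v f`_r <= v f`_k.
  move=> fk; rewrite vr; have ltk : (k < size f)%N.
    by rewrite ltnNge; apply: contra fk => lek; rewrite nth_default.
  exact: (min0 (Ordinal ltk)).
case: (lerP 0 (v f`_r)) => [vr0 i|vr0].
  have [->|fi] := eqVneq f`_i 0; first exact: dv_ge0.
  by rewrite in_dv_ge // (le_trans vr0) ?minr.
have [g [gm sg gf]] : exists g, [/\ g \is monic, size g = r.+1 & g %| (f`_r)^-1 *: f].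
  apply: hensel_factor => // [i||i ltri]; rewrite coefZ ?mulVf //.
  - have [->|fi] := eqVneq f`_i 0; first by rewrite mulr0 dv_ge0.
    rewrite in_dv_ge ?mulf_neq0 ?invr_eq0 // dvM ?invr_eq0 // dvV // addrC subr_ge0.
    exact: minr.
  - have [->|fi] := eqVneq f`_i 0; first by rewrite mulr0 dv_ge0.
    rewrite in_dv_ge ?mulf_neq0 ?invr_eq0 // dvM ?invr_eq0 // dvV //.
    have := minr i fi; rewrite le_eqVlt => /orP[/eqP Ev|]; last lia.
    have /maxr : Q i; last by rewrite leqNgt ltri.
    rewrite /Q fi -Ev vr eqxx !andbT ltnNge.
    by apply: contra fi => lek; rewrite nth_default.
rewrite dvdpZr ?invr_eq0 // in gf.
have r0 : r != 0%N.
  apply: contraTneq f00 => r0; rewrite r0 in fr vr0.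
  by rewrite [_ \in _]in_dv_ge // -ltNge.
have sg1 : size g != 1%N by rewrite sg eqSS.
have := eqp_size (firr g sg1 gf); rewrite sg => Er.
have Er' : r = (size f).-1 by rewrite -Er.
by move: vr0; rewrite Er' lf dv1 ltxx.
Qed.

End DiscreteValuation.

Section NormValuation.
Variables (K : fieldType) (v : discrete_valuation K) (L : splittingFieldType K).
Hypotheses (completeK : dv_complete v) (galL : galois 1 {:L}).
Local Notation G := ('Gal({:L} / 1))%g.
Local Notation N := (galNorm 1 {:L}).
Implicit Types (x y : L) (g : gal_of {:L}).

Lemma in_alg_inj : injective (in_alg L).
Proof. exact: fmorph_inj. Qed.

Lemma alg_eq0 (a : K) : (a%:A == 0 :> L) = (a == 0).
Proof. exact: (fmorph_eq0 (in_alg L)). Qed.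

Lemma gal_in_alg g (a : K) : g a%:A = a%:A.
Proof. by rewrite linearZ /= rmorph1. Qed.

Lemma mem_gal1 g : g \in G.
Proof. by rewrite gal_kHom ?sub1v // k1HomE ahomWin. Qed.

Lemma galNorm_ex x : exists a : K, N x = a%:A.
Proof.
have := mem_galNorm galL (memvf x).
by move/vlineP => [a ->]; exists a.
Qed.
Definition normK x : K := projT1 (cid (galNorm_ex x)).
Lemma normKE x : (normK x)%:A = N x.
Proof. by rewrite /normK; case: cid. Qed.

Lemma normKM x y : normK (x * y) = normK x * normK y.
Proof.
by apply: in_alg_inj; rewrite rmorphM /= !normKE galNormM.
Qed.

Lemma normK_eq0 x : (normK x == 0) = (x == 0).
Proof. by rewrite -(galNorm_eq0 1 {:L}) -normKE alg_eq0. Qed.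

Lemma normK_gal x g : normK (g x) = normK x.
Proof. by apply: in_alg_inj; rewrite /= !normKE galNorm_gal ?mem_gal1 ?sub1v ?memvf. Qed.

Lemma normK_alg (a : K) : normK a%:A = a ^+ #|G|.
Proof.
apply: in_alg_inj; rewrite rmorphXn /= normKE /galNorm.
rewrite (eq_bigr (fun=> a%:A)) => [|g _]; last exact: gal_in_alg.
by rewrite prodr_const.
Qed.

Lemma normKN x : normK (- x) = (-1) ^+ #|G| * normK x.
Proof. by rewrite -[- x]mulN1r -scaleN1r normKM normK_alg. Qed.

Lemma galois_minpoly x : exists q : {poly K}, exists r : seq (gal_of {:L}),
  [/\ q \is monic, irreducible_poly q,
      map_poly (in_alg L) q = \prod_(g <- r) ('X - (g x)%:P) & (0 < size r)%N].
Proof.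
have /(galois_factors (sub1v _)) /(_ x (memvf x)) [r [_ _ Dq]] := galL.
have /polyOver1P[q Eq] := minPolyOver 1 x.
have qm : q \is monic by rewrite -(map_monic (in_alg L)) -Eq monic_minPoly.
have sr : (0 < size r)%N.
  rewrite lt0n; apply: contraTneq (root_minPoly 1 x) => /size0nil r0.
  by rewrite Dq r0 big_nil root1.
exists q, r; split=> //; last by rewrite -Eq Dq big_map.
have sq : size q = (size r).+1.
  by rewrite -(size_map_poly (in_alg L)) -Eq Dq size_prod_XsubC size_map.
split=> [|u su uq]; first by rewrite sq ltnS.
have un0 : u != 0 by apply: contraTneq uq => ->; rewrite dvd0p monic_neq0.
have := @minPoly_irr _ _ 1%AS x (map_poly (in_alg L) u).
rewrite Eq dvdp_map uq => /(_ _ isT) /orP[]; first by apply/polyOver1P; exists u.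
  by rewrite eqp_map.
by rewrite -size_poly_eq1 size_map_poly (negPf su).
Qed.

(** Each factor of [q] at [c] is a conjugate of c - x and has the same norm, while the norm of the
    scalar [q.[c]] is its power of exponent #|G|. Valuations of values of [q] are thus read off
    norms. *)
Lemma minpoly_normK x (q : {poly K}) (r : seq (gal_of {:L})) (c : K) :
    map_poly (in_alg L) q = \prod_(g <- r) ('X - (g x)%:P) ->
  q.[c] ^+ #|G| = normK (c%:A - x) ^+ size r.
Proof.
move=> Dq; have Eq : (q.[c])%:A = (map_poly (in_alg L) q).[c%:A].
  by rewrite (horner_map (in_alg L)).
rewrite -normK_alg Eq Dq.
rewrite horner_prod (big_morph normK normKM (id1 := 1)); last first.
  by apply: in_alg_inj; rewrite /= normKE galNorm1 scale1r.
rewrite (eq_bigr (fun=> normK (c%:A - x))) => [|g _].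
  by rewrite big_const_seq count_predT iter_mulr_1.
by rewrite !hornerE -(normK_gal (_ - x) g) rmorphB /= gal_in_alg.
Qed.

(** By [minpoly_normK] at 0, the constant coefficient of the minimal polynomial has a valuation of
    the same sign as the norm of [x]; [irreducible_integral] then gives the other coefficients. *)
Lemma normK_integral x : x != 0 -> 0 <= v (normK x) ->
  exists q : {poly K}, exists r : seq (gal_of {:L}),
   [/\ q \is monic, pge v 0 q,
       map_poly (in_alg L) q = \prod_(g <- r) ('X - (g x)%:P) & (0 < size r)%N].
Proof.
move=> x0 vx; have [q [r [qm qi Dq sr]]] := galois_minpoly x.
exists q, r; split => //; apply: irreducible_integral => //.
have := minpoly_normK 0 Dq; rewrite scale0r sub0r horner_coef0 => Eq.
rewrite unfold_in; have [//|q0 /=] := eqVneq q`_0 0.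
have := congr1 v Eq; rewrite !dvX // ?normK_eq0 ?oppr_eq0 //.
rewrite normKN dvM ?normK_eq0 ?expf_neq0 ?oppr_eq0 ?oner_neq0 // dvX ?oppr_eq0 ?oner_neq0 //.
rewrite dvN1 mul0rn add0r => Ev.
by rewrite -(pmulrn_lge0 _ (cardG_gt0 G)) // Ev mulrn_wge0.
Qed.

(** The ultrametric inequality reduces to this case. The minimal polynomial of [x] is integral,
    hence so is its value at -1, whose valuation has the sign of that of the norm of 1 + x. *)
Lemma normK_ge0D1 x : x != 0 -> 1 + x != 0 -> 0 <= v (normK x) -> 0 <= v (normK (1 + x)).
Proof.
move=> x0 x10 vx; have [q [r [qm qO Dq sr]]] := normK_integral x0 vx.
have := minpoly_normK (-1) Dq; rewrite scaleN1r -opprD.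
rewrite normKN.
have q10 : q.[-1] \in dv_ge v 0.
  rewrite horner_coef; apply: dv_ge_sum => i _.
  have := @dv_geM _ v 0 0 q`_i ((-1) ^+ i) (qO i); rewrite addr0; apply.
  rewrite in_dv_ge ?expf_neq0 ?oppr_eq0 ?oner_eq0 //.
  by rewrite dvX ?oppr_eq0 ?oner_eq0 // dvN1 mul0rn.
have n0 : (-1) ^+ #|G| * normK (1 + x) != 0.
  by rewrite mulf_neq0 ?normK_eq0 // expf_neq0 ?oppr_eq0 ?oner_neq0.
move=> Eq; have qn0 : q.[-1] != 0.
  by apply: contraNneq (expf_neq0 (size r) n0) => q0; rewrite -Eq q0 expr0n eqn0Ngt cardG_gt0.
have := congr1 v Eq; rewrite !dvX //.
rewrite dvM ?normK_eq0 ?expf_neq0 ?oppr_eq0 ?oner_neq0 // dvX ?oppr_eq0 ?oner_neq0 //.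
rewrite dvN1 mul0rn add0r => Ev.
move: q10; rewrite in_dv_ge // => q10.
by rewrite -(pmulrn_lge0 _ sr) // -Ev mulrn_wge0.
Qed.

(** The valuations of norms form a nonzero subgroup of the integers, and [c] is its least positive
    element. *)
Lemma norm_value_ex : exists c : nat, (0 < c)%N /\
  (exists2 x0, x0 != 0 & v (normK x0) = c%:Z) /\
  (forall x, x != 0 -> exists k : int, v (normK x) = k * c%:Z).
Proof.
pose P (c : nat) := `[< (0 < c)%N /\ exists2 x0, x0 != 0 & v (normK x0) = c%:Z >].
have exP : exists c, P c.
  have [a a0 va] := dv_surj v; exists #|G|; apply/asboolP; rewrite cardG_gt0; split=> //.
  by exists a%:A; rewrite ?alg_eq0 // normK_alg dvX // va; lia.
case: (ex_minnP exP) => c /asboolP[c0 [x0 x00 vx0]] minc.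
exists c; split=> //; split; first by exists x0.
move=> x xn0; exists (v (normK x) %/ c)%Z.
have xy m : exists2 y, y != 0 & v (normK y) = m * c%:Z.
  case: m => m.
    exists (x0 ^+ m); rewrite ?expf_neq0 //.
    have -> : normK (x0 ^+ m) = normK x0 ^+ m.
      by apply: in_alg_inj; rewrite rmorphXn /= !normKE galNormX.
    by rewrite dvX ?normK_eq0 // vx0; lia.
  exists (x0 ^- m.+1); rewrite ?invr_eq0 ?expf_neq0 //.
  have -> : normK (x0 ^- m.+1) = normK x0 ^- m.+1.
    by apply: in_alg_inj; rewrite fmorphV rmorphXn /= !normKE galNormV galNormX.
  by rewrite dvV ?expf_neq0 ?normK_eq0 // dvX ?normK_eq0 // vx0; lia.
have [y y0 vy] := xy (- (v (normK x) %/ c)%Z).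
have Dv : v (normK (x * y)) = (v (normK x) %% c)%Z.
  by rewrite normKM dvM ?normK_eq0 // vy; have := divz_eq (v (normK x)) c; lia.
rewrite {1}(divz_eq (v (normK x)) c).
have m0 : 0 <= (v (normK x) %% c)%Z by rewrite modz_ge0 //; lia.
have ltm : (v (normK x) %% c)%Z < c by rewrite ltz_pmod //; lia.
case E : (v (normK x) %% c)%Z m0 ltm Dv => [[|m]|m] // _ ltm Dv; first by rewrite addr0.
have /minc : P m.+1 by apply/asboolP; split=> //; exists (x * y); rewrite ?mulf_neq0.
by lia.
Qed.

(* Dividing v o N by its positive generator normalizes it. *)
Lemma galois_valuation : exists w : discrete_valuation L,
  [/\ forall g x, w (g x) = w x,
      forall (m : int) (a : K), 0 <= m <= 1 -> (a%:A \in dv_ge w m) = (a \in dv_ge v m)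
    & forall x, x \in dv_ring w ->
        exists q : {poly K}, exists r : seq (gal_of {:L}),
        [/\ q \is monic, pge v 0 q,
          map_poly (in_alg L) q = \prod_(g <- r) ('X - (g x)%:P) & (0 < size r)%N]].
Proof.
have [c [c0 [[x0 x00 vx0] cP]]] := norm_value_ex.
pose w x := (v (normK x) %/ c)%Z.
have cn0 : c%:Z != 0 by lia.
have wE x : x != 0 -> v (normK x) = w x * c%:Z.
  by move=> /cP[k Dk]; rewrite /w Dk mulzK.
have wM x y : x != 0 -> y != 0 -> w (x * y) = w x + w y.
  move=> xn0 yn0; apply: (mulIf cn0); rewrite mulrDl -!wE ?mulf_neq0 //.
  by rewrite normKM dvM ?normK_eq0.
have w0 x : x != 0 -> (0 <= w x) = (0 <= v (normK x)).
  by move=> xn0; rewrite wE // pmulr_lge0 //; lia.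
have wD' x y : x != 0 -> y != 0 -> x + y != 0 -> w x <= w y -> w x <= w (x + y).
  move=> xn0 yn0 xy0 lexy.
  have Dxy : x + y = x * (1 + y / x) by rewrite mulrDr mulr1 mulrCA divff // mulr1.
  have yx0 : y / x != 0 by rewrite mulf_neq0 ?invr_eq0.
  have yx10 : 1 + y / x != 0 by apply: contraNneq xy0 => E; rewrite Dxy E mulr0.
  have : 0 <= w (y / x).
    have := wM _ _ xn0 yx0; rewrite mulrCA divff // mulr1; lia.
  rewrite w0 // => /(normK_ge0D1 yx0 yx10); rewrite -w0 // => H.
  by rewrite Dxy wM // lerDl.
have wD x y : x != 0 -> y != 0 -> x + y != 0 -> Num.min (w x) (w y) <= w (x + y).
  move=> xn0 yn0 xy0; have [lexy|/ltW leyx] := leP (w x) (w y); first exact: wD'.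
  by rewrite addrC; apply: wD' => //; rewrite addrC.
have wsurj : exists2 x, x != 0 & w x = 1.
  by exists x0 => //; rewrite /w vx0 divzz cn0.
exists (DiscreteValuation wM wD wsurj); split=> /=.
- by move=> g x; rewrite /w normK_gal.
(* On [K], [w] is a positive multiple of [v], the factor being the ramification index. Only the
   thresholds 0 and 1, that is nonnegative and positive, are preserved. *)
- move=> m a /andP[m0 m1]; rewrite !unfold_in /= alg_eq0.
  have [//|a0 /=] := eqVneq a 0.
  have := wE a%:A; rewrite alg_eq0 => /(_ a0); rewrite normK_alg dvX // => E.
  have G0 : (0 < #|G|%:Z)%R by rewrite ltz_nat cardG_gt0.
  rewrite -mulr_natr natz in E; have c0' : (0 < c%:Z)%R by lia.
  have [->|->] : m = 0 \/ m = 1 by case: (m) m0 m1 => [[|[|k]]|k] //; [left|right].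
    by rewrite -(pmulr_lge0 _ c0') -E pmulr_lge0.
  by rewrite -!gtz0_ge1 -(pmulr_lgt0 _ c0') -E pmulr_lgt0.
- move=> x; rewrite unfold_in /dv_ge /=.
  have [-> _|xn0 /=] := eqVneq x 0.
    exists 'X, [:: 1%g]; split; rewrite ?monicX //.
    + move=> i; rewrite coefX; case: eqP => _; rewrite ?dv_ge0 //.
      exact: dv_ge_1.
    + by rewrite map_polyX big_cons big_nil mulr1 rmorph0 subr0.
  by rewrite w0 // => /(normK_integral xn0).
Qed.
End NormValuation.

(** * Residue fields *)

(* A residue field of the valuation is presented by a map defined on the whole
   of [K]; only its values on the valuation ring are meaningful. *)
Definition is_residue_map (K : fieldType) (v : discrete_valuation K)
    (k : nzRingType) (red : K -> k) : Prop :=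
  [/\ red 1 = 1,
      {in dv_ring v &, {morph red : x y / x + y}},
      {in dv_ring v &, {morph red : x y / x * y}},
      {in dv_ring v, forall x, (red x == 0) = (x \in dv_ge v 1)}
    & forall a, exists2 x, x \in dv_ring v & red x = a].

Section ResidueMap.
Local Open Scope quotient_scope.
Variables (K : fieldType) (v : discrete_valuation K).
Local Notation R := (residue_ring v).

Let redR (x : K) : R :=
  if (insub x : option (val_ring v)) is Some a then \pi_R a else 0.

Let redRE x (xO : x \in dv_ring v) : redR x = \pi_R (ValRing xO).
Proof. by rewrite /redR insubT. Qed.

Let redR_map : is_residue_map v redR.
Proof.
have O1 : (1 : K) \in dv_ring v by exact: rpred1.
split=> [|x y xO yO|x y xO yO|x xO|a].
- rewrite (redRE O1); have -> : ValRing O1 = 1 by apply: val_inj.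
  by rewrite rmorph1.
- rewrite (redRE (rpredD xO yO)) (redRE xO) (redRE yO) -rmorphD.
  by congr (\pi _); apply: val_inj.
- rewrite (redRE (rpredM xO yO)) (redRE xO) (redRE yO) -rmorphM.
  by congr (\pi _); apply: val_inj.
- by rewrite (redRE xO) -[0](rmorph0 (\pi_R)) -Quotient.idealrBE subr0.
- by elim/quotW: a => [[x xO]]; exists x => //; rewrite redRE.
Qed.

Let R_inv_ex (a : R) : exists b, (a != 0 -> b * a = 1) /\ (a = 0 -> b = 0).
Proof.
have [r1 _ rM r0 rs] := redR_map.
have [->|a0] := eqVneq a 0; first by exists 0.
have [x xO Dx] := rs a; exists (redR x^-1); split=> [_|/eqP]; last by rewrite (negPf a0).
have x0 : x != 0.
  by apply: contraNneq a0 => x0; rewrite -Dx x0 r0 ?dv_ge0 // rpred0.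
have vx : v x = 0.
  have := xO; rewrite [_ \in _]in_dv_ge // => vx0.
  have := a0; rewrite -Dx r0 // in_dv_ge //; lia.
have xVO : x^-1 \in dv_ring v by rewrite [_ \in _]in_dv_ge ?invr_eq0 // dvV // vx.
by rewrite -Dx -rM // mulVf.
Qed.

(** A nonzero residue lifts to an element of valuation 0, whose inverse is integral; this turns the
    residue ring into a field. *)
Lemma residue_field_ex : exists (k : fieldType) (red : K -> k),
  [/\ is_residue_map v red, [pchar k] =i [pchar R]
    & finite_set [set: R]%classic -> exists s : seq k, forall a, a \in s].
Proof.
have [inv invP] := choice R_inv_ex.
have invl a : a != 0 -> inv a * a = 1 by have [] := invP a.
have inv0 : inv 0 = 0 by have [_ ->] := invP 0.
pose F : fieldType := HB.pack R (GRing.ComNzRing_isField.Build R invl inv0).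
exists F, (redR : K -> F); split=> //.
case/finite_seqP=> s Ds; exists s => a.
by have : [set: R]%classic a by []; rewrite Ds.
Qed.

Lemma finite_residue_field (k : fieldType) (red : K -> k) (s : seq k) :
    is_residue_map v red -> (forall a, a \in s) ->
  exists (F : finFieldType) (red' : K -> F),
    is_residue_map v red' /\ [pchar F] =i [pchar k].
Proof.
move=> redP sP.
have pK : pcancel (index^~ s) (onth s).
  by move=> x; rewrite onthE (nth_map x) ?index_mem // nth_index.
have enumP : Finite.axiom (undup s).
  by move=> x; rewrite count_uniq_mem ?undup_uniq // mem_undup sP.
pose F : finFieldType := HB.pack k (Choice_isCountable.Build k pK) (isFinite.Build k enumP).
by exists F, (red : K -> F).
Qed.

Section Theory.
Variables (k : nzRingType) (red : K -> k).
Hypothesis redP : is_residue_map v red.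
Local Notation O := (dv_ring v).

Lemma red1 : red 1 = 1. Proof. by case: redP. Qed.
Lemma redD : {in O &, {morph red : x y / x + y}}. Proof. by case: redP. Qed.
Lemma redM : {in O &, {morph red : x y / x * y}}. Proof. by case: redP. Qed.
Lemma red_eq0 x : x \in O -> (red x == 0) = (x \in dv_ge v 1).
Proof. by case: redP => _ _ _ H _; apply: H. Qed.
Lemma red_surj a : exists2 x, x \in O & red x = a.
Proof. by case: redP. Qed.
Lemma red0 : red 0 = 0. Proof. by apply/eqP; rewrite red_eq0 ?rpred0 // dv_ge0. Qed.
Lemma redN x : x \in O -> red (- x) = - red x.
Proof.
move=> xO; apply/eqP; rewrite -subr_eq0 opprK -redD ?rpredN //.
by rewrite addNr red0.
Qed.
Lemma redB : {in O &, {morph red : x y / x - y}}.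
Proof. by move=> x y xO yO; rewrite redD ?rpredN // redN. Qed.
Lemma redX x n : x \in O -> red (x ^+ n) = red x ^+ n.
Proof.
move=> xO; elim: n => [|n IHn]; first by rewrite !expr0 red1.
by rewrite !exprS redM ?rpredX // IHn.
Qed.
Lemma red_nat n : red n%:R = n%:R.
Proof.
elim: n => [|n IHn]; first exact: red0.
by rewrite !mulrS redD ?rpred1 ?rpred_nat // red1 IHn.
Qed.
Lemma red_sum (I : Type) (r : seq I) (F : I -> K) : (forall i, F i \in O) ->
  red (\sum_(i <- r) F i) = \sum_(i <- r) red (F i).
Proof.
move=> FO; elim: r => [|i r IHr]; first by rewrite !big_nil red0.
by rewrite !big_cons redD ?IHr ?rpred_sum.
Qed.
Lemma red_eq x y : x \in O -> y \in O -> (red x == red y) = (x - y \in dv_ge v 1).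
Proof. by move=> xO yO; rewrite -subr_eq0 -redB // red_eq0 // rpredB. Qed.
Lemma red_unit x : x != 0 -> v x = 0 -> x \in O /\ red x != 0.
Proof.
move=> x0 vx; have xO : x \in O by rewrite [_ \in _]in_dv_ge // vx.
by split=> //; rewrite red_eq0 // in_dv_ge // vx.
Qed.
End Theory.

Lemma red_prod_XsubC (k : comNzRingType) (red : K -> k) (s : seq K) :
    is_residue_map v red -> (forall x, x \in s -> x \in dv_ring v) ->
  forall i, (\prod_(x <- s) ('X - x%:P))`_i \in dv_ring v /\
    (\prod_(x <- s) ('X - (red x)%:P))`_i = red (\prod_(x <- s) ('X - x%:P))`_i.
Proof.
move=> redP; elim: s => [|x s IHs] sO i.
  rewrite !big_nil !coef1; case: eqP => _; first by rewrite rpred1 (red1 redP).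
  by rewrite rpred0 (red0 redP).
have xO : x \in dv_ring v by apply: sO; rewrite mem_head.
have {}IHs := IHs (fun y ys => sO y (mem_behead (ys : y \in behead (x :: s)))).
rewrite !big_cons !mulrBl !coefB !coefXM !coefCM.
have [iO Ei] := IHs i; have [i1O Ei1] := IHs i.-1.
case: (i == 0)%N.
  by rewrite !sub0r Ei rpredN rpredM // (redN redP) ?rpredM // (redM redP).
rewrite rpredB ?rpredM // Ei Ei1; split=> //.
by rewrite (redB redP) ?rpredM // (redM redP).
Qed.
End ResidueMap.

Lemma pchar_expBn (F : fieldType) p (n : nat) : p \in [pchar F] ->
  {morph (fun x : F => x ^+ (p ^ n)) : x y / x - y}.
Proof.
move=> pF x y; elim: n => [|n IHn]; first by rewrite expn0 !expr1.
by rewrite expnSr !exprM IHn -!(pFrobenius_autE pF) rmorphB.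
Qed.

Lemma pchar_expDn (F : fieldType) p (n : nat) : p \in [pchar F] ->
  {morph (fun x : F => x ^+ (p ^ n)) : x y / x + y}.
Proof.
move=> pF x y; elim: n => [|n IHn]; first by rewrite expn0 !expr1.
by rewrite expnSr !exprM IHn -!(pFrobenius_autE pF) rmorphD.
Qed.

Lemma pchar_exp_inj (F : fieldType) p (n : nat) : p \in [pchar F] ->
  injective (fun x : F => x ^+ (p ^ n)).
Proof.
move=> pF x y /eqP; rewrite -subr_eq0 -(pchar_expBn n pF) expf_eq0.
by case/andP=> _; rewrite subr_eq0 => /eqP.
Qed.

(** Repetition-free lists have length at most the size of [P], and a longest one exhausts [F]. *)
Lemma roots_enum (F : fieldType) (P : {poly F}) : P != 0 -> (forall a, root P a) ->
  exists s : seq F, forall a, a \in s.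
Proof.
move=> P0 rP.
pose Q (n : nat) := `[< exists2 s : seq F, uniq s & size s = n >].
have exQ : exists n, Q n by exists 0%N; apply/asboolP; exists [::].
have bQ n : Q n -> (n <= size P)%N.
  move/asboolP=> [s us <-]; apply/ltnW/max_poly_roots => //.
  by apply/allP => a _; apply: rP.
case: (ex_maxnP exQ bQ) => n /asboolP[s us ss] maxn.
exists s => a; apply/negPn/negP => as_.
have : Q n.+1 by apply/asboolP; exists (a :: s); rewrite /= ?as_ ?us ?ss.
by move/maxn; rewrite ltnn.
Qed.

Lemma dv_ring_in_alg (K : fieldType) (v : discrete_valuation K) (L : splittingFieldType K)
    (w : discrete_valuation L) :
    (forall (m : int) (a : K), 0 <= m <= 1 -> (a%:A \in dv_ge w m) = (a \in dv_ge v m)) ->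
  forall a, (a%:A \in dv_ring w) = (a \in dv_ring v).
Proof. by move=> wv a; apply: wv. Qed.

(* The Frobenius of the finite residue field of K maps a residue class to one
   of its finitely many conjugates, so some bounded power of it is trivial. *)
Lemma galois_residue_field (p : nat) (K : fieldType) (v : discrete_valuation K)
    (L : splittingFieldType K) :
    dv_complete v -> finite_set [set: residue_ring v]%classic ->
    p \in [pchar residue_ring v] -> galois 1 {:L} ->
  exists (w : discrete_valuation L) (k : finFieldType) (red : L -> k),
    [/\ forall (g : gal_of {:L}) x, w (g x) = w x, is_residue_map w red & p \in [pchar k]].
Proof.
move=> cv fv pv galL; have [w [wg wv wi]] := galois_valuation cv galL.
have [k0 [redk0 [redk0P pk0 /(_ fv) [s sP]]]] := residue_field_ex v.
have [k [redk [redkP pk]]] := finite_residue_field redk0P sP.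
have {}pk : p \in [pchar k] by rewrite pk pk0.
have [l [red [redP _ _]]] := residue_field_ex w.
have pp : prime p by move: pk; rewrite inE => /andP[].
have nO (n : nat) : n%:R \in dv_ring v by apply: rpred_nat.
have nOL (n : nat) : n%:R \in dv_ring w by apply: rpred_nat.
have pl : p \in [pchar l].
  rewrite inE pp -(red_nat redP) (red_eq0 redP) //.
  rewrite -(scaler_nat p (1 : L)) wv // -(red_eq0 redkP) // (red_nat redkP).
  by rewrite (pcharf0 pk) eqxx.
have [q pq cq] : exists2 a : nat, (0 < a)%N & #|k| = (p ^ a)%N.
  exists (logn p #|k|); last exact: (card_pprimeChar (pk : p \in [pchar k])).
  rewrite lt0n; apply: contraTneq (finNzRing_gt1 k) => E.
  by rewrite (card_pprimeChar (pk : p \in [pchar k])) E.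
pose Q := (p ^ q)%N.
have redk_frob a : a \in dv_ring v -> a ^+ Q - a \in dv_ge v 1.
  move=> aO; rewrite -(red_eq redkP) ?rpredX // (redX redkP) //.
  by rewrite /Q -cq expf_card.
have frob1 x : x \in dv_ring w -> exists g : gal_of {:L}, red x ^+ Q = red (g x).
  move=> xO; have [P [r [Pm PO DP sr]]] := wi x xO.
  pose s' := [seq (g : gal_of {:L}) x | g <- r].
  have s'O y : y \in s' -> y \in dv_ring w.
    by case/mapP=> g _ ->; move: xO; rewrite !unfold_in /dv_ge /= wg fmorph_eq0.
  pose T := \prod_(y <- s') ('X - (red y)%:P).
  have coefT i : T`_i = red (P`_i)%:A.
    have [_ ->] := red_prod_XsubC redP s'O i.
    by rewrite big_map -DP coef_map.
  (* The coefficients of [T] are residues of elements of [K], fixed by the power map of exponent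
     [Q]; that map therefore sends roots of [T] to roots of [T]. *)
  have Tfrob (y : l) : T.[y ^+ Q] = T.[y] ^+ Q.
    rewrite !horner_coef -/(pFrobenius_aut pl).
    have sumQ (F : 'I_(size T) -> l) : (\sum_i F i) ^+ Q = \sum_i F i ^+ Q.
      apply: (big_morph (fun z : l => z ^+ Q)) => [a b|].
        exact: (pchar_expDn q pl).
      by rewrite expr0n expn_eq0 eqn0Ngt prime_gt0.
    rewrite sumQ; apply: eq_bigr => i _; rewrite exprMn -!exprM mulnC; congr (_ * _).
    rewrite coefT -(redX redP); last by rewrite (dv_ring_in_alg wv); apply: PO.
    have PiO : (P`_i)%:A \in dv_ring w by rewrite (dv_ring_in_alg wv) //; apply: PO.
    apply/esym/eqP; rewrite (red_eq redP) ?rpredX //.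
    have -> : (P`_i)%:A ^+ Q - (P`_i)%:A = (P`_i ^+ Q - P`_i)%:A :> L.
      by rewrite scalerBl exprZn expr1n.
    by rewrite wv // redk_frob //; apply: PO.
  have rootT y : y \in s' -> root T (red y).
    move=> ys; rewrite /T -(big_map red xpredT (fun z => 'X - z%:P)).
    by rewrite root_prod_XsubC map_f.
  (* some conjugate of x is a root of T, hence so is x itself *)
  have xT : root T (red x).
    have : root (map_poly (in_alg L) P) x.
      case: (r) DP sr => [//|g r'] DP _.
      have := root_prod_XsubC [seq (h : gal_of {:L}) x | h <- g :: r'] (g x).
      rewrite big_map -DP mem_head rootE => /eqP E.
      rewrite rootE -(fmorph_eq0 g) -horner_map /=.
      rewrite -map_poly_comp (eq_map_poly (g := in_alg L)) ?E // => a /=.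
      exact: gal_in_alg.
    rewrite DP -(big_map (fun g : gal_of {:L} => g x) xpredT (fun z => 'X - z%:P)).
    by rewrite root_prod_XsubC => /rootT.
  have : root T (red x ^+ Q) by rewrite rootE Tfrob (eqP xT) expr0n expn_eq0 eqn0Ngt prime_gt0.
  rewrite /T -(big_map red xpredT (fun z => 'X - z%:P)) root_prod_XsubC.
  by case/mapP=> _ /mapP[g _ ->] ->; exists g.
pose G := #|{: gal_of {:L}}|.
have frobn x i : x \in dv_ring w -> exists g : gal_of {:L}, red x ^+ (Q ^ i) = red (g x).
  move=> xO; elim: i => [|i [g IHi]].
    by exists 1%g; rewrite expn0 expr1 gal_id.
  have gxO : g x \in dv_ring w by move: xO; rewrite !unfold_in /dv_ge /= wg fmorph_eq0.
  have [h Dh] := frob1 _ gxO.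
  by exists (g * h)%g; rewrite expnSr exprM IHi Dh galM ?memvf.
have Q1 : (1 < Q)%N by rewrite /Q -(exp1n q) ltn_exp2r // prime_gt1.
(* The iterates with i <= G are residues of the conjugates of [x], so two of them agree. Injectivity
   of Frobenius cancels the smaller exponent, leaving a period that is at most [G] and so divides
   its factorial. *)
have frobG x : x \in dv_ring w -> red x ^+ (Q ^ G`!) = red x.
  move=> xO; pose C := [seq red ((g : gal_of {:L}) x) | g <- enum {: gal_of {:L}}].
  have : ~~ uniq [seq red x ^+ (Q ^ i) | i <- iota 0 G.+1].
    apply/negP => /uniq_leq_size H.
    have /H : {subset [seq red x ^+ (Q ^ i) | i <- iota 0 G.+1] <= C}.
      move=> y /mapP[i _ ->]; have [g ->] := frobn x i xO.
      by apply/mapP; exists g => //; rewrite mem_enum inE.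
    by rewrite !size_map size_iota /G cardE -enumT ltnn.
  case/(uniqPn 0)=> i [j]; rewrite size_map size_iota => -[ltij ltj].
  rewrite !(nth_map 0%N) ?size_iota ?(ltn_trans ltij) // !nth_iota ?(ltn_trans ltij) //.
  rewrite !add0n -(subnK (ltnW ltij)) expnD exprM => E.
  have {}E : red x ^+ (Q ^ (j - i)) = red x.
    by apply/esym/(@pchar_exp_inj _ _ (q * i) pl); rewrite /= expnM.
  have /dvdnP[m ->] : (j - i %| G`!)%N.
    by apply: dvdn_fact; rewrite subn_gt0 ltij (leq_trans (leq_subr _ _)).
  elim: m => [|m IHm]; first by rewrite mul0n expn0 expr1.
  by rewrite mulSn expnD exprM E.
have [s' s'P] : exists s : seq l, forall a, a \in s.
  have ltQ : (1 < Q ^ G`!)%N by rewrite -(exp1n G`!) ltn_exp2r // fact_gt0.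
  have sX : (size (- 'X : {poly l}) < size ('X^(Q ^ G`!) : {poly l}))%N.
    by rewrite size_polyN size_polyX size_polyXn.
  apply: (@roots_enum l ('X^(Q ^ G`!) - 'X)).
    by rewrite -size_poly_eq0 size_polyDl // size_polyXn.
  move=> a; have [x xO <-] := red_surj redP a.
  by rewrite rootE !hornerE frobG // subrr.
have [F [red' [redP' pF]]] := finite_residue_field redP s'P.
by exists w, F, red'; rewrite pF.
Qed.

Lemma finfield_generator (k : finFieldType) :
  exists o : k, o != 0 /\ forall a, a != 0 -> exists m : nat, a = o ^+ m.
Proof.
have /cyclicP[u Du] := field_unit_group_cyclic [group of [set: {unit k}]].
exists (FinRing.uval u); split; first by rewrite -unitfE; exact: (valP u).
move=> a; rewrite -unitfE => ua.
have : FinRing.unit k ua \in <[u]>%g by rewrite -Du inE.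
by case/cycleP=> m /(congr1 val) /= Ea; exists m; rewrite Ea FinRing.val_unitX.
Qed.

(** The [p] multiples of 1 already exhaust the roots of X^p - X. *)
Lemma pchar_frob_fixed (F : fieldType) p (c : F) : p \in [pchar F] -> c ^+ p = c ->
  exists m : nat, c = m%:R.
Proof.
move=> pF cp; have pp := pcharf_prime pF.
pose s := [seq m%:R : F | m <- iota 0 p].
have sub i j : (i <= j)%N -> (j < p)%N -> i%:R = j%:R :> F -> i = j.
  move=> leij ltjp /eqP; rewrite eq_sym -subr_eq0 -natrB // -(dvdn_pcharf pF) => dv.
  apply/eqP; rewrite eqn_leq leij /= -subn_eq0 -leqn0 leqNgt; apply/negP => lt0.
  by move: (dvdn_leq lt0 dv); rewrite leqNgt (leq_ltn_trans (leq_subr _ _)).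
have us : uniq s.
  rewrite map_inj_in_uniq ?iota_uniq // => i j; rewrite !mem_iota !add0n /= => lti ltj E.
  by case/orP: (leq_total i j) => le; [apply: sub | apply/esym/sub].
have [/mapP[m _ ->]|ncs] := boolP (c \in s); first by exists m.
have sX : (size (- 'X : {poly F}) < size ('X^p : {poly F}))%N.
  by rewrite size_polyN size_polyX size_polyXn ltnS prime_gt1.
have P0 : 'X^p - 'X != 0 :> {poly F} by rewrite -size_poly_eq0 size_polyDl // size_polyXn.
have rs : all (root ('X^p - 'X)) (c :: s).
  rewrite /= rootE !hornerE cp subrr eqxx /=.
  apply/allP => _ /mapP[m _ ->]; rewrite rootE !hornerE.
  by rewrite -(pFrobenius_autE pF) rmorph_nat subrr.
have us' : uniq (c :: s) by rewrite /= ncs us.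
have := max_poly_roots P0 rs us'.
by rewrite /= size_map size_iota size_polyDl // size_polyXn ltnn.
Qed.

(** * Tame ramification *)

Section TameStructure.
Variables (p : nat) (K : fieldType) (L : splittingFieldType K).
Variables (w : discrete_valuation L) (k : finFieldType) (red : L -> k).
Hypotheses (wg : forall (g : gal_of {:L}) x, w (g x) = w x)
  (redP : is_residue_map w red) (pk : p \in [pchar k]).
Local Notation O := (dv_ring w).
Local Notation G := ('Gal({:L} / 1))%g.
Implicit Types (x y : L) (g h : gal_of {:L}).

Lemma sub_gal1 (A : {set gal_of {:L}}) : A \subset G.
Proof. by apply/subsetP => g _; apply: mem_gal1. Qed.

Lemma gal_dv_ge m g x : (g x \in dv_ge w m) = (x \in dv_ge w m).
Proof. by rewrite !unfold_in /= wg fmorph_eq0. Qed.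

Lemma gal_dv_ring g x : (g x \in O) = (x \in O).
Proof. exact: gal_dv_ge. Qed.

Lemma red_gal_eq g x y : x \in O -> y \in O -> red x = red y -> red (g x) = red (g y).
Proof.
move=> xO yO /eqP; rewrite (red_eq redP) // => xy; apply/eqP.
by rewrite (red_eq redP) ?gal_dv_ring // -rmorphB gal_dv_ge.
Qed.

(** Let [o] generate the multiplicative group of [k]. The product [T] of the X - o^(p^i) is fixed by
    Frobenius, so its coefficients are natural numbers and lift to elements fixed by [g]. Hence [g]
    sends a lift of [o] to an element whose residue is again a root of [T], that is some o^(p^i),
    and all nonzero residues are powers of [o]. *)
Lemma residue_aut_frobenius g : exists i : nat,
  forall x, x \in O -> red (g x) = red x ^+ (p ^ i).
Proof.
have [o [o0 oP]] := finfield_generator k.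
have pp := pcharf_prime pk.
have [d Dd] : exists d : nat, #|k| = (p ^ d.+1)%N.
  exists (logn p #|k|).-1; rewrite prednK; first exact: (card_pprimeChar pk).
  rewrite lt0n; apply: contraTneq (finNzRing_gt1 k) => E.
  by rewrite (card_pprimeChar pk) E.
have od : o ^+ (p ^ d.+1) = o by rewrite -Dd expf_card.
pose T := \prod_(i < d.+1) ('X - (o ^+ (p ^ i))%:P).
have Tfrob : map_poly (pFrobenius_aut pk) T = T.
  rewrite rmorph_prod [RHS]big_ord_recl [LHS]big_ord_recr /= mulrC; congr (_ * _).
    by rewrite rmorphB /= map_polyX map_polyC /= pFrobenius_autE -exprM -expnSr od expn0 expr1.
  apply: eq_bigr => i _.
  by rewrite rmorphB /= map_polyX map_polyC /= pFrobenius_autE -exprM -expnSr.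
have natT i : exists m : nat, T`_i = m%:R.
  apply: (pchar_frob_fixed pk).
  by rewrite -(pFrobenius_autE pk) -coef_map Tfrob.
have [c cP] := choice natT.
have [x xO Dx] := red_surj redP o.
have redT y : y \in O -> red (\sum_(i < size T) (c i)%:R * y ^+ i) = T.[red y].
  move=> yO; rewrite (red_sum redP) => [|i]; last by rewrite rpredM ?rpred_nat ?rpredX.
  rewrite horner_coef; apply: eq_bigr => i _.
  by rewrite (redM redP) ?rpred_nat ?rpredX // (red_nat redP) (redX redP) // cP.
have T0 : T.[o] = 0.
  by apply/eqP; rewrite -rootE /T big_ord_recl rootM expn0 expr1 root_XsubC eqxx.
have : T.[red (g x)] = 0.
  rewrite -redT ?gal_dv_ring //.
  have -> : \sum_(i < size T) (c i)%:R * g x ^+ i = g (\sum_(i < size T) (c i)%:R * x ^+ i).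
    by rewrite rmorph_sum; apply: eq_bigr => i _; rewrite rmorphM rmorph_nat rmorphXn.
  have SO : \sum_(i < size T) (c i)%:R * x ^+ i \in O.
    by apply: rpred_sum => i _; rewrite rpredM ?rpred_nat ?rpredX.
  rewrite (red_gal_eq g SO (rpred0 _)) ?rmorph0 ?(red0 redP) //.
  by rewrite redT // Dx T0.
move/eqP; rewrite -rootE /T (big_morph (fun q : {poly k} => root q (red (g x))) (id1 := false) (op1 := orb)); last 2 first.
- by move=> q r; rewrite rootM.
- exact/negbTE/root1.
rewrite big_orE => /existsP[i /=]; rewrite root_XsubC => /eqP Ei.
exists i => y yO; have [y0|y0] := eqVneq (red y) 0.
  rewrite y0 expr0n expn_eq0 eqn0Ngt prime_gt0 //=.
  by rewrite (red_gal_eq g yO (rpred0 _)) ?rmorph0 ?(red0 redP).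
have [m Em] := oP _ y0.
have -> : red (g y) = red (g (x ^+ m)).
  by apply: red_gal_eq; rewrite ?rpredX // (redX redP) // Dx.
by rewrite rmorphXn (redX redP) ?gal_dv_ring // Ei Em -!exprM mulnC.
Qed.

Let frob g : nat := projT1 (cid (residue_aut_frobenius g)).
Let frobP g x : x \in O -> red (g x) = red x ^+ (p ^ frob g).
Proof. by rewrite /frob; case: cid => i; apply. Qed.

Definition inertia : {set gal_of {:L}} :=
  [set g : gal_of {:L} | `[< forall x, x \in O -> red (g x) = red x >]].
(** The first higher ramification group; quantifying over all nonzero [x] avoids the choice of a
    uniformizer. *)
Definition wild_inertia : {set gal_of {:L}} :=
  [set g : gal_of {:L} | `[< forall x, x != 0 -> g x / x - 1 \in dv_ge w 1 >]].

Lemma inertiaP g : reflect (forall x, x \in O -> red (g x) = red x) (g \in inertia).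
Proof. by rewrite inE; apply: asboolP. Qed.

Lemma wild_inertiaP g :
  reflect (forall x, x != 0 -> g x / x - 1 \in dv_ge w 1) (g \in wild_inertia).
Proof. by rewrite inE; apply: asboolP. Qed.

Lemma gal_div_unit g x : x != 0 -> w (g x / x) = 0 /\ g x / x != 0.
Proof.
move=> x0; have gx0 : g x != 0 by rewrite fmorph_eq0.
by rewrite dvM ?invr_eq0 // dvV // wg subrr mulf_neq0 ?invr_eq0.
Qed.

Lemma gal_div_ring g x : x != 0 -> g x / x \in O.
Proof. by move=> x0; have [wx nx] := gal_div_unit g x0; rewrite [_ \in _]in_dv_ge // wx. Qed.

Lemma wild_inertia_red g :
  reflect (forall x, x != 0 -> red (g x / x) = 1) (g \in wild_inertia).
Proof.
apply: (iffP (wild_inertiaP g)) => H x x0; have := H x x0.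
  by rewrite -(red_eq redP) ?rpred1 ?gal_div_ring // (red1 redP) => /eqP.
by move/eqP; rewrite -[X in _ == X](red1 redP) (red_eq redP) ?rpred1 ?gal_div_ring.
Qed.

Fact inertia_group_set : group_set inertia.
Proof.
apply/group_setP; split; first by apply/inertiaP => x _; rewrite gal_id.
move=> g h /inertiaP gT /inertiaP hT; apply/inertiaP => x xO.
by rewrite galM ?memvf // hT ?gal_dv_ring // gT.
Qed.
Canonical inertia_group := Group inertia_group_set.

Fact wild_inertia_group_set : group_set wild_inertia.
Proof.
apply/group_setP; split.
  by apply/wild_inertia_red => x x0; rewrite gal_id divff // (red1 redP).
move=> g h /wild_inertia_red gW /wild_inertia_red hW; apply/wild_inertia_red => x x0.
have gx0 : g x != 0 by rewrite fmorph_eq0.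
have -> : (g * h)%g x / x = h (g x) / g x * (g x / x) by rewrite galM ?memvf // mulrA divfK.
by rewrite (redM redP) ?gal_div_ring // hW // gW // mulr1.
Qed.
Canonical wild_inertia_group := Group wild_inertia_group_set.

(** Products of automorphisms apply the left factor first, so conjugation by [h] transports the
    action of [g] along [h]. *)
Lemma gal_conjE g h x : (g ^ h)%g (h x) = h (g x).
Proof.
rewrite conjgE !galM ?memvf //.
have -> : (h^-1)%g (h x) = x by rewrite -galM ?memvf // mulgV gal_id.
by [].
Qed.

Lemma gal_invK h x : h ((h^-1)%g x) = x.
Proof. by rewrite -galM ?memvf // mulVg gal_id. Qed.

Lemma inertia_normal : (inertia <| G)%g.
Proof.
rewrite /normal sub_gal1 /=; apply/normsP => h _; apply/setP => g.
have H g' h' : g' \in inertia -> (g' ^ h')%g \in inertia.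
  move=> /inertiaP gT; apply/inertiaP => x xO; rewrite -{1}(gal_invK h' x) gal_conjE.
  rewrite (@red_gal_eq h' _ ((h'^-1)%g x)) ?gal_dv_ring // ?gT ?gal_dv_ring //.
  by rewrite gal_invK.
by rewrite mem_conjg; apply/idP/idP => [/(H _ h)|/(H _ h^-1)%g //]; rewrite conjgKV.
Qed.

Lemma wild_inertia_normal : (wild_inertia <| G)%g.
Proof.
rewrite /normal sub_gal1 /=; apply/normsP => h _; apply/setP => g.
have H g' h' : g' \in wild_inertia -> (g' ^ h')%g \in wild_inertia.
  move=> /wild_inertiaP gT; apply/wild_inertiaP => x x0; rewrite -(gal_invK h' x) gal_conjE.
  have y0 : (h'^-1)%g x != 0 by rewrite fmorph_eq0.
  have := gT _ y0; rewrite -(gal_dv_ge _ h') rmorphB rmorph1 fmorph_div.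
  by [].
by rewrite mem_conjg; apply/idP/idP => [/(H _ h)|/(H _ h^-1)%g //]; rewrite conjgKV.
Qed.

Lemma wild_inertia_sub : wild_inertia \subset inertia.
Proof.
apply/subsetP => g /wild_inertia_red gW; apply/inertiaP => x xO.
have [->|x0] := eqVneq x 0; first by rewrite rmorph0.
by rewrite -[g x](divfK x0) (redM redP) ?gal_div_ring // gW // mul1r.
Qed.

(* If g is wild of prime order r, then y = g x - x satisfies g^i y = y modulo
   higher valuation, and these r elements sum to 0, so that r y is small. *)
Lemma wild_inertia_pgroup : (p.-group wild_inertia)%g.
Proof.
have pp := pcharf_prime pk.
apply/pgroupP => r rp /Cauchy[] // g gW og.
apply/idPn => rnp.
have gn1 : g != 1%g by rewrite -order_gt1 og prime_gt1.
have [x gx] : exists x, g x != x.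
  apply: contrapT => /forallNP H; case/eqP: gn1; apply/eqP/gal_eqP => x _.
  by rewrite gal_id; apply/eqP/negPn/negP/H.
pose y := g x - x; have y0 : y != 0 by rewrite subr_eq0.
have gX i z : (g ^+ i.+1)%g z = g ((g ^+ i)%g z).
  by rewrite expgSr galM ?memvf.
have sumy n : \sum_(i < n) (g ^+ i)%g y = (g ^+ n)%g x - x.
  elim: n => [|n IHn]; first by rewrite big_ord0 gal_id subrr.
  rewrite big_ord_recr /= IHn /y rmorphB /= -galM ?memvf // -expgS.
  by rewrite addrC addrA subrK.
have sum0 : \sum_(i < r) (g ^+ i)%g y = 0 by rewrite sumy -og expg_order gal_id subrr.
have : red (\sum_(i < r) (g ^+ i)%g y / y) = r%:R.
  rewrite (red_sum redP) => [|i]; last exact: gal_div_ring.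
  rewrite (eq_bigr (fun=> 1)) => [|i _]; first by rewrite sumr_const card_ord.
  by have /wild_inertia_red-> : (g ^+ i)%g \in wild_inertia by rewrite groupX.
rewrite -mulr_suml sum0 mul0r (red0 redP) => /esym/eqP.
rewrite -(dvdn_pcharf pk) dvdn_prime2 // => /eqP E.
by rewrite E !inE eqxx in rnp.
Qed.

(** The map [f] is constant on cosets and embeds the quotient in the multiplicative group of a
    field, whose finite subgroups are cyclic. *)
Lemma quotient_cyclic (gT : finGroupType) (A B : {group gT}) (F : fieldType) (f : gT -> F) :
    (B <| A)%g -> {in A &, forall a b, f (a * b)%g = f a * f b} ->
    {in A, forall a, f a = 1 <-> a \in B} -> cyclic (A / B)%g.
Proof.
move=> nBA fM f1; have sBA := normal_sub nBA; have nB := normal_norm nBA.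
have fr a : a \in A -> f (fingroup.repr (coset B a)) = f a.
  move=> aA; rewrite val_coset ?(subsetP nB) //; set c := fingroup.repr _.
  have : c \in (B :* a)%g by rewrite mem_repr_rcoset.
  case/rcosetP => b bB ->; have bA := subsetP sBA b bB; rewrite fM //.
  by rewrite ((f1 b (subsetP sBA _ bB)).2 bB) mul1r.
pose h (c : coset_of B) := f (fingroup.repr c).
have hM : {in (A / B)%g &, {morph h : c d / (c * d)%g >-> c * d}}.
  move=> x y /morphimP[a aN aA ->] /morphimP[b bN bA ->].
  by rewrite -morphM //= /h !fr ?groupM // fM.
have h1 : {in (A / B)%g, forall c, h c = 1 <-> c = 1%g}.
  move=> x /morphimP[a aN aA ->]; rewrite /h fr // f1 //.
  by split=> [/coset_id //|/coset_idr]; apply.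
exact: (field_mul_group_cyclic hM h1).
Qed.

(** The tame character attached to a uniformizer [x] is multiplicative on inertia because inertia
    fixes the residue of h x / x. *)
Lemma tame_quotient_cyclic : cyclic (inertia / wild_inertia)%g.
Proof.
have [x x0 wx] := dv_surj w.
apply: (@quotient_cyclic _ [group of inertia] [group of wild_inertia] k (fun g => red (g x / x))).
- by rewrite /normal wild_inertia_sub; apply: subset_trans (normal_norm wild_inertia_normal); exact: sub_gal1.
- move=> g h gT hT /=; have gx0 : g x != 0 by rewrite fmorph_eq0.
  have -> : (g * h)%g x / x = h (g x / x) * (h x / x).
    by rewrite galM ?memvf // fmorph_div mulrA divfK // fmorph_eq0.
  rewrite (redM redP) ?gal_dv_ring ?gal_div_ring //; congr (_ * _).
  by apply: (inertiaP _ hT); rewrite gal_div_ring.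
move=> g gT /=; split; last by move/wild_inertia_red->.
move=> gx1; apply/wild_inertia_red => y y0.
(* A unit times a power of the uniformizer, with powers on both sides to keep exponents nonnegative.
   Inertia fixes the residue of the unit, so triviality on [x] gives triviality on [y]. *)
have [u [u0 wu [i [j Ey]]]] : exists u, [/\ u != 0, w u = 0 & exists i j : nat, y * x ^+ i = u * x ^+ j].
  case wy : (w y) => [m|m].
    exists (y / x ^+ m); rewrite mulf_neq0 ?invr_eq0 ?expf_neq0 // dvM ?invr_eq0 ?expf_neq0 //.
    split=> //; first by rewrite dvV ?expf_neq0 // dvX // wx wy; lia.
    by exists 0%N, m; rewrite expr0 mulr1 divfK // expf_neq0.
  exists (y * x ^+ m.+1); rewrite mulf_neq0 ?expf_neq0 // dvM ?expf_neq0 //.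
  split=> //; first by rewrite dvX // wx wy; lia.
  by exists m.+1, 0%N; rewrite expr0 mulr1.
have [uO ru0] := red_unit redP u0 wu.
have gu1 : red (g u / u) = 1.
  apply: (mulIf ru0); rewrite mul1r -(redM redP) ?gal_div_ring //.
  by rewrite divfK //; apply: (inertiaP _ gT).
have Eg : (g y / y) * (g x / x) ^+ i = (g u / u) * (g x / x) ^+ j.
  have := congr1 g Ey; rewrite !rmorphM !rmorphXn => Eg.
  have xi := expf_neq0 i x0; have xj := expf_neq0 j x0.
  rewrite !expr_div_n mulf_div Eg Ey -mulf_div.
  by [].
move: (gal_div_ring g y0) (gal_div_ring g x0) (gal_div_ring g u0) gx1 gu1 Eg.
move: (g y / y) (g x / x) (g u / u) => a b c aO bO cO b1 c1 /(congr1 red).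
by rewrite !(redM redP) ?rpredX // !(redX redP) // b1 c1 !expr1n !mulr1.
Qed.

(** If [d] is the order of Frobenius on the generator [o], the Frobenius exponent of [g] is a
    homomorphism modulo [d] with kernel the inertia group. Writing it as a power of a root of unity
    of order [d] in [algC] brings it under [quotient_cyclic]. *)
Lemma residue_quotient_cyclic : cyclic (G / inertia)%g.
Proof.
have [o [o0 oP]] := finfield_generator k.
have [x xO Dx] := red_surj redP o.
have pp := pcharf_prime pk.
have exd : exists d, (0 < d)%N && (o ^+ (p ^ d) == o).
  exists (logn p #|k|); rewrite -(card_pprimeChar pk) expf_card eqxx andbT.
  rewrite lt0n; apply: contraTneq (finNzRing_gt1 k) => E.
  by rewrite (card_pprimeChar pk) E.
case: (ex_minnP exd) => d /andP[d0 /eqP od] mind.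
have odM m : o ^+ (p ^ (d * m)) = o.
  by elim: m => [|m IHm]; rewrite ?muln0 ?expn0 ?expr1 // mulnS expnD exprM od.
have oi i : (o ^+ (p ^ i) == o) = (d %| i)%N.
  apply/idP/idP => [/eqP oi|/dvdnP[m ->]]; last by rewrite mulnC odM.
  move: oi; rewrite {1}(divn_eq i d) expnD exprM mulnC odM => oi.
  rewrite /dvdn eqn0Ngt; apply/negP => i0.
  have /mind : ((0 < i %% d) && (o ^+ (p ^ (i %% d)) == o))%N by rewrite i0 oi eqxx.
  by rewrite leqNgt ltn_mod d0.
have oij i j : (i <= j)%N -> o ^+ (p ^ i) = o ^+ (p ^ j) -> i = j %[mod d].
  move=> leij; rewrite -(subnK leij) expnD exprM => /(@pchar_exp_inj _ _ i pk)/esym/eqP.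
  by rewrite oi => /eqP E; rewrite -modnDml E.
have oij' i j : o ^+ (p ^ i) = o ^+ (p ^ j) -> i = j %[mod d].
  by case/orP: (leq_total i j) => le H; [apply: oij | apply/esym/oij].
have [z zP] := C_prim_root_exists d0.
apply: (@quotient_cyclic _ ('Gal({:L} / 1))%G [group of inertia] algC (fun g => z ^+ frob g)).
- exact: inertia_normal.
- move=> g h _ _ /=; rewrite -exprD; apply/eqP; rewrite (eq_prim_root_expr zP); apply/eqP.
  apply: oij'; rewrite -Dx -frobP // galM ?memvf // frobP ?gal_dv_ring // frobP //.
  by rewrite -exprM expnD.
move=> g _ /=; split=> [/eqP|/inertiaP gT].
  rewrite -(prim_order_dvd zP) -oi => /eqP og; apply/inertiaP => y yO.
  rewrite frobP //; have [->|y0] := eqVneq (red y) 0.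
    by rewrite expr0n expn_eq0 eqn0Ngt prime_gt0.
  by have [m ->] := oP _ y0; rewrite -exprM mulnC exprM og.
by apply/eqP; rewrite -(prim_order_dvd zP) -oi -Dx -frobP // gT.
Qed.

(** On residues [g] is the power map of exponent p^i. The residue of t x / x depends on [x] only
    through its valuation, so conjugating [t] by [g] raises this residue to the power p^i. *)
Lemma tame_conj g : exists i : nat,
  (forall t, t \in inertia -> exists2 u, u \in wild_inertia & (t ^ g)%g = (t ^+ (p ^ i) * u)%g) /\
  (forall (z : L) (m : nat), coprime p m -> z ^+ m = 1 -> g z = z ^+ (p ^ i)).
Proof.
have pp := pcharf_prime pk.
exists (frob g); split=> [t tT|z m cpm zm].
  exists ((t ^+ (p ^ frob g))^-1 * t ^ g)%g; last by rewrite mulKVg.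
  have tgT : (t ^ g)%g \in inertia by rewrite memJ_norm // (subsetP (normal_norm inertia_normal)) ?mem_gal1.
  have sT : ((t ^+ (p ^ frob g))^-1 * t ^ g)%g \in inertia by rewrite groupM ?groupV ?groupX.
  (* it is enough to compare the tame characters of both elements *)
  have tX x n : x != 0 -> red ((t ^+ n)%g x / x) = red (t x / x) ^+ n.
    move=> x0; elim: n => [|n IHn]; first by rewrite gal_id divff // (red1 redP).
    have tx0 : (t ^+ n)%g x != 0 by rewrite fmorph_eq0.
    rewrite expgS galM ?memvf //.
    have -> : (t ^+ n)%g (t x) / x = (t ^+ n)%g (t x / x) * ((t ^+ n)%g x / x).
      by rewrite fmorph_div mulrA divfK.
    rewrite (redM redP) ?gal_dv_ring ?gal_div_ring // IHn exprS; congr (_ * _).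
    have tn : (t ^+ n)%g \in inertia by rewrite groupX.
    exact: (inertiaP _ tn _ (gal_div_ring t x0)).
  have uni x y : x != 0 -> y != 0 -> w x = w y -> red (t x / x) = red (t y / y).
    move=> x0 y0 wxy; have u0 : x / y != 0 by rewrite mulf_neq0 ?invr_eq0.
    have wu : w (x / y) = 0 by rewrite dvM ?invr_eq0 // dvV // wxy subrr.
    have [uO ru0] := red_unit redP u0 wu.
    have -> : t x / x = (t (x / y) / (x / y)) * (t y / y).
      by rewrite fmorph_div; field; rewrite x0 y0 fmorph_eq0 y0.
    rewrite (redM redP) ?gal_div_ring // -[RHS]mul1r; congr (_ * _).
    apply: (mulIf ru0); rewrite mul1r -(redM redP) ?gal_div_ring //.
    by rewrite divfK //; apply: (inertiaP _ tT).
  apply/wild_inertia_red => x x0.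
  set s := (t ^+ (p ^ frob g))%g in sT *.
  have y0 : (s^-1)%g x != 0 by rewrite fmorph_eq0.
  rewrite galM ?memvf //; set y := (s^-1)%g x in y0 *.
  have Ex : x = s y by rewrite /y gal_invK.
  have h0 : (g^-1)%g y != 0 by rewrite fmorph_eq0.
  have -> : (t ^ g)%g y / x = ((t ^ g)%g y / y) / (s y / y).
    by rewrite Ex invf_div mulrA divfK.
  have sy0 : red (s y / y) != 0.
    by have [wu u0] := gal_div_unit s y0; have [] := red_unit redP u0 wu.
  have [wu u0] := gal_div_unit s y0.
  have [wu' u0'] := gal_div_unit (t ^ g)%g y0.
  have dO : (t ^ g)%g y / y / (s y / y) \in O.
    have nz : (t ^ g)%g y / y / (s y / y) != 0 by apply: mulf_neq0; rewrite ?invr_eq0.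
    by rewrite [_ \in _]in_dv_ge // dvM ?invr_eq0 // dvV // wu wu' subrr.
  apply: (mulIf sy0); rewrite mul1r -(redM redP) ?gal_div_ring //.
  rewrite divfK // tX // -{1 2}(gal_invK g y) gal_conjE -fmorph_div frobP ?gal_div_ring //.
  by congr (_ ^+ _); apply: uni => //; rewrite wg.
(* roots of unity of order prime to p are separated by reduction *)
have m0 : (0 < m)%N.
  by case: m cpm {zm} => // ; rewrite /coprime gcdn0 => /eqP E; rewrite E in pp.
have z0 : z != 0 by apply: contra_eq_neq zm => ->; rewrite expr0n eqn0Ngt m0 eq_sym oner_eq0.
have wz : w z = 0.
  have := dvX w m z0; rewrite zm dv1 => /esym/eqP; rewrite mulrn_eq0 eqn0Ngt m0.
  by move/eqP.
have zO : z \in O by rewrite [_ \in _]in_dv_ge // wz.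
have rz0 : red z != 0 by have [] := red_unit redP z0 wz.
pose e := g z / z ^+ (p ^ frob g).
have zX0 : z ^+ (p ^ frob g) != 0 by rewrite expf_neq0.
have eO : e \in O.
  rewrite [_ \in _]in_dv_ge ?mulf_neq0 ?invr_eq0 ?fmorph_eq0 // dvM ?invr_eq0 ?fmorph_eq0 //.
  by rewrite wg dvV // dvX // wz mul0rn subrr.
have re : red e = 1.
  apply: (mulIf (expf_neq0 (p ^ frob g) rz0)); rewrite mul1r -(redX redP) //.
  by rewrite -(redM redP) ?rpredX // divfK // frobP // (redX redP).
have em : e ^+ m = 1 by rewrite expr_div_n -rmorphXn zm rmorph1 exprAC zm expr1n divff ?oner_eq0.
apply/eqP; rewrite -[_ == _](inj_eq (mulIf (_ : (z ^+ (p ^ frob g))^-1 != 0))) ?invr_eq0 //.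
rewrite divff // -/e; apply/idPn => e1.
(* If [e] were not 1, its powers would sum to 0; but the residue of that sum is [m], which is prime
   to [p]. *)
have : (\sum_(i < m) e ^+ i) * (e - 1) == 0 by rewrite mulrC -subrX1 em subrr.
rewrite mulf_eq0 subr_eq0 (negPf e1) orbF => /eqP/(congr1 red).
rewrite (red_sum redP) => [|i]; last by rewrite rpredX.
rewrite (red0 redP) (eq_bigr (fun=> 1)) => [|i _]; last by rewrite (redX redP) // re expr1n.
rewrite sumr_const card_ord => /eqP; rewrite -(dvdn_pcharf pk).
by rewrite prime_coprime // in cpm; rewrite (negPf cpm).
Qed.

End TameStructure.

(** One exponent [i] governs both the conjugation by [g] on T / W and the action of [g] on roots of
    unity. This link lets the group fixing the root of order p^n - 1 act on T / W by exponents
    congruent to 1 modulo p^n - 1. *)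
Lemma tame_structure (p : nat) (K : fieldType) (L : splittingFieldType K) :
    is_p_field p K -> galois 1 {:L} ->
  let G := ('Gal({:L} / 1))%G in
  exists T W : {group gal_of {:L}},
    [/\ (T <| G)%g, (W <| G)%g, W \subset T, (p.-group W)%g & cyclic (T / W)%g] /\
    cyclic (G / T)%g /\
    forall g, exists i : nat,
      (forall t, t \in T -> exists2 u, u \in W & (t ^ g)%g = (t ^+ (p ^ i) * u)%g) /\
      (forall (z : L) (m : nat), coprime p m -> z ^+ m = 1 -> g z = z ^+ (p ^ i)).
Proof.
move=> [v [cv fv pv]] galL G.
have [w [k [red [wg redP pk]]]] := galois_residue_field cv fv pv galL.
exists (inertia_group red wg), (wild_inertia_group wg redP).
split; first split.
- exact: inertia_normal redP.
- exact: wild_inertia_normal.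
- exact: wild_inertia_sub redP.
- exact: wild_inertia_pgroup redP pk.
- exact: tame_quotient_cyclic.
split; first exact: residue_quotient_cyclic pk.
by move=> g; apply: tame_conj pk g.
Qed.

(** * Maximal subgroups of index p^n *)

Section MinnormalExponent.
Local Open Scope group_scope.
Variables (gT : finGroupType) (p n : nat) (G P A : {group gT}).
Hypotheses (minP : minnormal P G) (abP : p.-abelem P) (cardP : #|P| = (p ^ n)%N)
  (nAG : A <| G) (cAP : [~: A, A] \subset 'C(P)).

Section SimpleSubmodule.
Variable S : {group gT}.
Hypotheses (minS : minnormal S A) (sSP : S \subset P).

(** The subgroup of [S] fixed by [a] is stable under [A], because commutators of [A] centralize [P];
    being nontrivial, it is [S]. *)
Lemma simple_cent1 a x : a \in A -> x \in S -> x != 1 -> a \in 'C[x] -> a \in 'C(S).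
Proof.
move=> aA xS x1 ax; have /mingroupP[/andP[S1 nSA] minS'] := minS.
have S0S : S :&: 'C[a] = S.
  apply: minS'; last exact: subsetIl.
  apply/andP; split.
    apply: contraNneq x1 => S01; have : x \in S :&: 'C[a] by rewrite in_setI xS cent1C.
    by rewrite S01 => /set1P->.
  apply/subsetP => b bA; rewrite inE; apply/subsetP => _ /imsetP[y /setIP[yS ya] ->].
  have ybS : y ^ b \in S by rewrite memJ_norm // (subsetP nSA).
  rewrite inE ybS /=; apply/cent1P/commgP/conjg_fixP.
  rewrite -conjgM commgC.
  have := mem_commg bA aA; move: [~ b, a] => c /(subsetP cAP)/centP cP.
  rewrite !conjgM; have -> : y ^ a = y by apply/conjg_fixP/commgP/cent1P.
  by apply/conjg_fixP/commgP/commute_sym/cP/(subsetP sSP).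
by apply/centP => y; rewrite -{1}S0S => /setIP[_ /cent1P].
Qed.

(** By [simple_cent1] every nontrivial element of [S] has the same stabilizer in [A], so all orbits
    on the nontrivial elements have the same length. *)
Lemma simple_index_dvd : (#|A : 'C_A(S)| %| #|S|.-1)%N.
Proof.
have /mingroupP[/andP[S1 nSA] _] := minS.
have actS : [acts A, on S^# | 'J] by rewrite astabsJ normD1.
have -> : #|S|.-1 = #|S^#| by rewrite (cardsD1 1 S) group1.
rewrite -(acts_sum_card_orbit actS); apply: dvdn_sum => _ /imsetP[x /setD1P[x1 xS] ->].
rewrite card_orbit astab1J.
have -> // : 'C_A[x] = 'C_A(S).
apply/setP => a; rewrite !in_setI; case aA: (a \in A) => //=; apply/idP/idP => [ax|aS].
  exact: (simple_cent1 aA xS).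
by apply/cent1P/(centP aS).
Qed.

Lemma simple_exponent a : a \in A -> a ^+ #|S|.-1 \in 'C(S).
Proof.
move=> aA; have /mingroupP[/andP[S1 nSA] _] := minS.
have nCA : 'C_A(S) <| A by rewrite /normal subsetIl normsI ?normG ?norms_cent.
have /dvdnP[m ->] := simple_index_dvd.
have : a ^+ (m * #|A : 'C_A(S)|) \in 'C_A(S).
  apply: coset_idr; first by rewrite groupX // (subsetP (normal_norm nCA)).
  rewrite mulnC expgM morphX ?groupX // ?(subsetP (normal_norm nCA)) //.
  rewrite morphX ?(subsetP (normal_norm nCA)) // -card_quotient ?normal_norm //.
  by rewrite expg_cardG ?expg1n // mem_quotient.
by case/setIP.
Qed.

Let nPG : G \subset 'N(P). Proof. by have /mingroupP[/andP[]] := minP. Qed.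

Lemma simple_conj_sub g : g \in G -> S :^ g \subset P.
Proof. by move=> gG; rewrite -(normsP nPG g gG) conjSg. Qed.

Lemma simple_conj_gen : <<class_support S G>> = P.
Proof.
have /mingroupP[/andP[S1 nSA] _] := minS.
have /mingroupP[_ minP'] := minP; apply: minP'; last first.
  rewrite gen_subG class_supportEr; apply/bigcupsP => g; exact: simple_conj_sub.
rewrite norms_gen ?class_support_norm // andbT.
apply: contraNneq S1 => E; rewrite -subG1 -E.
by apply: subset_trans (subset_gen _); apply: sub_class_support.
Qed.

(** As [A] is normal in [G], the exponent bound on [S] passes to the conjugates of [S], which
    generate [P]. *)
Lemma exponent_centP a : a \in A -> a ^+ #|S|.-1 \in 'C(P).
Proof.
move=> aA; rewrite -simple_conj_gen cent_gen class_supportEr.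
apply/centP => _ /bigcupP[g gG /imsetP[x xS ->]].
have agA : a ^ g^-1 \in A by rewrite memJ_norm // groupV (subsetP (normal_norm nAG)).
have := centP (simple_exponent agA) x xS; rewrite /commute -conjXg => H.
by have := congr1 (conjg^~ g) H; rewrite /= conjMg conjgKV conjMg conjgKV.
Qed.

(** This is Clifford's argument. Take an [A]-stable [M] in [P], maximal among those whose order is a
    power of #|S|. A conjugate of [S] outside [M] is simple under [A], so it meets [M] trivially and
    could be added. *)
Lemma card_simple_power : exists k, #|P| = (#|S| ^ k)%N.
Proof.
have /mingroupP[/andP[S1 nSA] minS'] := minS.
pose good (M : {set gT}) := [&& M \subset P, A \subset 'N(M) & `[< exists k, #|M| = (#|S| ^ k)%N >]].
have good1 : good 1%G.
  by rewrite /good sub1G norms1; apply/asboolP; exists 0%N; rewrite cards1.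
have [M /maxgroupP[/and3P[sMP nMA /asboolP[k Ek]] maxM]] := ex_maxgroup (ex_intro (fun M : {group gT} => good M) 1%G good1).
have [sPM|] := boolP (P \subset M).
  by exists k; rewrite -Ek; congr #|pred_of_set _|; apply/eqP; rewrite eqEsubset sPM.
rewrite -{1}simple_conj_gen gen_subG class_supportEr => /bigcupsP H.
have [g gG nsM] : exists2 g, g \in G & ~~ (S :^ g \subset M).
  apply/exists_inP; apply: contraT; rewrite negb_exists_in => /forall_inP H'.
  by case: H => g /H'; rewrite negbK.
have nAg g' : g' \in G -> A :^ g' = A by move=> g'G; apply: (normsP (normal_norm nAG)).
have TI : M :&: S :^ g = 1.
  have : S :&: M :^ g^-1 = 1 \/ S :&: M :^ g^-1 = S.
    have [->|N1] := eqVneq (S :&: M :^ g^-1) 1; [by left|right].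
    apply: minS'; last exact: subsetIl.
    rewrite N1 normsI //= -(nAg g^-1) ?groupV // normJ conjSg.
    exact: nMA.
  case=> E; first by rewrite -[M : {set gT}](conjsgKV g) -conjIg setIC E conjs1g.
  by case/negP: nsM; rewrite sub_conjg -{1}E subsetIr.
have sSgP := simple_conj_sub gG.
have abelP : abelian P := abelem_abelian abP.
have cMS : S :^ g \subset 'C(M).
  by apply: subset_trans sSgP (subset_trans abelP (centS sMP)).
have EMS : M <*> S :^ g = M * S :^ g by apply: cent_joinEr.
have : M <*> S :^ g = M.
  apply: maxM; last exact: joing_subl.
  rewrite /good join_subG sMP sSgP /=; apply/andP; split.
    rewrite normsY //.
    by rewrite -(nAg g) // normJ conjSg.
  apply/asboolP; exists k.+1.
  by rewrite EMS TI_cardMg // Ek cardJg expnSr.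
by move=> E; case/negP: nsM; rewrite -E joing_subr.
Qed.
End SimpleSubmodule.

(* A acts on each of its simple submodules S of P through a group acting freely
   on S \ 1, and |P| is a power of |S|. *)
Lemma minnormal_exponent a : a \in A -> a ^+ (p ^ n).-1 \in 'C(P).
Proof.
move=> aA; have /mingroupP[/andP[P1 nPG] _] := minP.
have nPA : A \subset 'N(P) by apply: subset_trans (normal_sub nAG) nPG.
have [S minS sSP] := minnormal_exists P1 nPA.
have [k Ek] := card_simple_power minS sSP.
(* Since p^n is a power of #|S|, the exponent is a multiple of #|S| - 1. *)
rewrite -cardP Ek predn_exp expgM groupX //.
exact: exponent_centP.
Qed.
End MinnormalExponent.

Section PrimitiveSolvable.
Local Open Scope group_scope.
Variables (gT : finGroupType) (p n : nat) (G U : {group gT}).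
Hypotheses (solG : solvable G) (maxU : maximal U G) (coreU : gcore U G = 1)
  (indexU : #|G : U| = (p ^ n)%N) (p_pr : prime p).

(** A subgroup of [U] normalized by both [N] and [U] is normal in N U = G, hence lies in the trivial
    core. This applies to the intersection of [U] with [N] and, [N] being abelian, with the
    centralizer of [N], which therefore equals [N]. *)
Lemma primitive_solvable : exists N : {group gT},
  [/\ minnormal N G, N <| G, p.-abelem N, #|N| = (p ^ n)%N & N :&: U = 1 /\ 'C_G(N) = N].
Proof.
have /maxgroupP[prU _] := maxU; have sUG := proper_sub prU.
have G1 : G :!=: 1.
  by apply: contraTneq prU => ->; rewrite properE sub1G andbF.
have [N minN sNG] := minnormal_exists G1 (normG G).
have [nGN N1 abN] := minnormal_solvable minN sNG solG.
have nNG : N <| G by rewrite /normal sNG.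
have subU (M : {group gT}) : M <| G -> M \subset U -> M :=: 1.
  by move=> nM sM; apply/trivgP; rewrite -coreU gcore_max ?normal_norm.
have nsNU : ~~ (N \subset U) by apply: contra N1 => /(subU _ nNG) ->.
have defG : N * U = G.
  rewrite -norm_joinEr ?(subset_trans sUG) //.
  apply/eqP; rewrite eqEproper join_subG sNG sUG /=; apply: contra nsNU => prNU.
  by rewrite -((maxgroupP maxU).2 [group of N <*> U] prNU) ?joing_subr //= joing_subl.
have abelN : abelian N := abelem_abelian abN.
have normalNU (M : {group gT}) : M \subset G -> N \subset 'N(M) -> U \subset 'N(M) -> M <| G.
  by move=> sM nNM nUM; rewrite /normal sM -defG mul_subG.
have TI : N :&: U = 1.
  apply: (subU [group of N :&: U]) (subsetIr _ _); apply: normalNU => /=.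
  - exact: subset_trans (subsetIl _ _) sNG.
  - exact/cents_norm/(subset_trans abelN)/centS/subsetIl.
  - by rewrite normsI ?normG // (subset_trans sUG).
have cardN : #|N| = (p ^ n)%N.
  rewrite -indexU -divgS // -defG TI_cardMg // mulnK ?cardG_gt0 //.
have n0 : (0 < n)%N.
  by case: (n) cardN => [/eqP|//]; rewrite expn0 -trivg_card1 (negPf N1).
exists N; split=> //.
  by move: abN; rewrite /is_abelem cardN -[n](prednK n0) pdiv_pfactor.
split=> //.
have nCG : 'C_G(N) <| G by rewrite /normal subsetIl normsI ?normG // norms_cent.
have TIC : 'C_G(N) :&: U = 1.
  apply: (subU [group of 'C_G(N) :&: U]) (subsetIr _ _); apply: normalNU => /=.
  - exact: subset_trans (subsetIr _ _) sUG.
  - by apply: cents_norm; rewrite centsC; apply: subset_trans (subsetIl _ _) (subsetIr _ _).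
  - by rewrite normsI ?normG // (subset_trans sUG) ?normal_norm.
have sNC : N \subset 'C_G(N) by rewrite subsetI sNG.
have := group_modl U sNC; rewrite defG (setIidPr (subsetIl _ _)) [U :&: _]setIC TIC.
by rewrite mulg1.
Qed.

(** A p-group acting on a nontrivial p-group has nontrivial fixed points. They form a normal
    subgroup, hence all of [N], so [W] lies in the centralizer of [N]. *)
Lemma normal_pgroup_sub_minnormal (N W : {group gT}) :
    minnormal N G -> p.-group N -> 'C_G(N) = N -> W <| G -> p.-group W ->
  W \subset N.
Proof.
move=> minN pN cN nWG pW; have /mingroupP[/andP[N1 nNG] minN'] := minN.
have nNW : W \subset 'N(N) := subset_trans (normal_sub nWG) nNG.
have actW : [acts W, on N | 'J] by rewrite astabsJ.
have := pgroup_fix_mod pW actW; rewrite afixJ => E.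
have CN1 : 'C_N(W) != 1.
  apply: contraTneq pN => C1; move: E; rewrite C1 cards1 => E.
  apply/negP => pN; have [_ /dvdnP[k Ek] _] := pgroup_pdiv pN N1.
  by move: E; rewrite Ek modnMl modn_small ?prime_gt1.
have sWC : W \subset 'C(N).
  rewrite centsC; apply/setIidPl/minN'; last exact: subsetIl.
  by rewrite CN1 normsI // norms_cent // normal_norm.
by rewrite -cN subsetI normal_sub.
Qed.

End PrimitiveSolvable.

Lemma cyclic_quotient_gen (gT : finGroupType) (G T B : {group gT}) :
    (T <| G)%g -> B \subset G -> cyclic (G / T)%g ->
  exists2 b0, b0 \in B & forall b, b \in B ->
    exists k, exists2 t, t \in T & b = (b0 ^+ k * t)%g.
Proof.
move=> nTG sBG cGT; have nT := subset_trans sBG (normal_norm nTG).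
have /cyclicP[x Dx] := cyclicS (quotientS T sBG) cGT.
have : x \in (B / T)%g by rewrite Dx cycle_id.
case/morphimP=> b0 b0N b0B Ex; exists b0 => // b bB.
have : coset T b \in <[x]>%g by rewrite -Dx mem_quotient.
case/cycleP=> k Ek; exists k, ((b0 ^+ k)^-1 * b)%g; last by rewrite mulKVg.
apply: coset_idr; first by rewrite groupM ?groupV ?groupX // (subsetP nT).
rewrite morphM ?groupV ?groupX ?(subsetP nT) // morphV ?groupX //= morphX //.
by rewrite Ek Ex mulVg.
Qed.

Section PrimitiveTame.
Local Open Scope group_scope.
Variables (gT : finGroupType) (p n : nat) (G U T W B : {group gT}).
Hypotheses (solG : solvable G) (maxU : maximal U G) (coreU : gcore U G = 1)
  (indexU : #|G : U| = (p ^ n)%N) (p_pr : prime p).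
Hypotheses (nTG : T <| G) (nWG : W <| G) (nBG : B <| G) (pW : p.-group W).
Hypotheses
  (genT : exists2 t0, t0 \in T & forall t, t \in T ->
     exists k, exists2 u, u \in W & t = t0 ^+ k * u)
  (genB : exists2 b0, b0 \in B & forall b, b \in B ->
     exists k, exists2 t, t \in T & b = b0 ^+ k * t)
  (commTB : forall t b, t \in T -> b \in B ->
     exists k, exists2 u, u \in W & t ^ b = t * (t ^+ (p ^ n).-1) ^+ k * u).

Lemma primitive_tame : exists N : {group gT},
  [/\ minnormal N G, N <| G, p.-abelem N, #|N| = (p ^ n)%N & N :&: U = 1] /\
  [~: B, B] \subset N /\ forall b, b \in B -> b ^+ (p ^ n).-1 \in N.
Proof.
have [N [minN nNG abN cardN [TI cN]]] := primitive_solvable solG maxU coreU indexU p_pr.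
exists N; split=> //.
have sWN := normal_pgroup_sub_minnormal p_pr minN (abelem_pgroup abN) cN nWG pW.
have nN (A : {group gT}) : A \subset G -> A \subset 'N(N) by move=> sA; apply: subset_trans sA (normal_norm nNG).
have [sTG sBG] := (normal_sub nTG, normal_sub nBG).
have [nNT nNB] := (nN _ sTG, nN _ sBG).
have W1 u : u \in W -> coset N u = 1 by move=> uW; rewrite coset_id // (subsetP sWN).
have WN u : u \in W -> u \in 'N(N) by move=> uW; rewrite (subsetP (nN _ (normal_sub nWG))).
have TN t : t \in T -> t \in 'N(N) by move=> tT; rewrite (subsetP nNT).
have BN b : b \in B -> b \in 'N(N) by move=> bB; rewrite (subsetP nNB).
have abTN : abelian (T / N).
  have [t0 t0T t0P] := genT.
  suffices sT : T / N \subset <[coset N t0]> by apply: abelianS sT (cycle_abelian _).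
  apply/subsetP => _ /morphimP[t tN tT ->]; have [k [u uW ->]] := t0P t tT.
  by rewrite morphM ?groupX ?(TN _ t0T) ?(WN _ uW) //= (W1 _ uW) mulg1 morphX ?(TN _ t0T) // mem_cycle.
have NCN : N \subset 'C(N) := abelem_abelian abN.
have expN (A : {group gT}) : A <| G -> [~: A, A] \subset N -> forall a, a \in A -> a ^+ (p ^ n).-1 \in N.
  move=> nAG cAN a aA; rewrite -cN inE groupX ?(subsetP (normal_sub nAG)) //=.
  exact: (minnormal_exponent minN abN cardN nAG (subset_trans cAN NCN) aA).
have expT t : t \in T -> t ^+ (p ^ n).-1 \in N by apply: expN => //; apply: der1_min.
have cTB t b : t \in T -> b \in B -> commute (coset N t) (coset N b).
  move=> tT bB; have [k [u uW E]] := commTB tT bB.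
  apply/commgP/conjg_fixP; have [[tN bN] uN] := (TN _ tT, BN _ bB, WN _ uW).
  rewrite -morphJ //= E.
  have eN := expT t tT.
  rewrite !morphM ?groupM ?groupX //= (W1 _ uW) mulg1.
  by rewrite morphX ?groupX //= (coset_id eN) expg1n mulg1.
have cBN : [~: B, B] \subset N.
  apply: der1_min => //; have [b0 b0B b0P] := genB.
  apply/centsP => _ /morphimP[b bN bB ->] _ /morphimP[c cN' cB ->] /=.
  have [k [t tT Eb]] := b0P b bB; have [m [s sT Ec]] := b0P c cB.
  have [[tN sN] b0N] := (TN _ tT, TN _ sT, BN _ b0B).
  have cs : commute (coset N s) (coset N b) by apply: cTB.
  have cb0 : commute (coset N b0) (coset N b).
    rewrite Eb morphM ?groupX //= morphX //=.
    apply: commuteM; first exact: commuteX.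
    by apply/commute_sym/cTB.
  rewrite Ec morphM ?groupX //= morphX //=.
  apply: commuteM; last exact: commute_sym.
  by apply: commuteX; apply: commute_sym.
by split=> // b; apply: expN.
Qed.
End PrimitiveTame.

(** * Complements of a minimal normal subgroup and their conjugacy *)

Section ComplementConjugacy.
Local Open Scope group_scope.
Variables (gT : finGroupType) (p n : nat) (G N B : {group gT}).
Hypotheses (p_pr : prime p) (minN : minnormal N G) (nNG : N <| G) (abN : p.-abelem N)
  (cardN : #|N| = (p ^ n)%N) (sNB : N \subset B) (nBG : B <| G)
  (coB : coprime p #|B : N|) (indexB : (#|G : B| <= n)%N).

Let n_gt0 : (0 < n)%N.
Proof.
have /mingroupP[/andP[N1 _] _] := minN.
by case: (n) cardN => [/eqP|//]; rewrite expn0 -trivg_card1 (negPf N1).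
Qed.

Lemma abelem_gen_card (A : {set gT}) (H : {group gT}) :
  p.-abelem H -> <<A>> = H -> (#|H| <= p ^ #|A|)%N.
Proof.
move=> abH DH; have := grank_min A; rewrite DH (grank_abelian (abelem_abelian abH)).
rewrite (rank_abelem abH) {2}(card_pgroup (abelem_pgroup abH)).
by rewrite leq_exp2l // prime_gt1.
Qed.

(* The differences of the elements of an orbit O of G generate a normal
   subgroup of rank < #|O| <= #|G : B| <= n, so the orbit is a single point. *)
Lemma central_chief_trivial : B \subset 'C(N) -> G :=: B.
Proof.
move=> sBC; have /mingroupP[/andP[N1 nGN] minN'] := minN.
have [v vN v1] := trivgPn _ N1.
pose O := v ^: G.
have vO : v \in O by apply: class_refl.
have sON : O \subset N by rewrite class_sub_norm.
have cardO : (#|O| <= #|G : B|)%N.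
  rewrite -index_cent1; apply: dvdn_leq; first exact: indexg_gt0.
  apply: indexgS; rewrite subsetI normal_sub //= sub_cent1.
  by rewrite (subsetP _ _ vN) // centsC.
pose D := [set v^-1 * x | x in O :\ v].
have cardD : (#|D| < #|O|)%N.
  by rewrite (cardsD1 v O) vO ltnS leq_imset_card.
have vxD x : x \in O -> v^-1 * x \in <<D>>.
  move=> xO; have [->|xv] := eqVneq x v; first by rewrite mulVg group1.
  by apply: mem_gen; apply/imsetP; exists x; rewrite // !inE xv.
have sDN : <<D>> \subset N.
  rewrite gen_subG; apply/subsetP => _ /imsetP[x /setD1P[_ xO] ->].
  by rewrite groupM ?groupV // (subsetP sON).
have nGD : G \subset 'N(<<D>>).
  apply/subsetP => g gG; rewrite inE -genJ gen_subG.
  apply/subsetP => _ /imsetP[_ /imsetP[x /setD1P[_ xO] ->] ->].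
  have -> : (v^-1 * x) ^ g = (v^-1 * v ^ g)^-1 * (v^-1 * x ^ g).
    by rewrite conjMg conjVg; move: (v ^ g) (x ^ g) => a b; rewrite invMg invgK -mulgA mulKVg.
  rewrite groupM ?groupV // vxD ?memJ_class //.
  by case/imsetP: xO => h hG ->; rewrite -conjgM memJ_class ?groupM.
have D1 : <<D>> = 1.
  apply/eqP; apply: contraT => D1.
  have DN : <<D>> = N by apply: minN'; rewrite ?D1.
  have := abelem_gen_card abN DN; rewrite cardN leq_exp2l ?prime_gt1 // => leD.
  by have := leq_trans (leq_ltn_trans leD cardD) (leq_trans cardO indexB); rewrite ltnn.
have OE : O = [set v].
  apply/eqP; rewrite eqEsubset sub1set vO andbT; apply/subsetP => x /vxD.
  by rewrite D1 !inE => /eqP/(canRL (mulKg _)); rewrite invgK mulg1 => ->.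
have NE : <<O>> = N.
  apply: minN'; last by rewrite gen_subG.
  rewrite norms_gen ?class_norm // andbT -subG1 gen_subG OE sub1set inE.
  exact: v1.
have := abelem_gen_card abN NE; rewrite cardN leq_exp2l ?prime_gt1 // OE cards1 => n1.
apply/eqP; rewrite eqEsubset (normal_sub nBG) andbT -indexg_eq1 eqn_leq indexg_gt0 andbT.
exact: leq_trans indexB n1.
Qed.

Let solN : solvable N. Proof. exact: abelian_sol (abelem_abelian abN). Qed.

Lemma chief_hall : Hall B N.
Proof. by rewrite /Hall sNB cardN coprimeXl. Qed.

Lemma hall_complement_conj (H H' : {group gT}) :
    N :&: H = 1 -> N * H = B -> N :&: H' = 1 -> N * H' = B ->
  exists2 x, x \in N & H' :=: H :^ x.
Proof.
move=> TI DB TI' DB'.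
have nNB : B \subset 'N(N) := subset_trans (normal_sub nBG) (normal_norm nNG).
have cH (K : {group gT}) : N :&: K = 1 -> N * K = B -> #|K| = #|B : N|.
  by move=> tK dK; rewrite -divgS // -dK TI_cardMg // mulKn ?cardG_gt0.
apply: SchurZassenhaus_trans_sol => //.
- by apply: subset_trans nNB; rewrite -DB mulG_subr.
- by rewrite DB -DB' mulG_subr.
- by rewrite cardN (cH H) // coprimeXl.
- by rewrite !cH.
Qed.

Lemma complement_exists_conj :
  (exists H : {group gT}, N :&: H = 1 /\ N * H = G) /\
  (forall H H' : {group gT}, N :&: H = 1 -> N * H = G -> N :&: H' = 1 -> N * H' = G ->
     exists2 x, x \in G & H' :=: H :^ x).
Proof.
have /mingroupP[/andP[N1 nGN] minN'] := minN.
have sBG := normal_sub nBG; have sNG := normal_sub nNG.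
have nNB : N <| B := normalS sNB sBG nNG.
have /splitsP[C /complP[TIC DB]] := SchurZassenhaus_split chief_hall nNB.
(* The fixed points of [B] in [N] form a normal subgroup of [G], so they are trivial or all of [N].
   In the latter case [central_chief_trivial] reduces the claim to [B]. *)
have [CB1|CB1] := eqVneq 'C_N(B) 1; last first.
  have sBC : B \subset 'C(N).
    rewrite centsC; apply/setIidPl/minN'; last exact: subsetIl.
    by rewrite CB1 normsI // norms_cent // normal_norm.
  have GB := central_chief_trivial sBC.
  split; first by exists C; rewrite GB.
  move=> H H'; rewrite GB => TI D TI' D'.
  have [x xN E] := hall_complement_conj TI D TI' D'.
  by exists x; rewrite // (subsetP sNB).
have conjB g : g \in G -> N :&: C :^ g = 1 /\ N * C :^ g = B.
  move=> gG; have nNg : N :^ g = N by apply: (normsP (normal_norm nNG)).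
  have nBg : B :^ g = B by apply: (normsP (normal_norm nBG)).
  by rewrite -{1 2}nNg -conjIg -conjsMg TIC DB conjs1g nBg.
(* If [y] in [N] normalizes [C], its commutators with [C] lie in both [N] and [C], so [y]
   centralizes N C = B. *)
have TI : N :&: 'N_G(C) = 1.
  apply/trivgP; rewrite -CB1; apply/subsetP => y /setIP[yN /setIP[yG yC]].
  rewrite inE yN -DB /= centM inE (subsetP (abelem_abelian abN)) //=.
  apply/centP => c cC; apply/commgP; rewrite -in_set1 -[[set 1]]TIC inE.
  have sCG : C \subset G by apply: subset_trans sBG; rewrite -DB mulG_subr.
  apply/andP; split.
    by rewrite commgEl groupM ?groupV // memJ_norm // (subsetP nGN) // (subsetP sCG).
  by rewrite commgEr groupM // memJ_norm // groupV.
have DG : N * 'N_G(C) = G.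
  apply/eqP; rewrite eqEsubset mul_subG ?subsetIl //=; apply/subsetP => g gG.
  have [TIg DBg] := conjB g gG.
  have [x xN Ex] := hall_complement_conj TIC DB TIg DBg.
  have xG := subsetP sNG x xN.
  rewrite -(normC (A := 'N_G(C)) (B := N)); last by apply: subset_trans (normal_norm nNG); rewrite subsetIl.
  apply/mulsgP; exists (g * x^-1) x => //; last by rewrite mulgKV.
  by rewrite inE groupM ?groupV //=; apply/normP; rewrite conjsgM Ex conjsgK.
split; first by exists [group of 'N_G(C)].
(* A complement [H] of [N] in [G] meets [B] in a complement of [N] in [B], conjugate to [C]. As [H]
   normalizes this intersection, it lies in a conjugate of the normalizer of [C], and the orders
   agree. *)
have conjN (H : {group gT}) : N :&: H = 1 -> N * H = G -> exists2 x, x \in G & H :=: 'N_G(C) :^ x.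
  move=> TIH DH.
  have sHG : H \subset G by rewrite -DH mulG_subr.
  have TIHB : N :&: (H :&: B) = 1 by rewrite setIA TIH; apply/setIidPl; rewrite sub1G.
  have DHB : N * (H :&: B) = B by rewrite group_modl // DH; apply/setIidPr.
  have [x xN Ex] := hall_complement_conj TIC DB TIHB DHB.
  have xG := subsetP sNG x xN.
  exists x => //.
  have cardK (K : {group gT}) : N :&: K = 1 -> N * K = G -> #|K| = #|G : N|.
    by move=> tK dK; rewrite -divgS // -dK TI_cardMg // mulKn ?cardG_gt0.
  apply/eqP; rewrite eqEcard cardJg (cardK H) // (cardK [group of 'N_G(C)]) // leqnn andbT.
  rewrite -sub_conjgV subsetI; apply/andP; split.
    by rewrite -(normsP (normG G) _ (groupVr xG)) conjSg.
  apply/subsetP => _ /imsetP[h hH ->]; apply/normP.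
  have nHB : (H :&: B) :^ h = H :&: B.
    rewrite conjIg (normsP (normG H)) // (normsP (normal_norm nBG)) //.
    exact: (subsetP sHG).
  rewrite conjgE invgK !conjsgM -Ex nHB Ex conjsgK.
  by [].
move=> H H' TIH DH TIH' DH'.
have [x xG ->] := conjN _ TIH DH; have [y yG ->] := conjN _ TIH' DH'.
by exists (x^-1 * y); rewrite ?groupM ?groupV // conjsgM conjsgK.
Qed.
End ComplementConjugacy.

Definition elementary_chief (gT : finGroupType) (p n : nat) (G R S : {group gT}) : Prop :=
  [/\ (S <| G)%g, S \subset R, (p.-abelem (R / S))%g, #|(R / S)%g| = (p ^ n)%N
    & forall M : {group gT}, (M <| G)%g -> S \subset M -> M \subset R ->
        M :=: S \/ M :=: R].

(** * Maximal subgroups of index p^n and chief factors R / S *)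

Section KummerGroups.
Local Open Scope group_scope.
Variables (gT : finGroupType) (p n : nat) (G B R : {group gT}).
Hypotheses (p_pr : prime p) (n_gt0 : (0 < n)%N) (nBG : B <| G) (nRG : R <| G)
  (sRB : R \subset B) (indexB : (#|G : B| <= n)%N)
  (expB : forall b, b \in B -> b ^+ (p ^ n).-1 \in R).

Lemma coprime_pred_exp : coprime p (p ^ n).-1.
Proof.
have pn1 : (0 < p ^ n)%N by rewrite expn_gt0 prime_gt0.
rewrite -(coprime_pexpl _ _ n_gt0) -[X in coprime X _](prednK pn1).
exact: coprimeSn.
Qed.

Lemma coprime_index_exponent (S : {group gT}) : S \subset B -> B \subset 'N(S) ->
  (forall b, b \in B -> b ^+ (p ^ n).-1 \in S) -> coprime p #|B : S|.
Proof.
move=> sSB nSB eS; rewrite prime_coprime //; apply/negP.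
rewrite -card_quotient // => /Cauchy[] // x /morphimP[b bN bB ->] ob.
have : coset S b ^+ (p ^ n).-1 = 1 by rewrite -morphX //= coset_id // eS.
move/eqP; rewrite -order_dvdn [#[_]]ob => dv.
by have := coprime_pred_exp; rewrite prime_coprime // dv.
Qed.

(** The last hypothesis is the group form of the maximality of L_n among extensions of K_n that are
    abelian of exponent dividing p^n - 1. Modulo the core of [U] it places [R] inside the minimal
    normal subgroup [N], and since [R] is not inside [U], the two have the same image. *)
Lemma maximal_kummer_chief (U T W : {group gT}) :
    solvable G -> maximal U G -> #|G : U| = (p ^ n)%N ->
    T <| G -> W <| G -> p.-group W ->
    (exists2 t0, t0 \in T & forall t, t \in T ->
       exists k, exists2 u, u \in W & t = t0 ^+ k * u) ->
    (exists2 b0, b0 \in B & forall b, b \in B ->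
       exists k, exists2 t, t \in T & b = b0 ^+ k * t) ->
    (forall t b, t \in T -> b \in B ->
       exists k, exists2 u, u \in W & t ^ b = t * (t ^+ (p ^ n).-1) ^+ k * u) ->
    (forall N : {group gT}, N <| G -> [~: B, B] \subset N ->
       (forall b, b \in B -> b ^+ (p ^ n).-1 \in N) -> R \subset N) ->
  elementary_chief p n G R [group of U :&: R] /\ U * R = G.
Proof.
move=> solG maxU indexU nTG nWG pW [t0 t0T t0P] [b0 b0B b0P] commTB maxR.
have sUG := maxgroupp maxU; have {}sUG := proper_sub sUG.
pose X := [group of gcore U G].
have nXG : X <| G by apply: gcore_normal.
have sXU : X \subset U := gcore_sub _ _.
have nXU : X <| U := normalS sXU sUG nXG.
have nN (A : {group gT}) : A <| G -> A \subset 'N(X).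
  by move=> /normal_sub sA; apply: subset_trans (normal_norm nXG).
have [nXT nXW nXB] := And3 (nN _ nTG) (nN _ nWG) (nN _ nBG).
have maxU' : maximal (U / X) (G / X) by rewrite quotient_maximal.
have coreU' : gcore (U / X) (G / X) = 1.
  have nC : gcore (U / X) (G / X) <| G / X by rewrite gcore_normal ?quotientS.
  have [M DM sXM nMG] := inv_quotientN nXG nC.
  apply/trivgP; rewrite /= DM quotient_sub1 ?nN // gcore_max ?normal_norm //.
  rewrite -(quotientSGK _ sXU) ?nN // -DM; exact: gcore_sub.
have indexU' : #|G / X : U / X| = (p ^ n)%N.
  by rewrite index_quotient_eq ?normal_norm // (subset_trans (subsetIr _ _)).
have WX u : u \in W -> u \in 'N(X) by apply: (subsetP nXW).
have TX t : t \in T -> t \in 'N(X) by apply: (subsetP nXT).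
have BX b : b \in B -> b \in 'N(X) by apply: (subsetP nXB).
have [] := @primitive_tame _ p n (G / X) (U / X) (T / X) (W / X) (B / X).
- exact: quotient_sol.
- exact: maxU'.
- exact: coreU'.
- exact: indexU'.
- exact: p_pr.
- exact: quotient_normal.
- exact: quotient_normal.
- exact: quotient_normal.
- exact: quotient_pgroup.
- exists (coset X t0); first exact: mem_quotient.
  move=> _ /morphimP[t tN tT ->]; have [k [u uW ->]] := t0P t tT.
  exists k, (coset X u); first exact: mem_quotient.
  by have [aN bN] := (TX _ t0T, WX _ uW); rewrite morphM ?groupX //= morphX.
- exists (coset X b0); first exact: mem_quotient.
  move=> _ /morphimP[b bN bB ->]; have [k [t tT ->]] := b0P b bB.
  exists k, (coset X t); first exact: mem_quotient.
  by have [aN cN] := (BX _ b0B, TX _ tT); rewrite morphM ?groupX //= morphX.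
- move=> _ _ /morphimP[t tN tT ->] /morphimP[b bN bB ->].
  have [k [u uW E]] := commTB t b tT bB; have uN := WX _ uW.
  exists k, (coset X u); first exact: mem_quotient.
  by rewrite /= -morphJ // E !morphM ?groupM ?groupX //= !morphX ?groupX.
move=> N' [[minN nNG' abN cardN TIN] [cBN expN]].
have [N DN sXN nNG] := inv_quotientN nXG nNG'.
have BN b : b \in B -> b ^+ (p ^ n).-1 \in N.
  move=> bB; have bX := BX _ bB; have : coset X b \in B / X by rewrite mem_quotient.
  move/expN; rewrite /= DN -morphX //= => H.
  by rewrite -(quotientGK (normalS sXN (normal_sub nNG) nXG)) mem_morphpre ?groupX.
have sRN : R \subset N.
  apply: maxR => //; rewrite -(quotientSGK _ sXN) ?quotientR //; last first.
    by apply: subset_trans (normal_norm nXG); apply: subset_trans (der_sub 1 B) (normal_sub nBG).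
  by rewrite -DN.
have nXR : R \subset 'N(X) := nN _ nRG.
have UN : U :&: N = X.
  apply/eqP; rewrite eqEsubset subsetI sXU sXN andbT.
  have nXUN : U :&: N \subset 'N(X) by apply: subset_trans (subsetIl _ _) (normal_norm nXU).
  rewrite -quotient_sub1 //.
  by rewrite -TIN DN setIC quotientI.
have URX : U :&: R = X :&: R by rewrite -UN -setIA (setIidPr sRN).
(* Otherwise p^n divides #|G : R|, hence also #|G : B|, because #|B : R| is prime to [p]; but #|G :
   B| <= n < p^n. *)
have nsRU : ~~ (R \subset U).
  apply/negP => sRU; have := indexgS G sRU.
  have : (p ^ n %| #|G : R|)%N by rewrite -indexU -(Lagrange_index sUG sRU) dvdn_mulr.
  rewrite -(Lagrange_index (normal_sub nBG) sRB) Gauss_dvdl; last first.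
    rewrite coprimeXl // coprime_index_exponent //.
    by apply: subset_trans (normal_norm nRG); apply: normal_sub.
  move/dvdn_leq => /(_ (indexg_gt0 _ _)); rewrite leqNgt.
  by rewrite (leq_ltn_trans indexB) // ltn_expl // prime_gt1.
have DUR : U * R = G.
  rewrite -norm_joinEl ?(subset_trans sUG) ?normal_norm //.
  apply/eqP; rewrite eqEproper join_subG sUG normal_sub //=; apply: contra nsRU => prUR.
  by rewrite -((maxgroupP maxU).2 [group of U <*> R] prUR) ?joing_subr //= joing_subl.
have nS : U :&: R <| G.
  by rewrite URX normalI.
have DRX : R / X = N / X.
  have /mingroupP[_ minN'] := minN; rewrite -DN; apply: minN'; last by rewrite DN quotientS.
  rewrite -subG1 quotient_sub1 // quotient_norms ?normal_norm // andbT.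
  by apply: contra nsRU => sRX; apply: subset_trans sXU.
have iso : R / (U :&: R) \isog N / X by rewrite URX -DRX second_isog.
split=> //; split=> //=.
- exact: subsetIr.
- by rewrite (isog_abelem iso) /= -DN.
- by rewrite (card_isog iso) /= -DN.
move=> M nMG sSM sMR.
have nXM := nN _ nMG.
have : M / X = 1 \/ M / X = N / X.
  have [->|M1] := eqVneq (M / X) 1; [by left|right].
  have /mingroupP[_ minN'] := minN; rewrite -DN; apply: minN'.
    by rewrite M1 quotient_norms // normal_norm.
  by rewrite DN -DRX quotientS.
case=> E; [left|right]; apply/eqP; rewrite eqEsubset ?sSM ?sMR ?andbT /=.
  by rewrite URX subsetI sMR andbT -quotient_sub1 // E.
have sR : R \subset M * X by rewrite normC // -quotientSK // E -DRX.
apply: subset_trans (_ : M * X :&: R \subset _); first by rewrite subsetI sR subxx.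
by rewrite -group_modl // mul_subG // -URX.
Qed.

Section ChiefComplement.
Variable S : {group gT}.
Hypotheses (chiefS : elementary_chief p n G R S).

Lemma chief_minnormal : minnormal (R / S) (G / S).
Proof.
have [nSG sSR abS cardS minS] := chiefS.
apply/mingroupP; split.
  rewrite quotient_norms ?normal_norm // andbT -cardG_gt1 cardS.
  by rewrite -(exp1n n) ltn_exp2r // prime_gt1.
move=> M' /andP[M'1 nM'] sM'.
have nM'G : M' <| G / S by rewrite /normal nM' (subset_trans sM') // quotientS // normal_sub.
have [M DM sSM nMG] := inv_quotientN nSG nM'G.
have nSR : S <| R := normalS sSR (normal_sub nRG) nSG.
have nSM : M \subset 'N(S) := subset_trans (normal_sub nMG) (normal_norm nSG).
have sMR : M \subset R by rewrite -(quotientSGK nSM sSR) -DM.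
have [E|E] := minS M nMG sSM sMR; last by rewrite DM E.
by case/negP: M'1; rewrite DM E trivg_quotient.
Qed.

Lemma complement_quotient (U : {group gT}) : U :&: R = S -> U * R = G ->
  [/\ R / S :&: U / S = 1, (R / S) * (U / S) = G / S & S \subset U].
Proof.
have [nSG sSR _ _ _] := chiefS; move=> UR DUR.
have sSU : S \subset U by rewrite -UR subsetIl.
have nSU : U \subset 'N(S) by apply: subset_trans (normal_norm nSG); rewrite -DUR mulG_subl.
have nSR : R \subset 'N(S) := subset_trans (normal_sub nRG) (normal_norm nSG).
split=> //.
  by rewrite setIC -quotientIG // UR trivg_quotient.
rewrite -quotientMl // -normC ?DUR //.
by apply: subset_trans (normal_norm nRG); rewrite -DUR mulG_subl.
Qed.

(** If [M] contains [U], then its intersection with [R] is normalized by [U], and by [R] because it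
    contains [S], hence the commutators of [R]. So this intersection is [S] or [R], and [M] is [U]
    or [G] by the modular law. *)
Lemma chief_complement_maximal (U : {group gT}) : U :&: R = S -> U * R = G ->
  maximal U G /\ #|G : U| = (p ^ n)%N.
Proof.
have [nSG sSR abS cardS minS] := chiefS; move=> UR DUR.
have sUG : U \subset G by rewrite -DUR mulG_subl.
have sRG := normal_sub nRG.
have sSU : S \subset U by rewrite -UR subsetIl.
have nSR : R \subset 'N(S) := subset_trans sRG (normal_norm nSG).
have cR : #|R| = (p ^ n * #|S|)%N by rewrite -cardS card_quotient // mulnC Lagrange.
have iU : #|G : U| = (p ^ n)%N.
  rewrite -divgS //; have := mul_cardG U R; rewrite UR DUR cR => E.
  apply/eqP; rewrite eq_sym eqn_div ?cardG_gt0 ?cardSg //.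
  by rewrite -(eqn_pmul2r (cardG_gt0 S)) -E mulnA [(#|U| * _)%N]mulnC.
split=> //; apply/maxgroupP; split.
  rewrite properE sUG; apply/negP => sGU; have := iU.
  have -> : G :=: U by apply/eqP; rewrite eqEsubset sGU.
  rewrite indexgg => /eqP; rewrite eq_sym -(expn0 p) eqn_exp2l ?prime_gt1 //.
  by rewrite eqn0Ngt n_gt0.
move=> M prM sUM; have sMG := proper_sub prM.
have sSM := subset_trans sSU sUM.
have nMR : M :&: R <| G.
  rewrite /normal (subset_trans (subsetIl _ _)) //= -DUR mul_subG //.
    by rewrite normsI ?(subset_trans sUM (normG _)) // (subset_trans sUG) ?normal_norm.
  apply: normal_norm; apply: sub_der1_normal; last exact: subsetIr.
  apply: subset_trans (_ : S \subset _); last by rewrite subsetI sSM.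
  by apply: der1_min => //; apply: abelem_abelian abS.
have [||E|E] := minS [group of M :&: R] nMR.
- by rewrite subsetI sSM.
- exact: subsetIr.
- have := group_modl R sUM; rewrite DUR (setIC R) [M :&: R]E mulGSid // => ->.
  exact/esym/setIidPr.
- case/negP: (proper_subn prM); rewrite -DUR mul_subG //.
  by rewrite -E subsetIl.
Qed.

Lemma chief_complement :
  (exists U : {group gT}, U :&: R = S /\ U * R = G) /\
  (forall U U' : {group gT}, U :&: R = S -> U * R = G -> U' :&: R = S -> U' * R = G ->
     exists2 g, g \in G & U' :=: U :^ g).
Proof.
have [nSG sSR abS cardS minS] := chiefS.
have sRG := normal_sub nRG; have sBG := normal_sub nBG.
have nS (A : {group gT}) : A \subset G -> A \subset 'N(S).
  by move=> sA; apply: subset_trans (normal_norm nSG).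
have sSB := subset_trans sSR sRB; have sSG := normal_sub nSG.
have coB : coprime p #|B / S : R / S|.
  rewrite index_quotient_eq ?nS //; last by rewrite (subset_trans (subsetIr _ _)).
  by apply: coprime_index_exponent => //; apply: subset_trans sBG (normal_norm nRG).
have iB : (#|G / S : B / S| <= n)%N.
  by rewrite index_quotient_eq ?nS // (subset_trans (subsetIr _ _)).
have [[H [TI D]] conj] := complement_exists_conj p_pr chief_minnormal
  (quotient_normal _ nRG) abS cardS (quotientS _ sRB) (quotient_normal _ nBG) coB iB.
split.
  have sHG : H \subset G / S by rewrite -D mulG_subr.
  have [U DU sSU sUG] := inv_quotientS nSG sHG.
  exists U; split.
    apply/eqP; rewrite eqEsubset subsetI sSU sSR andbT.
    rewrite -quotient_sub1; last by apply: subset_trans (subsetIl _ _) (nS _ sUG).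
    by rewrite (subset_trans (quotientI _ _ _)) // -DU setIC TI.
  have E : (R * U) / S = G / S by rewrite quotientMl ?nS // -DU D.
  apply/eqP; rewrite eqEsubset mul_subG //=.
  have : G \subset S * (R * U) by rewrite -quotientSK ?nS // E.
  by rewrite mulgA (mulSGid sSR) -normC // (subset_trans sUG) ?normal_norm.
move=> U U' UR DUR UR' DUR'.
have [TI1 D1 sSU] := complement_quotient UR DUR.
have [TI2 D2 sSU'] := complement_quotient UR' DUR'.
have [x xG E] := conj [group of U / S] [group of U' / S] TI1 D1 TI2 D2.
case/morphimP: xG E => g gN gG -> E; exists g => //.
have nU : S <| U by rewrite /normal sSU nS // -DUR mulG_subl.
have nU' : S <| U' by rewrite /normal sSU' nS // -DUR' mulG_subl.
apply: (@quotient_inj _ S) => //; last by rewrite /= quotientJ.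
rewrite -(normsP (normal_norm nSG) g gG) /=.
by rewrite normalJ.
Qed.
End ChiefComplement.
End KummerGroups.

(** * Finite Galois models *)

(** The powers of a uniformizer are distinct, so [K] is infinite; this form feeds the primitive
    element theorem. *)
Lemma valued_field_large (p : nat) (K Ks : fieldType) (iota : {rmorphism K -> Ks}) :
    is_p_field p K ->
  forall r : {poly Ks}, r != 0 -> exists t, ~~ root r (iota t).
Proof.
move=> [v _] r r0; have [x x0 vx] := dv_surj v.
pose s := [seq iota (x ^+ i) | i <- seq.iota 0 (size r)].
have us : uniq s.
  rewrite map_inj_uniq ?iota_uniq // => i j /fmorph_inj /(congr1 v).
  by rewrite !dvX // vx; lia.
have := @max_poly_roots _ r s r0; rewrite us size_map size_iota ltnn.
case: allP => [_ /(_ isT isT)//|nr _].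
have [t ts /negP rt] : exists2 t, t \in s & ~ root r t.
  by apply: contrapT => H; apply: nr => t ts; apply: contrapT => rt; apply: H; exists t.
by case/mapP: ts rt => i _ -> rt; exists (x ^+ i).
Qed.

Section SeparableClosure.
Variables (K Ks : fieldType) (iota : {rmorphism K -> Ks}).
Hypotheses (sepKs : is_separable_closure iota)
  (largeK : forall r : {poly Ks}, r != 0 -> exists t, ~~ root r (iota t)).

Lemma se_D (E : subext iota) x y : se_set E x -> se_set E y -> se_set E (x + y).
Proof.
move=> xE yE; rewrite -[y]opprK; apply: se_B => //.
by rewrite -sub0r; apply: se_B => //; rewrite -(rmorph0 iota); apply: se_base.
Qed.

Lemma se_M (E : subext iota) x y : se_set E x -> se_set E y -> se_set E (x * y).
Proof.
move=> xE yE; rewrite -[y]invrK; apply: se_div => //.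
by rewrite -[_^-1]mul1r; apply: se_div => //; rewrite -(rmorph1 iota); apply: se_base.
Qed.

Lemma sep_splits (q : {poly Ks}) : separable_poly q ->
  exists rs : seq Ks, q %= \prod_(x <- rs) ('X - x%:P).
Proof.
have [k] := ubnP (size q); elim: k q => // k IHk q ltqk sq.
have q0 := separable_poly_neq0 sq.
have [le1|gt1] := leqP (size q) 1.
  exists [::]; rewrite big_nil -size_poly_eq1.
  by rewrite eqn_leq le1 size_poly_gt0.
have [x rx] := sepKs.2 q sq gt1.
have /factor_theorem[q' Dq] := rx.
move: sq; rewrite Dq separable_root => /andP[sq' _].
have [|rs Ers] := IHk q' _ sq'.
  apply: leq_trans (_ : size q <= k)%N; last by rewrite -ltnS.
  by rewrite Dq size_Mmonic ?monicXsubC ?separable_poly_neq0 // size_XsubC addn2.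
by exists (x :: rs); rewrite big_cons [X in _ %= X]mulrC eqp_mulr.
Qed.

Lemma seq_splitting (s : seq Ks) : exists (Q : {poly K}) (rs : seq Ks),
  map_poly iota Q %= \prod_(x <- rs) ('X - x%:P) /\ {subset s <= rs}.
Proof.
elim: s => [|x s [Q [rs [DQ sub]]]].
  by exists 1, [::]; rewrite rmorph1 big_nil eqpxx.
have [q sq rq] := sepKs.1 x.
have [|rs' Dq] := @sep_splits (map_poly iota q); first by rewrite separable_map.
exists (q * Q), (rs' ++ rs); split.
  by rewrite rmorphM big_cat; apply: eqp_trans (eqp_mulr _ Dq) (eqp_mull _ DQ).
move=> y; rewrite mem_cat inE => /orP[/eqP->|/sub->]; rewrite ?orbT //.
by rewrite -root_prod_XsubC -(eqp_root Dq) rq.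
Qed.

(** The second clause says that [z] lies in the field generated by [s]. *)
Lemma primitive_element (s : seq Ks) : exists z : Ks,
  (forall x, x \in s -> exists q : {poly K}, (map_poly iota q).[z] = x) /\
  (forall E : subext iota, (forall x, x \in s -> se_set E x) -> se_set E z).
Proof.
elim: s => [|x s [z [zs sz]]].
  by exists 0; split=> // E _; rewrite -(rmorph0 iota); apply: se_base.
have [p sp rp] := sepKs.1 x; have [q sq rq] := sepKs.1 z.
have [r r0 rP] := large_field_PET (separable_poly_neq0 sp) rp rq sq.
have [t /rP [[qx Ex] [qz Ez]]] := largeK r0.
exists (iota t * z - x); split=> [y|E Es].
  rewrite inE => /predU1P[->|/zs[q' <-]]; first by exists qx.
  exists (q' \Po qz); rewrite map_comp_poly horner_comp; congr (_.[_]).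
  exact: Ez.
apply: se_B; last by apply: Es; rewrite mem_head.
apply: se_M; first exact: se_base.
by apply: sz => y ys; apply: Es; rewrite inE ys orbT.
Qed.

Lemma minimal_poly_ex (z : Ks) : exists p : {poly K},
  root (map_poly iota p) z /\ irreducible_poly p.
Proof.
pose P k := `[< exists q : {poly K}, [/\ q != 0, root (map_poly iota q) z & size q = k] >].
have exP : exists k, P k.
  have [q sq rq] := sepKs.1 z; exists (size q); apply/asboolP; exists q.
  by rewrite separable_poly_neq0.
case: (ex_minnP exP) => k /asboolP[p [p0 rp sp]] mink.
exists p; split=> //; apply/(subfx_irreducibleP rp p0) => q rq q0.
by rewrite sp; apply: mink; apply/asboolP; exists q.
Qed.

Section SubfieldImage.
Variables (L : fieldExtType K) (j : {rmorphism L -> Ks}).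
Hypothesis jK : forall a : K, j a%:A = iota a.
Variable M : {subfield L}.

Let im_set : set Ks := fun x => exists2 y, y \in M & j y = x.
Fact img_subext_base a : im_set (iota a).
Proof. by exists a%:A; rewrite ?jK // rpredZ // rpred1. Qed.
Fact img_subext_B x y : im_set x -> im_set y -> im_set (x - y).
Proof. by move=> [a aM <-] [b bM <-]; exists (a - b); rewrite ?rmorphB ?rpredB. Qed.
Fact img_subext_div x y : im_set x -> im_set y -> im_set (x / y).
Proof. by move=> [a aM <-] [b bM <-]; exists (a / b); rewrite ?fmorph_div ?rpred_div. Qed.
Definition img_subext : subext iota :=
  SubExt img_subext_base img_subext_B img_subext_div.

Lemma img_subextP y : se_set img_subext (j y) <-> y \in M.
Proof. by split=> [[x xM /fmorph_inj<-]|yM]; last exists y. Qed.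
End SubfieldImage.

(** [L] is K[X] / (p), where [p] is the minimal polynomial of a primitive element [z] of a splitting
    field containing [s]. It is generated by the roots [rs] since [z] belongs to every extension
    that contains them. *)
Theorem galois_model (s : seq Ks) :
  exists (L : splittingFieldType K) (j : {rmorphism L -> Ks}),
  [/\ forall a : K, j a%:A = iota a, galois 1 {:L}
    & forall x, x \in s -> exists y, j y = x].
Proof.
have [Q [rs [DQ subs]]] := seq_splitting s.
have [z [zs sz]] := primitive_element rs.
have [p [rp ip]] := minimal_poly_ex z.
pose L0 : fieldExtType K := SubFieldExtType rp ip.
pose j : {rmorphism L0 -> Ks} := @subfx_inj _ _ iota z p.
have p0 := irredp_neq0 ip.
have jK (a : K) : j a%:A = iota a by apply: (subfx_inj_base rp p0).
have jz : exists y : L0, j y = z.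
  by exists (subfx_root iota z p); apply: (subfx_inj_root rp p0).
have jq (q : {poly K}) (y : L0) : j (map_poly (in_alg L0) q).[y] = (map_poly iota q).[j y].
  by rewrite -horner_map -map_poly_comp; congr (_.[_]); apply: eq_map_poly => a; apply: jK.
have jrs x : x \in rs -> exists y : L0, j y = x.
  move=> /zs[q <-]; have [y <-] := jz.
  by exists (map_poly (in_alg L0) q).[y]; rewrite jq.
have [rs' Ers] : exists rs' : seq L0, map j rs' = rs.
  elim: (rs) jrs => [|x s' IH] H; first by exists [::].
  have [y Ey] := H x (mem_head _ _).
  have [|rs' <-] := IH; first by move=> u us; apply: H; rewrite inE us orbT.
  by exists (y :: rs'); rewrite /= Ey.
have spl : splitting_field_axiom L0.
  exists (map_poly (in_alg L0) Q); first by apply/polyOver1P; exists Q.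
  exists rs'.
    rewrite -(eqp_map j) rmorph_prod -map_poly_comp (eq_map_poly (g := iota)) //.
    move: DQ; rewrite -Ers big_map.
    by under [in X in _ -> X]eq_bigr => x _ do rewrite rmorphB /= map_polyX map_polyC.
  apply/eqP; rewrite eqEsubv subvf /=; apply/subvP => y _.
  pose M := <<1 & rs'>>%AS.
  have zM : se_set (img_subext jK M) z.
    apply: sz => x; rewrite -Ers => /mapP[u us ->]; apply/img_subextP.
    by rewrite /M /=; apply: seqv_sub_adjoin.
  have [u uM Eu] := zM.
  have [q ->] := subfxEroot rp p0 y.
  have -> : subfx_root iota z p = u.
    by apply: (fmorph_inj j); rewrite Eu; apply: (subfx_inj_root rp p0).
  apply: (rpred_horner (S := M)) => //.
  by apply/polyOverP => i; rewrite coef_map memvZ ?mem1v.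
pose L : splittingFieldType K := HB.pack L0 (FieldExt_isSplittingField.Build K L0 spl).
exists L, j; split=> //.
  apply/and3P; split; [exact: sub1v| |exact: normalFieldf].
  have [p1 Kp1 [rs1 _ <-]] := @splittingFieldP _ L.
  apply: separable_Fadjoin_seq; apply/allP => y _; apply/separable_elementP.
  have [q sq rq] := sepKs.1 (j y).
  exists (map_poly (in_alg L) q); split.
  - by apply/polyOver1P; exists q.
  - by move: rq; rewrite !rootE -jq fmorph_eq0.
  - by rewrite separable_map.
by move=> x /subs/jrs.
Qed.
End SeparableClosure.

(** Take a subspace of largest dimension inside [P]: enlarging it by a vector of [P] stays inside
    [P], so it already contains that vector. *)
Lemma vspace_of_pred (F : fieldType) (vT : vectType F) (P : vT -> Prop) :
    P 0 -> (forall a u v, P u -> P v -> P (a *: u + v)) ->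
  exists U : {vspace vT}, forall v, v \in U <-> P v.
Proof.
move=> P0 PD.
pose Q k := `[< exists U : {vspace vT}, (forall v, v \in U -> P v) /\ \dim U = k >].
have exQ : exists k, Q k.
  exists 0%N; apply/asboolP; exists 0%VS; rewrite dimv0; split=> // v.
  by rewrite memv0 => /eqP->.
have bQ k : Q k -> (k <= \dim {:vT})%N.
  by case/asboolP=> U [_ <-]; apply/dimvS/subvf.
case: (ex_maxnP exQ bQ) => k /asboolP[U [UP dU]] maxk.
exists U => v; split; first exact: UP.
move=> Pv; have /maxk : Q (\dim (<[v]> + U)).
  apply/asboolP; exists (<[v]> + U)%VS; split=> // w.
  case/memv_addP=> _ /vlineP[a ->] [u /UP Pu ->]; exact: PD.
rewrite -dU => le; have : (U == <[v]> + U)%VS by rewrite eqEdim addvSr.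
by move/eqP->; rewrite memvE addvSl.
Qed.

(** * Galois correspondence between subextensions and subgroups in a model *)

Section GaloisModel.
Variables (K Ks : fieldType) (iota : {rmorphism K -> Ks}).
Variables (L : splittingFieldType K) (j : {rmorphism L -> Ks}).
Hypotheses (jK : forall a : K, j a%:A = iota a) (galL : galois 1 {:L}).
Implicit Types (E F : subext iota) (g h : gal_of {:L}) (H U : {group gal_of {:L}}).
Local Notation G := ('Gal({:L} / 1))%G.

Definition in_model E := forall x, se_set E x -> exists y, j y = x.

(** Defined for every [E], but it only sees the part of [E] inside the model; it determines [E] when
    [in_model E] holds. *)
Definition gp (E : subext iota) : {set gal_of {:L}} :=
  [set g : gal_of {:L} | `[< forall y, se_set E (j y) -> g y = y >]].

Lemma gpP E g : reflect (forall y, se_set E (j y) -> g y = y) (g \in gp E).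
Proof. by rewrite inE; apply: asboolP. Qed.

Fact gp_group_set E : group_set (gp E).
Proof.
apply/group_setP; split; first by apply/gpP => y _; rewrite gal_id.
move=> g h /gpP gE /gpP hE; apply/gpP => y yE.
by rewrite galM ?memvf // gE // hE.
Qed.
Canonical gp_group E := Group (gp_group_set E).

Lemma gp_sub1 E : gp E \subset G.
Proof. by apply/subsetP => g _; rewrite gal_kHom ?sub1v // k1HomE ahomWin. Qed.

Lemma subext_subfield E : exists M : {subfield L},
  (forall y, y \in M <-> se_set E (j y)) /\ 'Gal({:L} / M)%g = gp E.
Proof.
have [U UP] : exists U : {vspace L}, forall y, y \in U <-> se_set E (j y).
  apply: vspace_of_pred.
    by rewrite rmorph0 -(rmorph0 iota); apply: se_base.
  move=> a u v uE vE; rewrite rmorphD -mulr_algl rmorphM /= jK.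
  by apply: se_D => //; apply: se_M => //; apply: se_base.
have aU : is_aspace U.
  apply/andP; split.
    by apply: has_algid1; apply/UP; rewrite rmorph1 -(rmorph1 iota); apply: se_base.
  apply/prodvP => u v /UP uE /UP vE; apply/UP.
  by rewrite rmorphM; apply: se_M.
exists (ASpace aU); split=> //; apply/setP => g.
rewrite gal_kHom ?subvf //; apply/kAHomP/gpP => gE y yE; apply: gE; exact/UP.
Qed.

Lemma model_fixedP E y : se_set E (j y) <-> (forall g, g \in gp E -> g y = y).
Proof.
split=> [yE g /gpP|fix_y]; first exact.
have [M [MP GM]] := subext_subfield E; apply/MP.
have /galois_fixedField <- : galois M {:L}.
  by apply: galoisS galL; rewrite sub1v subvf.
by apply/fixedFieldP; rewrite ?memvf // GM.
Qed.

Lemma gpS E F : (se_set E `<=` se_set F)%classic -> gp F \subset gp E.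
Proof. by move=> sEF; apply/subsetP => g /gpP gF; apply/gpP => y /sEF; apply: gF. Qed.

Lemma gp_le E F : in_model E -> gp F \subset gp E -> (se_set E `<=` se_set F)%classic.
Proof.
move=> Em sFE x xE; have [y Dx] := Em x xE; rewrite -Dx in xE *.
by apply/model_fixedP => g /(subsetP sFE)/gpP; apply.
Qed.

Lemma gp_inj E F : in_model E -> in_model F -> gp E = gp F -> se_set E = se_set F.
Proof.
by move=> Em Fm E_F; apply/seteqP; split; apply: gp_le; rewrite // E_F.
Qed.

Definition fix_subext (A : {group gal_of {:L}}) : subext iota :=
  img_subext jK [aspace of fixedField A].

Lemma fix_subextP A y : se_set (fix_subext A) (j y) <-> (forall g, g \in A -> g y = y).
Proof.
rewrite /fix_subext img_subextP; split=> [/fixedFieldP|]; first by apply; apply: memvf.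
by move=> H; apply/fixedFieldP; rewrite ?memvf.
Qed.

Lemma fix_subext_model A : in_model (fix_subext A).
Proof. by move=> x [y _ <-]; exists y. Qed.

Lemma gp_fix A : gp (fix_subext A) = A.
Proof.
rewrite -[RHS](gal_fixedField A); apply/setP => g.
rewrite gal_kHom ?subvf //; apply/gpP/kAHomP => gE y yE; apply: gE.
  by apply/img_subextP.
by move/img_subextP: yE.
Qed.

Lemma gp_base : gp (base_ext iota) = G.
Proof.
apply/eqP; rewrite eqEsubset gp_sub1; apply/subsetP => g _; apply/gpP => y [a _].
by rewrite -jK => /fmorph_inj <-; rewrite linearZ /= rmorph1.
Qed.

Lemma base_in_model : in_model (base_ext iota).
Proof. by move=> x [a _ <-]; exists a%:A. Qed.

Lemma adjoin_in_model E (S : set Ks) : in_model E -> (forall x, S x -> exists y, j y = x) ->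
  in_model (adjoin E S).
Proof.
move=> Em Sm x xES.
have [||y _ <-] := xES (fix_subext 1%G); last by exists y.
- move=> u /Em[y <-]; apply/fix_subextP => g /set1P->; exact: gal_id.
- move=> u /Sm[y <-]; apply/fix_subextP => g /set1P->; exact: gal_id.
Qed.

(** An adjunction is the intersection of all larger extensions, so it can be tested against the
    fixed field of the cyclic group generated by [g]. *)
Lemma gp_adjoinP E (S : set Ks) g : in_model E -> (forall x, S x -> exists y, j y = x) ->
  g \in gp (adjoin E S) <-> g \in gp E /\ forall y, S (j y) -> g y = y.
Proof.
move=> Em Sm; split=> [/gpP gES|[/gpP gE gS]].
  split=> [|y yS]; first by apply/gpP => y yE; apply: gES => F sEF _; apply: sEF.
  by apply: gES => F _ sSF; apply: sSF.
apply/gpP => y yES.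
have [||u uF /fmorph_inj Eu] := yES (fix_subext [group of <[g]>%g]).
- move=> u /[dup] uE /Em[x Ex]; rewrite -Ex in uE *; apply/fix_subextP => h /cycleP[i ->].
  elim: i => [|i IHi]; first exact: gal_id.
  by rewrite expgS galM ?memvf // gE.
- move=> u /[dup] uS /Sm[x Ex]; rewrite -Ex in uS *; apply/fix_subextP => h /cycleP[i ->].
  elim: i => [|i IHi]; first exact: gal_id.
  by rewrite expgS galM ?memvf // gS.
rewrite -Eu; move/fixedFieldP: uF => -> //; first exact: memvf.
exact: cycle_id.
Qed.

Lemma gp_adjoin E F : in_model E -> in_model F -> gp (adjoin E F) = gp E :&: gp F.
Proof.
move=> Em Fm; apply/setP => g; rewrite in_setI; apply/idP/andP.
  by move=> /(gp_adjoinP g Em Fm)[gE gF]; split=> //; apply/gpP.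
by case=> gE /gpP gF; apply/(gp_adjoinP g Em Fm).
Qed.

Lemma ext_degree_index E m : in_model E -> ext_degree E m <-> #|G : gp E|%g = m.
Proof.
move=> Em; have [M [MP GM]] := subext_subfield E.
have <- : \dim M = #|G : gp E|%g.
  have galM : galois M {:L} by apply: galoisS galL; rewrite sub1v subvf.
  have := dim_fixed_galois galL (gp_sub1 E : gp_group E \subset G).
  rewrite /= -GM; move/galois_fixedField: galM => ->.
  by rewrite dimv1 divn1.
have jZ a y : j (a *: y) = iota a * j y by rewrite -mulr_algl rmorphM /= jK.
split=> [[b [bE bP]]|<-].
  have [bL Db] := choice (fun i => Em _ (bE i)).
  pose t := [tuple bL i | i < m].
  have tE (i : 'I_m) : t`_i = bL i by rewrite -tnth_nth tnth_mktuple.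
  suffices tb : basis_of M t by rewrite (size_basis tb).
  rewrite /basis_of; apply/andP; split.
    rewrite eqEsubv; apply/andP; split.
      apply/span_subvP => _ /mapP[i _ ->]; apply/MP; rewrite Db; exact: bE.
    apply/subvP => y /MP /bP[c [Ec _]].
    have -> : y = \sum_(i < m) c i *: t`_i.
      apply: (fmorph_inj j); rewrite Ec rmorph_sum; apply: eq_bigr => i _.
      by rewrite jZ tE Db.
    by apply: rpred_sum => i _; rewrite memvZ // memv_span // mem_nth ?size_tuple.
  apply/freeP => k k0 i.
  have /bP[c [_ cuniq]] : se_set E 0 by rewrite -(rmorph0 iota); apply: se_base.
  have c0 : c = [ffun=> 0].
    by apply: cuniq; rewrite big1 // => l _; rewrite ffunE rmorph0 mul0r.
  have : c = [ffun l => k l].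
    apply: cuniq; rewrite -[LHS](rmorph0 j) -[in LHS]k0 rmorph_sum; apply: eq_bigr => l _.
    by rewrite jZ tE Db ffunE.
  by rewrite c0 => /ffunP/(_ i); rewrite !ffunE.
pose b (i : 'I_(\dim M)) := j (vbasis M)`_i.
exists b; split=> [i|v vE].
  by apply/MP/vbasis_mem/mem_nth; rewrite size_tuple.
have [y Dv] := Em v vE; rewrite -Dv in vE *; move/MP: vE => yM.
have jb c : \sum_(i < \dim M) iota (c i) * b i = j (\sum_(i < \dim M) c i *: (vbasis M)`_i).
  by rewrite rmorph_sum; apply: eq_bigr => i _; rewrite jZ.
exists [ffun i => coord (vbasis M) i y]; split.
  rewrite (eq_bigr (fun i => iota (coord (vbasis M) i y) * b i)) => [|i _]; last by rewrite ffunE.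
  by rewrite jb -coord_vbasis.
move=> c; rewrite jb => /fmorph_inj Ey; apply/ffunP => i; rewrite ffunE Ey.
by rewrite coord_sum_free // (basis_free (vbasisP M)).
Qed.

End GaloisModel.

(** * Isomorphism as conjugacy, primitivity as maximality *)

Section ModelIso.
Variables (K Ks : fieldType) (iota : {rmorphism K -> Ks}).

Lemma field_of_mem (E : subext iota) (x : field_of E) : se_set E (se_val x).
Proof. by apply/asboolP; exact: (valP x). Qed.

(** A basis of [E] over [K]: any model containing it contains [E]. This is how models are chosen
    large enough. *)
Lemma ext_degree_gens (E : subext iota) m : ext_degree E m -> exists s : seq Ks,
  forall (L : splittingFieldType K) (j : {rmorphism L -> Ks}),
    (forall a : K, j a%:A = iota a) -> (forall x, x \in s -> exists y, j y = x) ->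
    in_model j E.
Proof.
move=> [b [bE bP]]; exists [seq b i | i <- enum 'I_m] => L j jK js x /bP[c [-> _]].
have [y Dy] := choice (fun i => js (b i) (map_f b (mem_enum 'I_m i))).
exists (\sum_(i < m) c i *: y i); rewrite rmorph_sum; apply: eq_bigr => i _.
by rewrite -mulr_algl rmorphM /= jK Dy.
Qed.

Lemma fixes_base_horner (E F : subext iota) (f : {rmorphism field_of E -> field_of F}) :
  fixes_base f -> forall (q : {poly K}) (x y : field_of E),
    se_val y = (map_poly iota q).[se_val x] ->
    se_val (f y) = (map_poly iota q).[se_val (f x)].
Proof.
move=> fK; elim/poly_ind => [|q c IHq] x y.
  by rewrite rmorph0 !horner0 -(rmorph0 iota) => Ey; apply: fK.
rewrite rmorphD rmorphM /= map_polyX map_polyC !hornerMXaddC => Ey.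
have qE : se_set E (map_poly iota q).[se_val x].
  elim/poly_ind: (q) => [|r d IHr]; first by rewrite rmorph0 horner0 -(rmorph0 iota); apply: se_base.
  rewrite rmorphD rmorphM /= map_polyX map_polyC hornerMXaddC.
  apply: se_D; last exact: se_base.
  by apply: se_M => //; apply/asboolP; exact: (valP x).
have [qE' cE] : (map_poly iota q).[se_val x] \in se_pred E /\ iota c \in se_pred E.
  by split; apply/asboolP => //; apply: se_base.
pose y1 := SubExtType qE'; pose y2 := SubExtType cE.
have -> : y = y1 * x + y2 by apply: val_inj; rewrite /= Ey.
rewrite rmorphD rmorphM.
have -> : se_val (f y1 * f x + f y2) = se_val (f y1) * se_val (f x) + se_val (f y2) by [].
by rewrite (IHq x y1) // (fK c y2).
Qed.

Variables (L : splittingFieldType K) (j : {rmorphism L -> Ks}).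
Hypotheses (jK : forall a : K, j a%:A = iota a) (galL : galois 1 {:L}).
Implicit Types (E F : subext iota) (g h : gal_of {:L}).
Local Notation G := ('Gal({:L} / 1))%G.

Lemma gal_mem_conj E F g : in_model j E -> in_model j F -> gp j F = (gp j E :^ g)%g ->
  forall y, se_set F (j (g y)) <-> se_set E (j y).
Proof.
move=> Em Fm EF y; split=> [/(model_fixedP jK galL) gF|/(model_fixedP jK galL) gE];
  apply/(model_fixedP jK galL) => h hE.
  by apply: (fmorph_inj g); have := gF (h ^ g)%g; rewrite gal_conjE EF memJ_conjg; apply.
move: hE; rewrite EF => /imsetP[h' h'E ->]; rewrite gal_conjE; congr (g _).
exact: gE.
Qed.

Lemma restrict_gal E F g : in_model j E -> in_model j F -> gp j F = (gp j E :^ g)%g ->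
  exists f : {rmorphism field_of E -> field_of F}, [/\ bijective f, fixes_base f
    & forall x u, j u = se_val x -> j (g u) = se_val (f x)].
Proof.
move=> Em Fm EF; have memE := gal_mem_conj Em Fm EF.
have exf (x : field_of E) : exists y : field_of F, exists2 u, j u = se_val x & j (g u) = se_val y.
  have [u Du] := Em _ (field_of_mem x).
  have uF : j (g u) \in se_pred F by apply/asboolP/memE; rewrite Du; apply: field_of_mem.
  by exists (SubExtType uF), u.
have exh (y : field_of F) : exists x : field_of E, exists2 u, j u = se_val x & j (g u) = se_val y.
  have [u Du] := Fm _ (field_of_mem y).
  have uE : j ((g^-1)%g u) \in se_pred E by apply/asboolP/memE; rewrite gal_invK Du; apply: field_of_mem.
  by exists (SubExtType uE), ((g^-1)%g u) => //; rewrite gal_invK.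
have [f fP] := choice exf; have [h hP] := choice exh.
have fE x u : j u = se_val x -> j (g u) = se_val (f x).
  by move=> Du; have [u' Du' <-] := fP x; congr (j (g _)); apply: (fmorph_inj j); rewrite Du.
have fB : zmod_morphism f.
  move=> x y; have [[u Du Du'] [w Dw Dw']] := (fP x, fP y); apply: val_inj => /=.
  by rewrite -(fE (x - y) (u - w)) ?rmorphB ?Du' ?Dw' //= ?rmorphB Du Dw.
have fM : monoid_morphism f.
  split=> [|x y].
    by apply: val_inj; rewrite /= -(fE 1 1) ?rmorph1.
  have [[u Du Du'] [w Dw Dw']] := (fP x, fP y); apply: val_inj => /=.
  by rewrite -(fE (x * y) (u * w)) ?rmorphM ?Du' ?Dw' //= Du Dw.
pose fR : {rmorphism field_of E -> field_of F} :=
  HB.pack f (GRing.isZmodMorphism.Build _ _ f fB) (GRing.isMonoidMorphism.Build _ _ f fM).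
exists fR; split; last exact: fE.
  exists h => [x|y] /=.
    have [u Du Eu] := hP (f x); apply: val_inj; rewrite /= -Du.
    have [w Dw Ew] := fP x; rewrite -Dw; congr (j _).
    by apply: (fmorph_inj g); apply: (fmorph_inj j); rewrite Eu Ew.
  by have [u Du Eu] := hP y; apply: val_inj; rewrite /= -(fE _ _ Du).
move=> a x Dx /=; rewrite -(fE x a%:A) ?jK //.
by rewrite linearZ /= rmorph1 jK.
Qed.

Lemma conj_iso E F g : in_model j E -> in_model j F -> gp j F = (gp j E :^ g)%g ->
  K_isomorphic E F.
Proof. by move=> Em Fm EF; have [f [fbij fK _]] := restrict_gal Em Fm EF; exists f. Qed.

(** The image under [f] of a separable generator of [E] is a conjugate of it, and normality of [L]
    provides the automorphism. *)
Lemma extend_iso E F (f : {rmorphism field_of E -> field_of F}) :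
    in_model j F -> fixes_base f ->
  exists2 g, g \in G & forall y (yE : j y \in se_pred E), se_val (f (SubExtType yE)) = j (g y).
Proof.
move=> Fm fK.
have [M [MP GM]] := subext_subfield jK E.
have [_ sepL nL] := and3P galL.
have sepM : separable 1 M by apply: separableSr sepL; apply: subvf.
have DM := eq_adjoin_separable_generator sepM (sub1v _).
set t := separable_generator _ _ in DM.
have tM : t \in M by rewrite DM memv_adjoin.
have tE : j t \in se_pred E by apply/asboolP/MP.
pose x := SubExtType tE.
have [u Du] := Fm _ (field_of_mem (f x)).
have /polyOver1P[q Dq] := minPolyOver 1 t.
have jq (r : {poly K}) y : j (map_poly (in_alg L) r).[y] = (map_poly iota r).[j y].
  by rewrite -horner_map -map_poly_comp; congr (_.[_]); apply: eq_map_poly => a; apply: jK.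
have rootu : root (minPoly 1 t) u.
  rewrite rootE Dq -(fmorph_eq0 j) jq Du -(fixes_base_horner fK (y := 0)) ?rmorph0 //.
  by rewrite -[se_val x]/(j t) -jq -Dq (eqP (root_minPoly 1 t)) rmorph0.
have [g gG gt] := normalField_root_minPoly (sub1v _) nL (memvf t) rootu.
exists g => // y yE.
have : y \in M by apply/MP/asboolP.
rewrite DM => /Fadjoin_polyP[r /polyOver1P[r' ->] Dy].
rewrite (fixes_base_horner fK (q := r') (x := x)); last by rewrite /= Dy jq.
rewrite -Du -gt -jq Dy -(horner_map g); congr (j (_.[_])).
by rewrite -map_poly_comp; apply: eq_map_poly => a /=; rewrite gal_in_alg.
Qed.

Lemma iso_conj E F : in_model j E -> in_model j F -> K_isomorphic E F ->
  exists2 g, g \in G & gp j F = (gp j E :^ g)%g.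
Proof.
move=> Em Fm [f [fbij fK]].
have [g gG fg] := extend_iso Fm fK; exists g => //.
have memE y : se_set E (j y) -> se_set F (j (g y)).
  by move/asboolP => yE; rewrite -(fg y yE); apply: field_of_mem.
have memF y : se_set F (j y) -> exists2 y', se_set E (j y') & y = g y'.
  case: fbij => h fh hf /asboolP yF.
  have [y' Dy'] := Em _ (field_of_mem (h (SubExtType yF))).
  have y'E : se_set E (j y') by rewrite Dy'; apply: field_of_mem.
  exists y' => //; have /asboolP y'E' := y'E; apply: (fmorph_inj j); rewrite -(fg _ y'E').
  have -> : SubExtType y'E' = h (SubExtType yF) by apply: val_inj.
  by rewrite hf.
apply/setP => h; apply/gpP/imsetP => [hF|[h' /gpP h'E -> y /memF[y' y'E ->]]].
  exists (h ^ g^-1)%g; last by rewrite conjgKV.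
  apply/gpP => y /memE/hF E1; rewrite -[y in LHS](gal_invK (g^-1)%g) invgK gal_conjE.
  by rewrite E1 -galM ?memvf // mulgV gal_id.
by rewrite gal_conjE h'E.
Qed.

Lemma primitive_maximal E : in_model j E -> primitive_ext E -> maximal (gp j E) G.
Proof.
move=> Em [[m m1 /(ext_degree_index jK galL _ Em) Dm] primE].
apply/maxgroupP; split.
  by rewrite properE gp_sub1 -(indexg_eq1 _ (gp_group j E)) Dm gtn_eqF.
move=> M prM sEM.
have [|FE|FE] := primE (fix_subext jK M).
- by apply: (gp_le jK galL); [exact: fix_subext_model | rewrite gp_fix].
- have := proper_subn prM; rewrite -(gp_fix jK M) -(gp_base jK).
  by case/negP; apply: gpS; rewrite FE.
- by rewrite -(gp_fix jK M); apply/eqP; rewrite eqEsubset !gpS // FE.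
Qed.

Lemma maximal_primitive E : in_model j E -> maximal (gp j E) G -> primitive_ext E.
Proof.
move=> Em /maxgroupP[prE maxE]; split.
  exists #|G : gp j E|%g; last exact/(ext_degree_index jK galL).
  rewrite ltn_neqAle eq_sym (indexg_eq1 _ (gp_group j E)) indexg_gt0 andbT.
  exact: (proper_subn prE).
move=> F sFE; have Fm : in_model j F by move=> x /sFE/Em.
have sgp := gpS j sFE.
have [FG|FG] := eqVneq (gp j F) G; [left|right].
  by apply: (gp_inj jK galL) => //; [exact: (base_in_model jK) | rewrite FG (gp_base jK)].
apply: (gp_inj jK galL) => //; apply: (maxE (gp_group j F)) => //.
by rewrite properEneq FG gp_sub1.
Qed.
End ModelIso.

(** * The fields K_n and L_n *)

Section KummerTower.
Variables (p n : nat) (K Ks : fieldType) (iota : {rmorphism K -> Ks}) (z : Ks).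
Hypotheses (p_pr : prime p) (n_gt0 : (0 < n)%N) (hK : is_p_field p K)
  (prim_z : ((p ^ n).-1)%N.-primitive_root z).
Local Notation e := ((p ^ n).-1)%N.
Local Notation Kn := (K_ iota z).
Local Notation Ln := (L_ iota e z).

Lemma e_gt0 : (0 < e)%N.
Proof. exact: prim_order_gt0 prim_z. Qed.

Definition is_eth_root (y : Ks) := se_set Kn (y ^+ e) /\ y != 0.

Lemma eth_root_Ln y : is_eth_root y -> se_set Ln y.
Proof. by move=> yr F _; apply. Qed.

Section InModel.
Variables (L : splittingFieldType K) (j : {rmorphism L -> Ks}).
Hypotheses (jK : forall a : K, j a%:A = iota a) (galL : galois 1 {:L}).
Implicit Types (g h b : gal_of {:L}) (y : L).
Local Notation G := ('Gal({:L} / 1))%G.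
Variable zL : L.
Hypothesis jz : j zL = z.

Let prim_zL : e.-primitive_root zL.
Proof. by rewrite -(fmorph_primitive_root j) jz. Qed.

Let zL_neq0 : zL != 0.
Proof.
apply: contra_eq_neq (prim_expr_order prim_zL) => ->.
by rewrite expr0n eqn0Ngt e_gt0 eq_sym oner_eq0.
Qed.

Lemma Kn_in_model : in_model j Kn.
Proof.
apply: (adjoin_in_model jK); first exact: base_in_model.
by move=> _ ->; exists zL.
Qed.

Lemma gp_KnP g : reflect (g zL = zL) (g \in gp j Kn).
Proof.
have zm x : [set z]%classic x -> exists y, j y = x by move=> ->; exists zL.
apply: (iffP idP) => [/(gp_adjoinP jK g (base_in_model jK) zm)[_]|gz]; first exact.
apply/(gp_adjoinP jK g (base_in_model jK) zm); split; first by rewrite (gp_base jK) mem_gal1.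
by move=> y /=; rewrite -jz => /fmorph_inj->.
Qed.

Lemma gal_zL g : exists i : nat, g zL = zL ^+ i.
Proof.
have [|i ->] := @prim_rootP _ _ _ prim_zL (g zL); last by exists i.
by rewrite -rmorphXn (prim_expr_order prim_zL) rmorph1.
Qed.

Lemma gp_Kn_normal : (gp j Kn <| G)%g.
Proof.
rewrite /normal gp_sub1 /=; apply/subsetP => g _; rewrite inE.
apply/subsetP => _ /imsetP[h /gp_KnP hz ->]; apply/gp_KnP.
have [i Ei] := gal_zL (g^-1)%g.
have hX : h (zL ^+ i) = zL ^+ i by rewrite rmorphXn /= hz.
by rewrite -{1}(gal_invK g zL) gal_conjE Ei hX -Ei gal_invK.
Qed.

Lemma eth_root_gal b y : b \in gp j Kn -> is_eth_root (j y) -> exists i : nat, b y = zL ^+ i * y.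
Proof.
move=> bB []; rewrite -rmorphXn => /(model_fixedP jK galL)/(_ b bB) by_ jy0.
have y0 : y != 0 by apply: contraNneq jy0 => ->; rewrite rmorph0.
have [|i Ei] := @prim_rootP _ _ _ prim_zL (b y / y).
  by rewrite expr_div_n -[b y ^+ e](rmorphXn b) /= by_ divff // expf_neq0.
by exists i; rewrite -Ei divfK.
Qed.

Lemma gal_zLX b i y : b \in gp j Kn -> b (zL ^+ i * y) = zL ^+ i * b y.
Proof. by move/gp_KnP => bz; rewrite rmorphM rmorphXn /= bz. Qed.

Lemma eth_root_exp b y k : b \in gp j Kn -> is_eth_root (j y) ->
  exists i : nat, (b ^+ k)%g y = zL ^+ (i * k) * y.
Proof.
move=> bB yr; have [i Ei] := eth_root_gal bB yr; exists i.
elim: k => [|k IHk]; first by rewrite gal_id muln0 expr0 mul1r.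
by rewrite expgSr galM ?memvf // IHk gal_zLX // Ei mulrA -exprD -mulnSr.
Qed.

Section Generated.
Variable S : set Ks.
Hypotheses (Sroot : forall x, S x -> is_eth_root x) (Sm : forall x, S x -> exists y, j y = x).
Local Notation E := (adjoin Kn S).
Local Notation B := (gp_group j Kn).

Lemma gp_ES_P g : reflect (g \in B /\ forall y, S (j y) -> g y = y) (g \in gp j E).
Proof. by apply: (iffP idP) => /(gp_adjoinP jK g Kn_in_model Sm). Qed.

Lemma gp_ES_sub : gp j E \subset B.
Proof. by apply/subsetP => g /gp_ES_P[]. Qed.

Lemma gp_ES_exp b : b \in B -> (b ^+ e)%g \in gp j E.
Proof.
move=> bB; apply/gp_ES_P; split=> [|y /Sroot yr]; first by rewrite groupX.
have [i ->] := eth_root_exp e bB yr.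
by rewrite mulnC exprM (prim_expr_order prim_zL) expr1n mul1r.
Qed.

(** Elements of [B] multiply each root by powers of [zL], which [B] fixes, so their actions on the
    root commute. *)
Lemma gp_ES_comm : [~: B, B]%g \subset gp j E.
Proof.
rewrite gen_subG; apply/subsetP => _ /imset2P[a b aB bB ->].
apply/gp_ES_P; split=> [|y /Sroot yr]; first by rewrite groupR.
have [i Ei] := eth_root_gal aB yr; have [k Ek] := eth_root_gal bB yr.
have cB : [~ a, b]%g \in B by rewrite groupR.
have Eab : (a * b)%g y = zL ^+ (i + k) * y.
  by rewrite galM ?memvf // Ei gal_zLX // Ek mulrA -exprD.
have Eba : (b * a)%g y = zL ^+ (i + k) * y.
  by rewrite galM ?memvf // Ek gal_zLX // Ei mulrA -exprD addnC.
have z0 : zL ^+ (i + k) != 0 by rewrite expf_neq0 // zL_neq0.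
apply: (mulfI z0); rewrite -Eab (commgC a b) (galM (b * a)%g) ?memvf // Eba gal_zLX //.
Qed.

Lemma gp_ES_normal : (gp j E <| B)%g.
Proof. by apply: sub_der1_normal gp_ES_sub; apply: gp_ES_comm. Qed.
End Generated.

Lemma prim_root_sum (k : nat) : (k < e)%N ->
  \sum_(i < e) zL ^+ (i * k) = (if k == 0%N then e%:R else 0).
Proof.
move=> ltk; case: eqP => [->|/eqP k0].
  rewrite (eq_bigr (fun=> 1)) ?sumr_const ?card_ord // => i _.
  by rewrite muln0 expr0.
have zk : zL ^+ k != 1 by rewrite -(prim_order_dvd prim_zL) gtnNdvd // lt0n.
apply: (mulfI (_ : zL ^+ k - 1 != 0)); first by rewrite subr_eq0.
rewrite mulr0 (eq_bigr (fun i : 'I_e => (zL ^+ k) ^+ i)) => [|i _]; last by rewrite -exprM mulnC.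
by rewrite -subrX1 -exprM mulnC exprM (prim_expr_order prim_zL) expr1n subrr.
Qed.

(* A commuting family of operators of order e on the fixed field of A is
   diagonalizable over Kn, and a common eigenvector is an e-th root. *)
Lemma kummer_maximal (A : {group gal_of {:L}}) : (A <| gp j Kn)%g ->
    [~: gp j Kn, gp j Kn]%g \subset A -> (forall b, b \in gp j Kn -> (b ^+ e)%g \in A) ->
  forall y, (forall a, a \in A -> a y = y) -> se_set Ln (j y).
Proof.
move=> nAB cA eA.
have comm a b y : a \in gp j Kn -> b \in gp j Kn -> (forall a, a \in A -> a y = y) ->
    a (b y) = b (a y).
  move=> aB bB Ay; rewrite -!galM ?memvf // (commgC b a) (galM (a * b)%g) ?memvf //.
  have cAB : ([~ b, a] ^ (a * b)^-1)%g \in A.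
    have abB : ((a * b)^-1)%g \in gp j Kn by rewrite groupV groupM.
    rewrite memJ_norm; last exact: subsetP (normal_norm nAB) _ abB.
    by apply: (subsetP cA); apply: mem_commg.
  by rewrite -(conjgKV (a * b)%g [~ b, a]%g) gal_conjE Ay.
have fixX b y k : b \in gp j Kn -> (forall a, a \in A -> a y = y) ->
    forall a, a \in A -> a ((b ^+ k)%g y) = (b ^+ k)%g y.
  move=> bB Ay a aA; have bkB : (b ^+ k)%g \in gp j Kn by rewrite groupX.
  by rewrite (comm _ _ _ (subsetP (normal_sub nAB) a aA) bkB Ay) Ay.
(* Induction on the list [bs] of elements not yet known to multiply [y] by a power of [zL]. When it
   is empty, the power of [y] of exponent e is fixed by the group of K_n. *)
have main (bs : seq (gal_of {:L})) y : {subset bs <= gp j Kn} ->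
    (forall a, a \in A -> a y = y) ->
    (forall b, b \in gp j Kn -> b \in bs \/ exists i : nat, b y = zL ^+ i * y) ->
    se_set Ln (j y).
  elim: bs y => [|b bs IH] y sbs Ay eig.
    have [->|y0] := eqVneq y 0; first by rewrite rmorph0 -(rmorph0 iota); apply: se_base.
    apply: eth_root_Ln; split; last by rewrite fmorph_eq0.
    rewrite -rmorphXn; apply/(model_fixedP jK galL) => b /eig[//|[i Ei]].
    by rewrite rmorphXn /= Ei exprMn exprAC (prim_expr_order prim_zL) expr1n mul1r.
  have bB : b \in gp j Kn by apply: sbs; rewrite mem_head.
  pose F i k := zL ^+ (i * k) * (b ^+ k)%g y.
  (* Lagrange resolvents of [y] for [b]: each is an eigenvector of [b], remains one for the elements
     already treated, and together they sum to e times [y]. *)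
  pose Y i := \sum_(k < e) F i k.
  have Fe i : F i e = F i 0%N.
    rewrite /F mulnC exprM (prim_expr_order prim_zL) expr1n muln0 expr0 !mul1r gal_id.
    by rewrite Ay // eA.
  have AY i a : a \in A -> a (Y i) = Y i.
    move=> aA; rewrite /Y rmorph_sum; apply: eq_bigr => k _.
    by rewrite /F /= gal_zLX ?(subsetP (normal_sub nAB)) // fixX.
  have bY i : zL ^+ i * b (Y i) = Y i.
    apply/eqP; rewrite -subr_eq0 /Y rmorph_sum mulr_sumr -sumrB.
    rewrite (eq_bigr (fun k : 'I_e => F i k.+1 - F i k)) => [|k _].
      by rewrite -(big_mkord xpredT (fun k => F i k.+1 - F i k)) telescope_sumr // Fe subrr.
    by rewrite {1}/F /= gal_zLX // mulrA -exprD -mulnS /F expgSr galM ?memvf.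
  have YLn i : se_set Ln (j (Y i)).
    apply: IH => [c cbs||c cB]; [by apply: sbs; rewrite inE cbs orbT|exact: AY|].
    have [|[m Em]] := eig c cB.
      rewrite inE => /predU1P[->|]; [right|by left].
      (* The inverse of [zL ^+ i] as a power with nonnegative exponent. *)
      exists (i * e.-1)%N.
      rewrite -[in RHS](bY i) mulrA -exprD -mulnSr prednK ?e_gt0 // mulnC exprM.
      by rewrite (prim_expr_order prim_zL) expr1n mul1r.
    right; exists m; rewrite /Y rmorph_sum mulr_sumr; apply: eq_bigr => k _.
    rewrite /F /= gal_zLX // comm ?groupX // Em gal_zLX ?groupX //.
    by rewrite mulrCA.
  have e0 : e%:R != 0 :> L by exact: prim_root_natf_neq0 prim_zL.
  have sumY : \sum_(i < e) Y i = e%:R * y.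
    rewrite /Y exchange_big /= (eq_bigr (fun k : 'I_e => (if k == 0%N :> nat then e%:R else 0) * (b ^+ k)%g y)).
      rewrite (bigD1 (Ordinal e_gt0)) //= gal_id big1 ?addr0 // => k k0.
      by move: k0; rewrite -val_eqE /= => /negPf->; rewrite mul0r.
    by move=> k _; rewrite -prim_root_sum // -mulr_suml.
  have -> : y = (\sum_(i < e) Y i) / e%:R by rewrite sumY mulrC mulKf.
  rewrite fmorph_div rmorph_nat; apply: se_div; last first.
    by rewrite -(rmorph_nat iota); apply: se_base.
  rewrite rmorph_sum; elim/big_ind: _ => //.
    by rewrite -(rmorph0 iota); apply: se_base.
  by move=> u v uL vL; apply: se_D.
move=> y Ay; apply: (main (enum (gp j Kn))) => // b; rewrite mem_enum //.
by left.
Qed.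
End InModel.
End KummerTower.

Lemma coprime_exp_mem (gT : finGroupType) (H : {group gT}) (x : gT) (a b : nat) :
  coprime a b -> (x ^+ a)%g \in H -> (x ^+ b)%g \in H -> x \in H.
Proof.
move=> cab xa xb; have [a0|a0] := posnP a.
  by move: cab; rewrite a0 /coprime gcd0n => /eqP b1; rewrite b1 expg1 in xb.
case: (egcdnP b a0) => km kn; rewrite (eqP cab) => Ek _.
have Ex : (x ^+ (km * a) = x ^+ (kn * b) * x)%g by rewrite Ek addn1 expgSr.
have -> : x = ((x ^+ (kn * b))^-1 * x ^+ (km * a))%g by rewrite Ex mulKg.
rewrite [(kn * b)%N]mulnC [(km * a)%N]mulnC !expgM.
by apply: groupM; rewrite ?groupV; apply: groupX.
Qed.

Section KummerTowerIndex.
Variables (p n : nat) (K Ks : fieldType) (iota : {rmorphism K -> Ks}) (z : Ks).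
Hypotheses (p_pr : prime p) (n_gt0 : (0 < n)%N) (hK : is_p_field p K)
  (prim_z : ((p ^ n).-1)%N.-primitive_root z).
Local Notation e := ((p ^ n).-1)%N.
Local Notation Kn := (K_ iota z).
Local Notation Ln := (L_ iota e z).
Local Notation eth_root := (is_eth_root p n iota z).

Section InModel.
Variables (L : splittingFieldType K) (j : {rmorphism L -> Ks}).
Hypotheses (jK : forall a : K, j a%:A = iota a) (galL : galois 1 {:L}).
Implicit Types (g h b : gal_of {:L}) (y : L).
Local Notation G := ('Gal({:L} / 1))%G.
Variable zL : L.
Hypothesis jz : j zL = z.
Local Notation B := (gp_group j Kn).

Let prim_zL : e.-primitive_root zL.
Proof. by rewrite -(fmorph_primitive_root j) jz. Qed.

Lemma zL_frob_mod (i : nat) : zL ^+ (p ^ i) = zL ^+ (p ^ (i %% n)).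
Proof.
have pn1 : (0 < p ^ n)%N by rewrite expn_gt0 prime_gt0.
have zn m : zL ^+ (p ^ (n * m)) = zL.
  elim: m => [|m IHm]; first by rewrite muln0 expn0 expr1.
  rewrite mulnS expnD exprM -[X in zL ^+ X](prednK pn1) exprS (prim_expr_order prim_zL).
  by rewrite mulr1.
by rewrite [in LHS](divn_eq i n) expnD exprM mulnC zn.
Qed.

(** Each automorphism sends [zL] to its power of exponent p^i with [i] taken modulo [n], and [i]
    determines the coset. *)
Lemma index_Kn : (#|G : gp j Kn|%g <= n)%N.
Proof.
have [T [W [_ [_ tc]]]] := tame_structure hK galL.
have ex g : exists i : 'I_n, g zL = zL ^+ (p ^ i).
  have [i [_ /(_ zL e (coprime_pred_exp p_pr n_gt0) (prim_expr_order prim_zL)) Ei]] := tc g.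
  exists (Ordinal (ltn_pmod i n_gt0)); rewrite /= -zL_frob_mod; exact: Ei.
have [f fP] := choice ex.
have rc c : c \in rcosets B G -> c = (B :* fingroup.repr c)%g.
  by case/rcosetsP => g _ ->; rewrite rcoset_repr.
have inj : {in rcosets B G &, injective (fun c => f (fingroup.repr c))}.
  move=> c d cC dC fcd; rewrite (rc c cC) (rc d dC); apply/rcoset_eqP.
  rewrite mem_rcoset; apply/(gp_KnP jK jz); rewrite galM ?memvf //.
  by rewrite fP fcd -fP -galM ?memvf // mulgV gal_id.
by rewrite /indexg -(card_in_imset inj) -[X in (_ <= X)%N]card_ord max_card.
Qed.

(** As [b] fixes [zL], e divides p^i - 1, so the power of [t] of exponent p^i is [t] times a power
    of [t ^+ e]. *)
Lemma tame_commutator (T W : {group gal_of {:L}}) :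
    (forall g, exists i : nat,
      (forall t, t \in T -> exists2 u, u \in W & (t ^ g)%g = (t ^+ (p ^ i) * u)%g) /\
      (forall (y : L) (m : nat), coprime p m -> y ^+ m = 1 -> g y = y ^+ (p ^ i))) ->
  forall t b, t \in T -> b \in B ->
    exists k, exists2 u, u \in W & (t ^ b = t * (t ^+ e) ^+ k * u)%g.
Proof.
move=> tc t b tT bB; have [i [ti zi]] := tc b.
have [u uW Eu] := ti t tT.
have := zi zL e (coprime_pred_exp p_pr n_gt0) (prim_expr_order prim_zL).
have /(gp_KnP jK jz)-> := bB => /eqP.
rewrite -[X in X == _]expr1 eq_sym (eq_prim_root_expr prim_zL) eqn_mod_dvd ?expn_gt0 ?prime_gt0 //.
case/dvdnP=> k Ek; exists k, u => //.
by rewrite Eu -expgM -expgS mulnC -Ek subn1 prednK // expn_gt0 prime_gt0.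
Qed.

Section Generated.
Variable S : set Ks.
Hypotheses (Sroot : forall x, S x -> eth_root x) (Sm : forall x, S x -> exists y, j y = x).
Local Notation E := (adjoin Kn S).

(** The bound is independent of [S]. Modulo the group of [E], each element of [B] is a power of [b0]
    times a power of [t1], with exponents modulo e: wild elements of [B] have p-power order and e-th
    power in that group, hence lie in it. *)
Lemma index_ES : (#|gp j Kn : gp j E|%g <= e * e)%N.
Proof.
have [T [W [[nTG nWG sWT pW cTW] [cGT tc]]]] := tame_structure hK galL.
have sBG : gp j Kn \subset G := gp_sub1 _ _.
have nEB := gp_ES_normal prim_z jK galL jz Sroot Sm.
have eE := gp_ES_exp prim_z jK galL jz Sroot Sm.
have [b0 b0B b0P] := cyclic_quotient_gen nTG sBG cGT.
have nWT : (W <| T)%g by apply: normalS sWT (normal_sub nTG) nWG.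
have [t1 t1TB t1P] := cyclic_quotient_gen nWT (subsetIl T B : [group of T :&: B] \subset T) cTW.
have [t1T t1B] := setIP t1TB.
have WE u : u \in W -> u \in B -> u \in gp j E.
  move=> uW uB; have [k Ek] := p_natP (pnat_dvd (order_dvdG uW) pW).
  have ck : coprime e (p ^ k) by rewrite coprimeXr // coprime_sym coprime_pred_exp.
  apply: (@coprime_exp_mem _ (gp_group j E) u _ _ ck); first exact: eE.
  by rewrite -Ek expg_order group1.
have nE b : b \in B -> b \in 'N(gp j E)%g by apply: (subsetP (normal_norm nEB)).
rewrite -card_quotient ?normal_norm //.
pose f (kl : 'I_e * 'I_e) := (coset (gp j E) b0 ^+ kl.1 * coset (gp j E) t1 ^+ kl.2)%g.
have modE b k : b \in B -> (coset (gp j E) b ^+ k = coset (gp j E) b ^+ (k %% e))%g.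
  move=> bB; rewrite {1}(divn_eq k e) expgD mulnC expgM.
  have -> : (coset (gp j E) b ^+ e = 1)%g by rewrite -morphX ?nE //= coset_id // eE.
  by rewrite expg1n mul1g.
have e0 := e_gt0 prim_z.
have : (gp j Kn / gp j E)%g \subset [set f kl | kl in {: 'I_e * 'I_e}].
  apply/subsetP => _ /morphimP[b bN bB ->].
  have [k [t tT Eb]] := b0P b bB.
  have tB : t \in B by rewrite -(mulKg (b0 ^+ k)%g t) -Eb groupM ?groupV ?groupX.
  have [l [u uW Et]] := t1P t (introT setIP (conj tT tB)).
  have uB : u \in B by rewrite -(mulKg (t1 ^+ l)%g u) -Et groupM ?groupV ?groupX.
  apply/imsetP; exists (Ordinal (ltn_pmod k e0), Ordinal (ltn_pmod l e0)) => //.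
  rewrite /f /= -!modE // Eb Et.
  have [[bN0 tN1] uN] := (nE _ b0B, nE _ t1B, nE _ uB).
  rewrite !morphM ?groupM ?groupX //= (coset_id (WE u uW uB)) mulg1.
  by rewrite !morphX.
move/subset_leq_card/leq_trans; apply; apply: leq_trans (leq_imset_card _ _) _.
by rewrite card_prod card_ord.
Qed.
End Generated.

Section LnInModel.
Hypothesis Lnm : in_model j Ln.

Let Sroot : forall x, eth_root x -> eth_root x. Proof. by []. Qed.
Let Sm : forall x, eth_root x -> exists y, j y = x.
Proof. by move=> x /eth_root_Ln/Lnm. Qed.

Lemma gp_Ln_sub : gp j Ln \subset gp j Kn.
Proof. exact: (gp_ES_sub jK jz Sm). Qed.

Lemma gp_Ln_exp b : b \in gp j Kn -> (b ^+ e)%g \in gp j Ln.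
Proof. exact: (gp_ES_exp prim_z jK galL jz Sroot Sm). Qed.

(** The generators of L_n are permuted by the Galois group because K_n is stable under it. *)
Lemma gp_Ln_normal : (gp j Ln <| G)%g.
Proof.
rewrite /normal gp_sub1 /=; apply/subsetP => g _; rewrite inE.
have nB := normal_norm (gp_Kn_normal prim_z jK jz).
apply/subsetP => _ /imsetP[r rR ->].
have gG : g \in 'N(gp j Kn)%g by apply: (subsetP nB); apply: mem_gal1.
apply/(gp_ES_P jK jz Sm); split.
  by rewrite memJ_norm //; apply: (subsetP gp_Ln_sub).
move=> y yr; have [yK y0] := yr.
pose x := (g^-1)%g y.
have xr : eth_root (j x).
  split; last first.
    by rewrite fmorph_eq0 /x fmorph_eq0; apply: contraNneq y0 => ->; rewrite rmorph0.
  rewrite -rmorphXn; apply/(model_fixedP jK galL) => b bB.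
  have Ex : g (x ^+ e) = y ^+ e by rewrite rmorphXn /= gal_invK.
  suff : (b ^ g)%g (y ^+ e) = y ^+ e by rewrite -Ex gal_conjE => /fmorph_inj.
  move: yK; rewrite -rmorphXn => /(model_fixedP jK galL); apply.
  by rewrite memJ_norm.
have /(gp_ES_P jK jz Sm)[_ rfix] := rR.
by rewrite -[y in LHS](gal_invK g) gal_conjE rfix // gal_invK.
Qed.
End LnInModel.
End InModel.

Hypothesis sepKs : is_separable_closure iota.

Let largeK := valued_field_large iota hK.

(** If no finite set of e-th roots generated L_n, adjoining them one by one would give groups of
    unbounded index, whereas [index_Kn] and [index_ES] bound it by n e^2. *)
Lemma Ln_finite : exists s : seq Ks,
  forall (L : splittingFieldType K) (j : {rmorphism L -> Ks}),
    (forall a : K, j a%:A = iota a) -> galois 1 {:L} ->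
    (forall x, x \in s -> exists y, j y = x) -> (exists y, j y = z) /\ in_model j Ln.
Proof.
pose Es (s : seq Ks) := adjoin Kn [set` s].
have [s [sr sLn]] : exists s : seq Ks, (forall x, x \in s -> eth_root x) /\
    forall y, eth_root y -> se_set (Es s) y.
  apply: contrapT => H.
  have step (s : seq Ks) : (forall x, x \in s -> eth_root x) ->
      exists y, eth_root y /\ ~ se_set (Es s) y.
    move=> sr; apply: contrapT => H'; apply: H; exists s; split=> // y yr.
    by apply: contrapT => yE; apply: H'; exists y.
  have chain k : exists s : seq Ks, (forall x, x \in s -> eth_root x) /\
      forall (L : splittingFieldType K) (j : {rmorphism L -> Ks}),
        (forall a : K, j a%:A = iota a) -> galois 1 {:L} -> (exists y, j y = z) ->
        (forall x, x \in s -> exists y, j y = x) ->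
        (k < #|('Gal({:L} / 1))%G : gp j (Es s)|%g)%N.
    elim: k => [|k [s [sr IH]]].
      by exists [::]; split=> // L j _ _ _ _; rewrite indexg_gt0.
    have [y [yr yE]] := step s sr.
    have yr' x : x \in y :: s -> eth_root x by rewrite inE => /predU1P[->|/sr].
    exists (y :: s); split=> // L j jK galL [zL jz] sm.
    have sm' x : x \in s -> exists u, j u = x by move=> xs; apply: sm; rewrite inE xs orbT.
    have Knm := Kn_in_model jK jz.
    have lt := IH L j jK galL (ex_intro _ zL jz) sm'.
    apply: leq_ltn_trans lt _.
    have Esm' : in_model j (Es s) by apply: (adjoin_in_model jK Knm sm').
    have ss : gp j (Es (y :: s)) \subset gp j (Es s).
      apply: gpS => x xE F KF sF; apply: xE => // u us; apply: sF.
      by rewrite /= inE us orbT.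
    have nss : ~~ (gp j (Es s) \subset gp j (Es (y :: s))).
      apply/negP => ss'; apply: yE.
      have Em : in_model j (Es (y :: s)) by apply: (adjoin_in_model jK Knm sm).
      apply: (gp_le jK galL Em ss').
      by move=> F _ sF; apply: sF; rewrite /= mem_head.
    have pr : gp j (Es (y :: s)) \proper gp j (Es s) by rewrite properE ss nss.
    have sG := gp_sub1 j (Es s).
    rewrite -(Lagrange_index (sG : gp_group j (Es s) \subset _) (ss : gp_group j _ \subset gp_group j (Es s))).
    by rewrite ltn_Pmulr ?indexg_gt0 // indexg_gt1 proper_subn.
  have [s [sr lt]] := chain (n * (e * e))%N.
  have [L [j [jK galL sm]]] := galois_model sepKs largeK (z :: s).
  have [zL jz] := sm z (mem_head _ _).
  have sm' x : [set` s]%classic x -> exists u, j u = x by move=> /= xs; apply: sm; rewrite inE xs orbT.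
  have := lt L j jK galL (ex_intro _ zL jz) sm'.
  have sB := gp_ES_sub jK jz sm'.
  rewrite -(Lagrange_index (gp_sub1 j Kn : gp_group j Kn \subset _) (sB : gp_group j _ \subset gp_group j Kn)).
  rewrite ltnNge leq_mul ?(index_Kn jK galL jz) //.
  exact: (index_ES jK galL jz sr sm').
exists (z :: s) => L j jK galL sm.
have [zL jz] := sm z (mem_head _ _); split; first by exists zL.
have Knm := Kn_in_model jK jz.
have Esm : in_model j (Es s).
  by apply: (adjoin_in_model jK Knm) => x /= xs; apply: sm; rewrite inE xs orbT.
move=> x /(_ (Es s)) xE; apply: Esm; apply: xE => [u uK F KF _|y]; first exact: KF.
exact: sLn.
Qed.

Lemma zeta_in_Ln : [pchar K] =i pred0 ->
  exists2 c : Ks, p.-primitive_root c & se_set Ln c.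
Proof.
move=> charK.
have p1 : p%:R != 0 :> Ks.
  rewrite -(rmorph_nat iota) fmorph_eq0; apply/negP => p0.
  have := charK p; rewrite inE inE p_pr p0.
  by [].
have sepX : separable_poly ('X^p - 1 : {poly Ks}).
  exact: separable_Xn_sub_1.
have [rs Drs] := sep_splits sepKs sepX.
have urs : uniq rs by rewrite -separable_prod_XsubC -(eqp_separable Drs).
have srs : size rs = p.
  have := eqp_size Drs; rewrite size_prod_XsubC size_XnsubC ?prime_gt0 //.
  by case.
have rsP x : x \in rs -> x ^+ p = 1.
  rewrite -root_prod_XsubC -(eqp_root Drs) rootE !hornerE.
  by rewrite subr_eq0 => /eqP.
have /hasP[c crs c1] : has (predC1 1) rs.
  apply: contraT; rewrite has_predC negbK => /allP all1.
  have : (size rs <= 1)%N by rewrite -[1%N]/(size [:: (1:Ks)]) uniq_leq_size // => x /all1 /=; rewrite inE.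
  by rewrite srs leqNgt prime_gt1.
have cp := rsP c crs.
have primc : p.-primitive_root c.
  have [m pm] := prim_order_exists (prime_gt0 p_pr) cp.
  case/primeP: p_pr => _ H /H /orP[]/eqP m1; last by rewrite -m1.
  by move: c1 (prim_expr_order pm); rewrite m1 expr1 => /= /negPf c1 /eqP; rewrite c1.
exists c => //.
have [L [j [jK galL sm]]] := galois_model sepKs largeK [:: z; c].
have [zL jz] := sm z (mem_head _ _).
have [cL jc] : exists y, j y = c by apply: sm; rewrite !inE eqxx orbT.
have primcL : p.-primitive_root cL by rewrite -(fmorph_primitive_root j) jc.
have Knm := Kn_in_model jK jz.
have cm x : [set c]%classic x -> exists y, j y = x by move=> ->; exists cL.
pose A := gp_group j (adjoin Kn [set c]%classic).
have AP g : reflect (g \in gp j Kn /\ g cL = cL) (g \in A).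
  apply: (iffP idP) => [/(gp_adjoinP jK g Knm cm)[gB gc]|[gB gc]].
    by split=> //; apply: gc.
  apply/(gp_adjoinP jK g Knm cm); split=> // y /=.
  by rewrite -jc => /fmorph_inj->.
have actc (g : gal_of {:L}) : exists i, g cL = cL ^+ i.
  have gc1 : g cL ^+ p = 1 by rewrite -[LHS](rmorphXn g) /= (prim_expr_order primcL) rmorph1.
  by have [i ->] := prim_rootP primcL gc1; exists i.
have actX (g : gal_of {:L}) k i : g cL = cL ^+ i -> (g ^+ k)%g cL = cL ^+ (i ^ k).
  move=> Eg; elim: k => [|k IHk]; first by rewrite gal_id expn0 expr1.
  by rewrite expgSr galM ?memvf // IHk rmorphXn /= Eg -exprM expnS.
have cA : [~: gp j Kn, gp j Kn]%g \subset A.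
  rewrite gen_subG; apply/subsetP => _ /imset2P[a b aB bB ->].
  apply/AP; split; first by rewrite (groupR (G := gp_group j Kn)).
  have [i Ei] := actc a; have [k Ek] := actc b.
  have Eab : (a * b)%g cL = (b * a)%g cL.
    by rewrite !galM ?memvf // Ei Ek !rmorphXn /= Ei Ek -!exprM mulnC.
  have [m Em] := actc [~ a, b]%g; rewrite Em.
  have E : (b * a)%g (cL ^+ m) = (b * a)%g cL.
    have [l El] := actc (b * a)%g.
    rewrite -Eab (commgC a b) (galM (b * a)%g) ?memvf // El.
    have -> : [~ a, b]%g (cL ^+ l) = (cL ^+ m) ^+ l by rewrite rmorphXn /= Em.
    by rewrite rmorphXn /= El -!exprM mulnC.
  exact: fmorph_inj E.
rewrite -jc; apply: (kummer_maximal prim_z jK galL jz (A := A)).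
- by apply: sub_der1_normal cA _; apply/subsetP => g /AP[].
- exact: cA.
- move=> b bB; apply/AP; split; first by rewrite (groupX (G := gp_group j Kn)).
  have [i Ei] := actc b; rewrite (actX _ _ _ Ei).
  have cpi : coprime i p.
    rewrite coprime_sym prime_coprime //; apply/negP => /dvdnP[m Em].
    have : b cL = b 1 by rewrite Ei Em mulnC exprM (prim_expr_order primcL) expr1n rmorph1.
    move/fmorph_inj => c1'; have := prim_order_dvd primcL 1.
    by rewrite expr1 c1' eqxx dvdn1 => /eqP p1'; have := p_pr; rewrite p1'.
  (* The exponent [i] is prime to [p], so its power of exponent p - 1 is 1 modulo [p], and p - 1
     divides e. *)
  apply/eqP; rewrite -[X in _ == X]expr1 (eq_prim_root_expr primcL).
  rewrite -[n](prednK n_gt0) predn_exp expnM -modnXm.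
  have := Euler_exp_totient cpi; rewrite totient_prime // => ->.
  by rewrite modnXm exp1n.
by move=> a /AP[].
Qed.
End KummerTowerIndex.

(** * Primitive extensions and chief factors in a model *)

Section PrimitiveModel.
Variables (p n : nat) (K Ks : fieldType) (iota : {rmorphism K -> Ks}) (z : Ks).
Hypotheses (p_pr : prime p) (n_gt0 : (0 < n)%N) (hK : is_p_field p K)
  (prim_z : ((p ^ n).-1)%N.-primitive_root z).
Local Notation e := ((p ^ n).-1)%N.
Local Notation Kn := (K_ iota z).
Local Notation Ln := (L_ iota e z).
Variables (L : splittingFieldType K) (j : {rmorphism L -> Ks}).
Hypotheses (jK : forall a : K, j a%:A = iota a) (galL : galois 1 {:L}).
Local Notation G := ('Gal({:L} / 1))%G.
Variable zL : L.
Hypotheses (jz : j zL = z) (Lnm : in_model j Ln).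
Local Notation B := (gp_group j Kn).
Local Notation R := (gp_group j Ln).
Implicit Types E : subext iota.

Let nBG : (B <| G)%g. Proof. exact: (gp_Kn_normal prim_z jK jz). Qed.
Let nRG : (R <| G)%g. Proof. exact: (gp_Ln_normal prim_z jK galL jz Lnm). Qed.
Let sRB : R \subset B. Proof. exact: (gp_Ln_sub jK jz Lnm). Qed.
Let indexB : (#|G : B|%g <= n)%N.
Proof. exact: (index_Kn p_pr n_gt0 hK prim_z jK galL jz). Qed.
Let expB b : b \in B -> (b ^+ e)%g \in R.
Proof. exact: (gp_Ln_exp prim_z jK galL jz Lnm). Qed.

Lemma gal_solvable : solvable G.
Proof.
have [T [W [[nTG nWG sWT pW cTW] [cGT _]]]] := tame_structure hK galL.
have nWT : (W <| T)%g by apply: normalS sWT (normal_sub nTG) nWG.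
rewrite (series_sol nTG) (abelian_sol (cyclic_abelian cGT)) andbT.
by rewrite (series_sol nWT) (pgroup_sol pW) (abelian_sol (cyclic_abelian cTW)).
Qed.

Lemma primitive_chief E : in_model j E -> primitive_ext E -> ext_degree E (p ^ n) ->
  elementary_chief p n G R [group of gp j E :&: R] /\ (gp j E * R)%g = G.
Proof.
move=> Em primE /(ext_degree_index jK galL _ Em) degE.
have [T [W [[nTG nWG sWT pW cTW] [cGT tc]]]] := tame_structure hK galL.
have nWT : (W <| T)%g by apply: normalS sWT (normal_sub nTG) nWG.
have maxE := primitive_maximal jK galL Em primE.
apply: (maximal_kummer_chief p_pr n_gt0 nBG nRG sRB indexB expB gal_solvable maxE degE
  nTG nWG pW).
- exact: cyclic_quotient_gen nWT (subxx T) cTW.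
- exact: cyclic_quotient_gen nTG (normal_sub nBG) cGT.
- exact: (tame_commutator p_pr n_gt0 prim_z jK jz tc).
(* Maximality of L_n: the fixed field of [A] is abelian over K_n of exponent dividing e, so
   [kummer_maximal] puts it inside L_n. *)
move=> N nNG cN eN; pose A := [group of N :&: gp j Kn].
have AN a : a \in A -> a \in N by case/setIP.
have cB : [~: gp j Kn, gp j Kn]%g \subset gp j Kn := der_sub 1 B.
have kmax := @kummer_maximal _ _ _ _ _ _ prim_z L j jK galL zL jz A.
apply: subset_trans (_ : gp j (fix_subext jK A) \subset N); last first.
  by rewrite gp_fix subsetIl.
apply: gpS => x [y yA <-]; apply: kmax.
- rewrite /normal subsetIr normsI ?(normG B) // (subset_trans (normal_sub nBG)) //.
  exact: normal_norm.
- by rewrite subsetI cN.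
- by move=> b bB; rewrite in_setI eN // groupX.
- by move=> a aA; move/fixedFieldP: yA; apply=> //; apply: memvf.
Qed.

Lemma chief_primitive (S : {group gal_of {:L}}) : elementary_chief p n G R S ->
  exists E, [/\ in_model j E, primitive_ext E, ext_degree E (p ^ n) & gp j E :&: R = S].
Proof.
move=> chS.
have [[U [UR DUR]] _] := chief_complement p_pr n_gt0 nBG nRG sRB indexB expB chS.
have [maxU indU] := chief_complement_maximal p_pr n_gt0 nRG chS UR DUR.
have gU := gp_fix jK U.
exists (fix_subext jK U); have Um := @fix_subext_model _ _ _ _ _ jK U; split=> //.
- by apply: (maximal_primitive jK galL Um); rewrite gU.
- by apply/(ext_degree_index jK galL _ Um); rewrite gU.
- by rewrite gU.
Qed.

Lemma chief_primitive_iso E E' :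
    in_model j E -> primitive_ext E -> ext_degree E (p ^ n) ->
    in_model j E' -> primitive_ext E' -> ext_degree E' (p ^ n) ->
  gp j E :&: R = gp j E' :&: R -> K_isomorphic E E'.
Proof.
move=> Em pE dE Em' pE' dE' EE'.
have [chE DE] := primitive_chief Em pE dE; have [_ DE'] := primitive_chief Em' pE' dE'.
have [_ conj] := chief_complement p_pr n_gt0 nBG nRG sRB indexB expB chE.
have [g _ Eg] := conj (gp_group j E) (gp_group j E') erefl DE (esym EE') DE'.
exact: (conj_iso jK galL Em Em' Eg).
Qed.

Lemma iso_chief E E' : in_model j E -> in_model j E' -> K_isomorphic E E' ->
  primitive_ext E -> ext_degree E (p ^ n) -> gp j E' :&: R = gp j E :&: R.
Proof.
move=> Em Em' iso pE dE; have [[nS _ _ _ _] _] := primitive_chief Em pE dE.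
have [g gG ->] := iso_conj jK galL Em Em' iso.
have Rg : (R :^ g)%g = R := normsP (normal_norm nRG) g gG.
rewrite -{1}Rg -conjIg.
exact: (normsP (normal_norm nS) g gG).
Qed.
End PrimitiveModel.

(** * Kummer and Artin-Schreier duality *)

Section Cokernel.
Variables (A0 : zmodType) (f : {additive A0 -> A0}).

Lemma coker_class_is_zmod_morphism : zmod_morphism (coker_class f).
Proof. by move=> x y; rewrite /coker_class; exact: (raddfB (\pi_({ideal_quot (im_pred f)}))%qT). Qed.
HB.instance Definition _ :=
  GRing.isZmodMorphism.Build A0 (coker f) (coker_class f) coker_class_is_zmod_morphism.

Lemma coker_classP x y : coker_class f x = coker_class f y <-> exists w, f w = x - y.
Proof.
split=> [/eqP|[w Ew]]; first by rewrite -Quotient.idealrBE => /asboolP.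
by apply/eqP; rewrite -Quotient.idealrBE; apply/asboolP; exists w.
Qed.

Lemma coker_class_surj v : exists x, v = coker_class f x.
Proof. by exists (repr v); rewrite /coker_class reprK. Qed.
End Cokernel.

Section FpTorsion.
Variables (p : nat) (p_pr : prime p) (V : zmodType).
Implicit Types (v : V) (c d : 'F_p).

Lemma mulrn_modp v m : v *+ p = 0 -> v *+ (m %% p) = v *+ m.
Proof. by move=> vp; rewrite {2}(divn_eq m p) mulrnDr mulnC mulrnA vp mul0rn add0r. Qed.

Lemma mulrn_nat_Fp v m : v *+ p = 0 -> v *+ (m%:R : 'F_p) = v *+ m.
Proof. by move=> vp; rewrite val_Fp_nat // mulrn_modp. Qed.

Lemma mulrn_FpD v c d : v *+ p = 0 -> v *+ (c + d)%R = v *+ c + v *+ d.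
Proof.
by move=> vp; rewrite -mulrnDr -(mulrn_nat_Fp (c + d)%N vp) natrD !natr_Zp.
Qed.

Lemma mulrn_FpM v c d : v *+ p = 0 -> v *+ (c * d)%R = v *+ c *+ d.
Proof. by move=> vp; rewrite -mulrnA -(mulrn_nat_Fp (c * d)%N vp) natrM !natr_Zp. Qed.

Lemma mulrn_FpN v c : v *+ p = 0 -> v *+ (- c)%R = - (v *+ c).
Proof.
by move=> vp; apply/eqP; rewrite -addr_eq0 -mulrn_FpD // addNr.
Qed.

Lemma mulrn_Fp_inj v : v *+ p = 0 -> v != 0 -> injective (fun c : 'F_p => v *+ c).
Proof.
move=> vp v0 c d Ecd; apply/eqP; rewrite -subr_eq0; apply: contraNT v0 => u0.
have -> : v = v *+ ((c - d) / (c - d))%R by rewrite divff // mulr1n.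
by rewrite mulrn_FpM // mulrn_FpD // mulrn_FpN // Ecd subrr mul0rn.
Qed.

Lemma mulrn_Fp_sum v (I : finType) (c : I -> 'F_p) : v *+ p = 0 ->
  v *+ (\sum_i c i)%R = \sum_i v *+ c i.
Proof.
move=> vp; apply: (big_morph (fun c : 'F_p => v *+ c)) => // x y.
exact: mulrn_FpD.
Qed.
End FpTorsion.

Section Characters.
Variables (p : nat) (p_pr : prime p) (gT : finGroupType) (R : {group gT}) (n : nat).

Definition hom_on (V : zmodType) (phi : gT -> V) :=
  forall g h, g \in R -> h \in R -> phi (g * h)%g = phi g + phi h.

Lemma hom_on1 (V : zmodType) (phi : gT -> V) : hom_on phi -> phi 1%g = 0.
Proof.
move=> phiM; have := phiM 1%g 1%g (group1 _) (group1 _).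
by rewrite mulg1 -{1}[phi 1%g]addr0 => /addrI.
Qed.

Lemma hom_on_kernel (V : zmodType) (phi : gT -> V) g h : hom_on phi ->
  g \in R -> h \in R -> phi (g * h^-1)%g = phi g - phi h.
Proof.
move=> phiM gR hR; apply: (addIr (phi h)).
by rewrite -phiM ?groupM ?groupV // mulgKV addrNK.
Qed.

(** The rows of [M] are the values of [phi]. The hypothesis makes its columns independent, so the
    rows span, and sums of values are again values. *)
Lemma hom_on_surj (phi : gT -> 'rV['F_p]_n) : hom_on phi ->
    (forall c : 'I_n -> 'F_p, (forall g, g \in R -> \sum_i phi g 0 i * c i = 0) ->
       forall i, c i = 0) ->
  forall v, exists2 g, g \in R & phi g = v.
Proof.
move=> phiM inj_c v; pose M := \matrix_(k < #|R|) phi (enum_val k).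
have free_tr : row_free M^T.
  apply: inj_row_free => w wM; apply/rowP => i; rewrite mxE.
  apply: (inj_c (fun i => w 0 i)) => g gR.
  move/rowP/(_ (enum_rank_in gR g)): wM; rewrite !mxE => wM.
  rewrite -[RHS]wM; apply: eq_bigr => l _.
  by rewrite !mxE enum_rankK_in // mulrC.
have fullM : row_full M by rewrite /row_full -mxrank_tr.
have /submxP[w ->] := submx_full v fullM.
rewrite mulmx_sum_row.
have : forall k, w 0 k *: row k M = phi (enum_val k) *+ w 0 k.
  by move=> k; rewrite rowK -scaler_nat; congr (_ *: _); rewrite natr_Zp.
move=> Ek; rewrite (eq_bigr _ (fun k _ => Ek k)).
elim/big_rec: _ => [|k x _ [h hR Eh]]; first by exists 1%g; rewrite ?group1 ?hom_on1.
exists (enum_val k ^+ (w 0 k) * h)%g; first by rewrite groupM ?groupX // enum_valP.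
rewrite phiM ?groupX ?enum_valP // Eh; congr (_ + _).
elim: {Eh} (w 0 k : nat) => [|m IHm]; first by rewrite hom_on1.
by rewrite expgS phiM ?groupX ?enum_valP // IHm mulrS.
Qed.

Lemma hom_on_factor (phi : gT -> 'rV['F_p]_n) (psi : gT -> 'F_p) :
    hom_on phi -> hom_on psi -> (forall v, exists2 g, g \in R & phi g = v) ->
    (forall g, g \in R -> phi g = 0 -> psi g = 0) ->
  exists c : {ffun 'I_n -> 'F_p}, forall g, g \in R -> psi g = \sum_i phi g 0 i * c i.
Proof.
move=> phiM psiM surj ker.
have /choice[s sP] : forall v, exists g, g \in R /\ phi g = v.
  by move=> v; have [g] := surj v; exists g.
have ls g : g \in R -> psi (s (phi g)) = psi g.
  move=> gR; have [sR Es] := sP (phi g); apply/eqP; rewrite -subr_eq0.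
  by rewrite -hom_on_kernel // ker ?groupM ?groupV // hom_on_kernel // Es subrr.
have lD u v : psi (s (u + v)) = psi (s u) + psi (s v).
  have [[uR Eu] [vR Ev]] := (sP u, sP v).
  by rewrite -psiM // -(ls (_ * _)%g) ?groupM // phiM // Eu Ev.
have l0 : psi (s 0) = 0 by apply: (addrI (psi (s 0))); rewrite -lD !addr0.
have lMn u m : psi (s (u *+ m)) = psi (s u) *+ m.
  by elim: m => [|m IHm] //; rewrite !mulrS lD IHm.
exists [ffun i => psi (s (delta_mx 0 i))] => g gR.
rewrite -ls // {1}[phi g]row_sum_delta (big_morph (fun v => psi (s v)) lD l0).
apply: eq_bigr => i _; rewrite ffunE -{1}[phi g 0 i]natr_Zp scaler_nat lMn.
by rewrite -mulr_natl natr_Zp.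
Qed.

Lemma hom_on_quotient (phi : gT -> 'rV['F_p]_n) (S : {group gT}) :
    hom_on phi -> (forall v, exists2 g, g \in R & phi g = v) ->
    (forall g, g \in S <-> g \in R /\ phi g = 0) ->
  (p.-abelem (R / S))%g /\ #|(R / S)%g| = (p ^ n)%N.
Proof.
move=> phiM surj SP.
have mphi : {in R &, {morph phi : x y / (x * y)%g >-> (x * y)%g}} by move=> x y; apply: phiM.
pose f := Morphism mphi.
have kf : ('ker f)%g = S.
  apply/setP => g; apply/idP/idP => [/morphpreP[gR /set1P g0]|/SP[gR g0]].
    by apply/SP.
  by apply/morphpreP; split=> //; apply/set1P.
have imf : (f @* R)%g = [set: 'rV['F_p]_n].
  apply/setP => v; rewrite in_setT; have [g gR <-] := surj v.
  exact: (mem_morphim f).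
have iso : (R / S \isog [set: 'rV['F_p]_n])%g by rewrite -imf -kf; apply: first_isog.
have -> : p.-abelem%g (R / S)%g by rewrite (isog_abelem iso) mx_Fp_abelem.
by rewrite (card_isog iso) cardsT card_mx mul1n card_Fp.
Qed.

Lemma quotient_hom_on (S : {group gT}) :
    (S <| R)%g -> (p.-abelem (R / S))%g -> #|(R / S)%g| = (p ^ n)%N ->
  exists phi : gT -> 'rV['F_p]_n, [/\ hom_on phi, (forall v, exists2 g, g \in R & phi g = v)
    & forall g, g \in S <-> g \in R /\ phi g = 0].
Proof.
move=> nSR abE cE.
have /isogP[f injf imf] : (R / S \isog [set: 'rV['F_p]_n])%g.
  by rewrite (isog_abelem_card _ abE) mx_Fp_abelem // cardsT card_mx mul1n card_Fp // cE eqxx.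
have sRN := normal_norm nSR.
exists (fun g => f (coset S g)%g); split.
- move=> g h gR hR; rewrite morphM ?(subsetP sRN) //.
  by rewrite (morphM f) ?mem_quotient.
- move=> v; have : v \in (f @* (R / S))%g by rewrite imf in_setT.
  case/morphimP=> _ _ /morphimP[g gN gR ->] ->; by exists g.
move=> g; split=> [gS|[gR fg]].
  by split; [apply: (subsetP (normal_sub nSR)) | rewrite coset_id // (morph1 f)].
have /set1P : coset S g \in [1 (coset_of S)]%g.
  by apply: (subsetP injf); apply/morphpreP; split; [apply: mem_quotient | apply/set1P].
by apply: coset_idr; apply: (subsetP sRN).
Qed.
End Characters.

(** * Duality common to the Kummer and Artin-Schreier cases *)

Section AbstractKummer.
Variables (p : nat) (p_pr : prime p) (gT : finGroupType) (G R : {group gT}).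
Hypothesis nRG : (R <| G)%g.
Variables (A A0 : zmodType) (act : gT -> {additive A -> A}) (F : {additive A -> A}).
Variables (f : {additive A0 -> A0}) (i0 : {additive A0 -> A}) (c0 : A).
Hypotheses (act1 : forall a, act 1%g a = a)
  (actM : forall g h a, act (g * h)%g a = act h (act g a))
  (actF : forall g a, F (act g a) = act g (F a)).
Hypotheses (c0p : c0 *+ p = 0) (c0_neq0 : c0 != 0) (Fc0 : F c0 = 0)
  (kerF : forall a, F a = 0 -> exists k : 'F_p, a = c0 *+ k)
  (fixc0 : forall g, g \in R -> act g c0 = c0).
Hypothesis hilbert90 : forall psi : gT -> 'F_p, hom_on R psi ->
  exists a, forall g, g \in R -> act g a = a + c0 *+ psi g.
Hypotheses (i0_inj : injective i0) (i0F : forall x, i0 (f x) = F (i0 x))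
  (i0P : forall a, (forall g, g \in R -> act g a = a) <-> exists x, a = i0 x).
Variables (Gt : Type) (actV : Gt -> coker f -> coker f).
Hypotheses
  (actG : forall g, g \in G -> exists s, forall x y, i0 y = act g (i0 x) ->
     actV s (coker_class f x) = coker_class f y)
  (Gact : forall s, exists2 g, g \in G & forall x y, i0 y = act g (i0 x) ->
     actV s (coker_class f x) = coker_class f y).
Local Notation cl := (coker_class f).
Implicit Types (D : set (coker f)) (S M : {group gT}).

(** Classes of the elements with an [F]-preimage in the fixed field of [S]. *)
Definition D_of (S : {set gT}) : set (coker f) :=
  [set v | exists x a, [/\ v = cl x, F a = i0 x & forall g, g \in S -> act g a = a]]%classic.

(** The annihilator of [D] in [R]; when [D] has lifts it is the group of the field generated by the
    preimages, see [gp_cl_ext]. *)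
Definition S_of D : {set gT} :=
  [set g in R | `[< forall x a, D (cl x) -> F a = i0 x -> act g a = a >]].

(** A finite model need not contain preimages of all classes, so their existence is a condition on
    [D]; it holds once the extension defined by [D] lies in the model. *)
Definition has_lifts D := forall x, D (cl x) -> exists a, F a = i0 x.

Lemma S_ofP D g : g \in S_of D <->
  g \in R /\ forall x a, D (cl x) -> F a = i0 x -> act g a = a.
Proof.
rewrite inE; split=> [/andP[gR /asboolP H]//|[gR H]].
by rewrite gR; apply/asboolP.
Qed.

Lemma S_of_group_set D : group_set (S_of D).
Proof.
apply/group_setP; split; first by apply/S_ofP; split=> // *; rewrite act1.
move=> g h /S_ofP[gR gD] /S_ofP[hR hD]; apply/S_ofP; split=> [|x a Dx Fa].
  by rewrite groupM.
by rewrite actM (gD x) // (hD x).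
Qed.
Canonical S_of_group D := Group (S_of_group_set D).

Lemma S_of_sub D : S_of D \subset R.
Proof. by apply/subsetP => g /S_ofP[]. Qed.

Lemma S_of_anti D D' : (D `<=` D')%classic -> S_of D' \subset S_of D.
Proof.
move=> sD; apply/subsetP => g /S_ofP[gR gD]; apply/S_ofP; split=> // x a /sD.
exact: gD.
Qed.

Lemma D_of_anti (S M : {set gT}) : S \subset M -> (D_of M `<=` D_of S)%classic.
Proof.
move=> sSM v [x [a [-> Fa Ma]]]; exists x, a; split=> // g /(subsetP sSM); exact: Ma.
Qed.

Lemma i0_fixed x g : g \in R -> act g (i0 x) = i0 x.
Proof. by move: g; apply/i0P; exists x. Qed.

Lemma act_inv g a : act g (act g^-1%g a) = a.
Proof. by rewrite -actM mulVg act1. Qed.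

Lemma F_fixed a : F a = 0 -> forall g, g \in R -> act g a = a.
Proof. by case/kerF=> k -> g gR; rewrite raddfMn fixc0. Qed.

(** Nondegeneracy on the side of classes: a lift fixed by [R] comes from [A0] through [i0], and any
    two lifts differ by an element of the kernel of [F], fixed by [R]. *)
Lemma lift_fixed_class0 x a : F a = i0 x ->
  (forall g, g \in R -> act g a = a) <-> cl x = 0.
Proof.
move=> Fa; rewrite -[X in _ <-> _ = X](raddf0 cl); split.
  move/i0P=> [w Ew]; apply/coker_classP; exists w; apply: i0_inj.
  by rewrite i0F -Ew Fa subr0.
move/coker_classP=> [w]; rewrite subr0 => Ew g gR.
have : F (a - i0 w) = 0 by rewrite raddfB Fa -i0F Ew subrr.
by move/F_fixed/(_ g gR); rewrite raddfB i0_fixed // => /addIr.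
Qed.

Lemma lift_fixed_class x y a b : cl x = cl y -> F a = i0 x -> F b = i0 y ->
  forall g, g \in R -> act g a = a <-> act g b = b.
Proof.
move=> Exy Fa Fb g gR.
have Fab : F (a - b) = i0 (x - y) by rewrite !raddfB Fa Fb.
have /(lift_fixed_class0 Fab)/(_ g gR) : cl (x - y) = 0 by rewrite raddfB /= Exy subrr.
rewrite raddfB => Eab; split=> Ea.
  by move: Eab; rewrite Ea => /addrI/oppr_inj.
by move: Eab; rewrite Ea => /addIr.
Qed.

Lemma lift_class x y a : cl x = cl y -> F a = i0 x -> exists b, F b = i0 y.
Proof.
move=> /coker_classP[w Ew] Fa; exists (a - i0 w).
by rewrite raddfB -i0F Ew Fa raddfB subKr.
Qed.

Lemma lift_torsion x a : F a = i0 x -> cl x *+ p = 0.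
Proof.
move=> Fa; rewrite -(raddfMn cl).
have Fpa : F (a *+ p) = i0 (x *+ p) by rewrite !raddfMn Fa.
apply/(lift_fixed_class0 Fpa) => g gR; rewrite raddfMn.
have /kerF[k Ek] : F (act g a - a) = 0 by rewrite raddfB actF Fa i0_fixed // subrr.
by rewrite -[act g a](subrK a) Ek mulrnDl -mulrnA mulnC mulrnA c0p mul0rn add0r.
Qed.

Lemma D_of_R : D_of R = [set 0]%classic.
Proof.
apply/seteqP; split=> [v [x [a [-> Fa Ra]]]|_ ->] /=.
  exact/(lift_fixed_class0 Fa).
by exists 0, 0; rewrite !raddf0; split=> // g _; rewrite raddf0.
Qed.

Lemma S_of_0 : S_of [set 0]%classic = R.
Proof.
apply/eqP; rewrite eqEsubset S_of_sub; apply/subsetP => g gR; apply/S_ofP; split=> //.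
by move=> x a /= x0 Fa; apply: (lift_fixed_class0 Fa).2.
Qed.

Section Frame.
Variables (n : nat) (phi : gT -> 'rV['F_p]_n) (x : 'I_n -> A0) (a : 'I_n -> A).

(** Coordinates for the pairing: the [a i] lift the [x i], the row [phi g] lists the pairings of [g]
    with their classes, and surjectivity of [phi] expresses that these classes are independent. *)
Definition frame := [/\ hom_on R phi, (forall v, exists2 g, g \in R & phi g = v),
  (forall i, F (a i) = i0 (x i))
  & forall g i, g \in R -> act g (a i) = a i + c0 *+ phi g 0 i].
Hypothesis frm : frame.

Lemma frame_comb (c : 'I_n -> 'F_p) : F (\sum_i a i *+ c i) = i0 (\sum_i x i *+ c i).
Proof.
case: frm => _ _ Fa _; rewrite !raddf_sum; apply: eq_bigr => i _.
by rewrite !raddfMn Fa.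
Qed.

Lemma frame_comb_act (c : 'I_n -> 'F_p) g : g \in R ->
  act g (\sum_i a i *+ c i) = \sum_i a i *+ c i + c0 *+ (\sum_i phi g 0 i * c i)%R.
Proof.
case: frm => _ _ _ ag gR; rewrite raddf_sum mulrn_Fp_sum // -big_split.
by apply: eq_bigr => i _ /=; rewrite raddfMn ag // mulrnDl mulrn_FpM.
Qed.

Lemma frame_comb_class (c : 'I_n -> 'F_p) :
  cl (\sum_i x i *+ c i) = \sum_i Fp_scale (c i) (cl (x i)).
Proof. by rewrite raddf_sum; apply: eq_bigr => i _; rewrite raddfMn. Qed.

(** An element [g] with [phi g] the i-th unit row isolates the coefficient [c i]. *)
Lemma frame_free (c : 'I_n -> 'F_p) :
  \sum_i Fp_scale (c i) (cl (x i)) = 0 -> forall i, c i = 0.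
Proof.
rewrite -frame_comb_class => /(lift_fixed_class0 (frame_comb c)) fix_c i.
case: frm => _ surj _ _; have [g gR Eg] := surj (delta_mx 0 i).
have := fix_c g gR; rewrite frame_comb_act // -{2}[\sum_i _]addr0 => /addrI.
rewrite -(mulr0n c0) => /(mulrn_Fp_inj p_pr c0p c0_neq0 (x2 := 0)) <-.
rewrite (bigD1 i) //= Eg mxE !eqxx mul1r big1 ?addr0 // => k ki.
by rewrite mxE (negPf ki) andbF mul0r.
Qed.

Variable S : {group gT}.
Hypothesis SP : forall g, g \in S <-> g \in R /\ phi g = 0.

Lemma frame_fix i g : g \in S -> act g (a i) = a i.
Proof.
case: frm => _ _ _ ag /SP[gR g0].
by rewrite ag // g0 mxE mulr0n addr0.
Qed.

Lemma frame_basis i : D_of S (cl (x i)).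
Proof. by exists (x i), (a i); split=> // [|g /frame_fix->//]; case: frm. Qed.

(** Pairing with [v] is a character of [R] trivial on [S], hence a combination of the coordinates of
    [phi]. The corresponding combination of classes differs from [v] by a class pairing trivially
    with [R], which is 0. *)
Lemma frame_span v : D_of S v ->
  exists c : {ffun 'I_n -> 'F_p}, v = \sum_i Fp_scale (c i) (cl (x i)).
Proof.
case=> y [b [-> Fb Sb]]; case: (frm) => phiM surj Fa ag.
have /choice[psi psiP] : forall g, exists k : 'F_p, g \in R -> act g b = b + c0 *+ k.
  move=> g; case gR: (g \in R); last by exists 0.
  have /kerF[k Ek] : F (act g b - b) = 0 by rewrite raddfB actF Fb i0_fixed // subrr.
  by exists k => _; rewrite -Ek addrC subrK.
have psiM : hom_on R psi.
  move=> g h gR hR; apply: (mulrn_Fp_inj p_pr c0p c0_neq0); apply: (addrI b).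
  rewrite -psiP ?groupM // actM psiP // raddfD raddfMn fixc0 // psiP //.
  by rewrite mulrn_FpD // addrAC -addrA.
have kpsi g : g \in R -> phi g = 0 -> psi g = 0.
  move=> gR g0; have := Sb g ((SP g).2 (conj gR g0)).
  rewrite psiP // -{2}[b]addr0 => /addrI; rewrite -(mulr0n c0).
  exact: (mulrn_Fp_inj p_pr c0p c0_neq0 (x2 := 0)).
have [c Ec] := hom_on_factor phiM psiM surj kpsi; exists c.
rewrite -frame_comb_class; apply/eqP; rewrite -subr_eq0 -raddfB; apply/eqP.
have Fd : F (b - \sum_i a i *+ c i) = i0 (y - \sum_i x i *+ c i).
  by rewrite raddfB [RHS]raddfB frame_comb Fb.
apply/(lift_fixed_class0 Fd) => g gR.
rewrite raddfB psiP // frame_comb_act // Ec //.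
by rewrite opprD addrACA subrr addr0.
Qed.

Lemma frame_dim : has_dim (@Fp_scale p (coker f)) (D_of S) n.
Proof.
exists (fun i => cl (x i)); split=> [|v /frame_span[c Ec]]; first exact: frame_basis.
exists c; split=> // d Ed; apply/ffunP => i; apply/eqP; rewrite -subr_eq0.
apply/eqP; apply: (frame_free (c := fun i => c i - d i)).
have xp k : cl (x k) *+ p = 0 by case: frm => _ _ Fa _; apply: lift_torsion (Fa k).
rewrite (eq_bigr (fun i => Fp_scale (c i) (cl (x i)) - Fp_scale (d i) (cl (x i)))).
  by rewrite sumrB -Ec -Ed subrr.
by move=> k _; rewrite /Fp_scale mulrn_FpD // mulrn_FpN.
Qed.

Lemma frame_S_of : S_of (D_of S) = S.
Proof.
apply/setP => g; apply/idP/idP => [/S_ofP[gR gD]|gS].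
  apply/SP; split=> //; apply/rowP => i; rewrite mxE.
  case: (frm) => _ _ Fa ag; have := gD _ _ (frame_basis i) (Fa i).
  rewrite ag // -{2}[a i]addr0 => /addrI; rewrite -(mulr0n c0).
  exact: (mulrn_Fp_inj p_pr c0p c0_neq0 (x2 := 0)).
have [gR _] := (SP g).1 gS.
apply/S_ofP; split=> // y b [y' [b' [Ey Fb' Sb']]] Fb.
by apply/(lift_fixed_class Ey Fb Fb' gR)/Sb'.
Qed.
End Frame.

(** The coordinates of an isomorphism from R / S to the row space are characters of [R], and Hilbert
    90 realizes each of them by an element of [A]. *)
Lemma frame_of_group n S : (S <| R)%g -> (p.-abelem (R / S))%g -> #|(R / S)%g| = (p ^ n)%N ->
  exists phi x a, @frame n phi x a /\ forall g, g \in S <-> g \in R /\ phi g = 0.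
Proof.
move=> nSR abS cS; have [phi [phiM surj SP]] := quotient_hom_on p_pr nSR abS cS.
have /choice[a aP] : forall i, exists a, forall g, g \in R -> act g a = a + c0 *+ phi g 0 i.
  by move=> i; apply: hilbert90 => g h gR hR; rewrite phiM // mxE.
have /choice[x xP] : forall i, exists x, F (a i) = i0 x.
  by move=> i; apply/i0P => g gR; rewrite -actF aP // raddfD raddfMn Fc0 mul0rn addr0.
by exists phi, x, a; split=> //; split=> // i g; apply: aP.
Qed.

Lemma D_of_lifts S : has_lifts (D_of S).
Proof. by move=> x [y [a [Exy Fa _]]]; apply: lift_class (esym Exy) Fa. Qed.

Lemma sum_delta_scale (W : zmodType) n (v : 'I_n -> W) i :
  \sum_k Fp_scale ([ffun k => (k == i)%:R : 'F_p] k) (v k) = v i.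
Proof.
rewrite (bigD1 i) //= big1 => [|k ki]; first by rewrite ffunE eqxx addr0 /Fp_scale mulr1n.
by rewrite ffunE (negPf ki).
Qed.

(** Surjectivity of [phi] is dual to independence of the basis: a linear relation among its
    coordinates gives a lift fixed by [R], so the same relation holds among the basis classes. *)
Lemma frame_of_basis D n : submodule p actV D -> has_lifts D ->
    has_dim (@Fp_scale p (coker f)) D n ->
  exists phi x a, @frame n phi x a /\
    forall v, D v <-> exists c : {ffun 'I_n -> 'F_p}, v = \sum_i Fp_scale (c i) (cl (x i)).
Proof.
move=> [D0 DD DZ _] liftD [b [bD bP]].
have /choice[x xP] : forall i, exists x, b i = cl x by move=> i; apply: coker_class_surj.
have /choice[a aP] : forall i, exists w, F w = i0 (x i).
  by move=> i; apply: liftD; rewrite -xP.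
have /choice[phi phiP] : forall g, exists v : 'rV['F_p]_n, g \in R ->
    forall i, act g (a i) = a i + c0 *+ v 0 i.
  move=> g; case gR: (g \in R); last by exists 0.
  have /choice[k kP] : forall i, exists k : 'F_p, act g (a i) = a i + c0 *+ k.
    move=> i; have /kerF[k Ek] : F (act g (a i) - a i) = 0.
      by rewrite raddfB actF aP i0_fixed // subrr.
    by exists k; rewrite -Ek addrC subrK.
  by exists (\row_i k i) => _ i; rewrite mxE.
have phiM : hom_on R phi.
  move=> g h gR hR; apply/rowP => i; rewrite mxE.
  apply: (mulrn_Fp_inj p_pr c0p c0_neq0); apply: (addrI (a i)).
  rewrite -phiP ?groupM // actM phiP // raddfD raddfMn fixc0 // phiP //.
  by rewrite mulrn_FpD // addrAC -addrA.
have clsum (c : 'I_n -> 'F_p) : cl (\sum_i x i *+ c i) = \sum_i Fp_scale (c i) (cl (x i)).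
  by rewrite raddf_sum; apply: eq_bigr => i _; rewrite raddfMn.
have Fsum (c : 'I_n -> 'F_p) : F (\sum_i a i *+ c i) = i0 (\sum_i x i *+ c i).
  by rewrite !raddf_sum; apply: eq_bigr => i _; rewrite !raddfMn aP.
exists phi, x, a; split; last first.
  move=> v; split=> [/bP[c [Ec _]]|[c ->]].
    by exists c; rewrite Ec; apply: eq_bigr => i _; rewrite xP.
  by elim/big_rec: _ => // i w _ Dw; apply: DD => //; apply: DZ; rewrite -xP.
split=> //; last by move=> g i gR; apply: phiP.
apply: hom_on_surj => // c c0R i.
have cl0 : \sum_i Fp_scale (c i) (cl (x i)) = 0.
  rewrite -clsum; apply/(lift_fixed_class0 (Fsum c)) => g gR.
  rewrite raddf_sum; transitivity (\sum_i a i *+ c i + c0 *+ (\sum_i phi g 0 i * c i)%R).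
    rewrite mulrn_Fp_sum // -big_split; apply: eq_bigr => k _ /=.
    by rewrite raddfMn phiP // mulrnDl mulrn_FpM.
  by rewrite c0R // mulr0n addr0.
have [d [_ uniq_d]] := bP 0 D0.
have Ed (c' : 'I_n -> 'F_p) : 0 = \sum_i Fp_scale (c' i) (cl (x i)) -> d = [ffun i => c' i].
  move=> Ec'; apply: uniq_d; apply: (etrans Ec'); apply: eq_bigr => k _.
  by rewrite ffunE xP.
have := Ed (fun=> 0); rewrite big1 => [|k _]; last by rewrite /Fp_scale mulr0n.
by rewrite (Ed c) // => /(_ erefl)/ffunP/(_ i); rewrite !ffunE.
Qed.

Lemma S_of_basis D n : submodule p actV D -> has_lifts D ->
    has_dim (@Fp_scale p (coker f)) D n ->
  [/\ (p.-abelem (R / S_of D))%g, #|(R / S_of D)%g| = (p ^ n)%N & D_of (S_of D) = D].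
Proof.
move=> subD liftD dimD; have [phi [x [a [frm DP]]]] := frame_of_basis subD liftD dimD.
have SP g : g \in S_of D <-> g \in R /\ phi g = 0.
  case: (frm) => _ _ Fa ag; split=> [/S_ofP[gR gD]|[gR g0]].
    split=> //; apply/rowP => i; rewrite mxE.
    have := gD (x i) (a i) _ (Fa i); rewrite ag // -{2}[a i]addr0 => Ea.
    apply: (mulrn_Fp_inj p_pr c0p c0_neq0); apply: (addrI (a i)); rewrite mulr0n Ea //.
    by apply/DP; exists [ffun k => (k == i)%:R : 'F_p]; rewrite (sum_delta_scale (cl \o x)).
  apply/S_ofP; split=> // y b /DP[c]; rewrite -(frame_comb_class x) => Ey Fb.
  apply/(lift_fixed_class Ey Fb (frame_comb frm c) gR).
  rewrite (frame_comb_act frm) // (_ : \sum_i phi g 0 i * c i = 0) ?mulr0n ?addr0 //.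
  by rewrite big1 // => i _; rewrite g0 mxE mul0r.
have [phiM surj _ _] := frm.
have [abS cS] := hom_on_quotient p_pr (S := S_of_group D) phiM surj SP.
split=> //; apply/seteqP; split=> v.
  by move/(frame_span frm SP) => Dv; apply/DP.
move=> Dv; have [x' Ev] := coker_class_surj v; rewrite Ev in Dv *.
have [b Fb] := liftD _ Dv; exists x', b; split=> // g /S_ofP[gR gD].
exact: gD Dv Fb.
Qed.

Lemma D_of_submodule S : (S <| G)%g -> S \subset R -> submodule p actV (D_of S).
Proof.
move=> nSG sSR; split.
- by exists 0, 0; rewrite !raddf0; split=> // g _; rewrite raddf0.
- move=> _ _ [x [a [-> Fa Sa]]] [y [b [-> Fb Sb]]]; exists (x + y), (a + b).
  by rewrite !raddfD /= Fa Fb; split=> // g gS; rewrite raddfD /= Sa // Sb.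
- move=> c _ [x [a [-> Fa Sa]]]; exists (x *+ c), (a *+ c).
  by rewrite !raddfMn /= Fa; split=> // g gS; rewrite raddfMn /= Sa.
move=> s _ [x [a [-> Fa Sa]]]; have [g gG gs] := Gact s.
have nSg : (S :^ g^-1)%g = S by apply: (normsP (normal_norm nSG)); rewrite groupV.
have [y Ey] : exists y, act g (i0 x) = i0 y.
  apply/i0P => h hR; rewrite -actM conjgCV actM i0_fixed //.
  by rewrite memJ_norm ?groupV // (subsetP (normal_norm nRG)).
exists y, (act g a); split; first exact: gs.
  by rewrite actF Fa.
by move=> h hS; rewrite -actM conjgCV actM Sa // -nSg memJ_conjg.
Qed.

Lemma S_of_normal D : submodule p actV D -> (S_of D <| G)%g.
Proof.
move=> [_ _ _ stabD]; apply/fingroup.normalP; split.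
  exact: subset_trans (S_of_sub D) (normal_sub nRG).
move=> g gG; apply/eqP; rewrite eqEcard cardJg leqnn andbT.
apply/subsetP => _ /imsetP[h /S_ofP[hR hD] ->].
apply/S_ofP; split=> [|x a Dx Fa].
  by rewrite memJ_norm // (subsetP (normal_norm nRG)).
have gVG : (g^-1 \in G)%g by rewrite groupV.
have [s sP] := actG gVG.
have [y Ey] : exists y, act g^-1%g (i0 x) = i0 y.
  apply/i0P => k kR; rewrite -actM conjgCV invgK actM i0_fixed //.
  by rewrite memJ_norm // (subsetP (normal_norm nRG)).
have Dy : D (cl y) by rewrite -(sP x y) //; apply: stabD.
by rewrite conjgE !actM (hD y) ?act_inv // actF Fa.
Qed.

(** A normal [M] between [S_of D] and [R] yields the submodule [D_of M] of [D], which is 0 or [D];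
    [frame_S_of] recovers [M] from it. *)
Lemma simple_chief D n : simple_submodules p actV n D -> has_lifts D ->
  elementary_chief p n G R (S_of_group D) /\ D_of (S_of D) = D.
Proof.
move=> [[subD D0 simpleD] dimD] liftD.
have [abS cS DS] := S_of_basis subD liftD dimD.
have nSG := S_of_normal subD.
split=> //; split=> //; first exact: S_of_sub.
move=> M nMG sSM sMR.
have nSR : (S_of D <| R)%g by apply: normalS (S_of_sub D) (normal_sub nRG) nSG.
have nMR : (M <| R)%g by apply: normalS sMR (normal_sub nRG) nMG.
have iso := third_isog sSM nSR nMR.
have abM : (p.-abelem (R / M))%g by rewrite -(isog_abelem iso) quotient_abelem.
have [m cM] : exists m, #|(R / M)%g| = (p ^ m)%N.
  by exists (logn p #|(R / M)%g|); apply/card_pgroup/abelem_pgroup.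
have [phi [x [a [frm MP]]]] := frame_of_group nMR abM cM.
have EM := frame_S_of frm MP.
have sMD : (D_of M `<=` D)%classic by rewrite -[X in (_ `<=` X)%classic]DS; apply: D_of_anti.
have [M0|MD] := simpleD _ (D_of_submodule nMG sMR) sMD.
  by right; rewrite -[LHS]EM M0 S_of_0.
by left; rewrite -[LHS]EM MD.
Qed.

Lemma chief_simple S n : (0 < n)%N -> elementary_chief p n G R S ->
  simple_submodules p actV n (D_of S) /\ S_of (D_of S) = S.
Proof.
move=> n_gt0 [nSG sSR abS cS maxS].
have nSR : (S <| R)%g by apply: normalS sSR (normal_sub nRG) nSG.
have [phi [x [a [frm SP]]]] := frame_of_group nSR abS cS.
have ES := frame_S_of frm SP; split=> //; split; last by have H := frame_dim frm SP; exact: H.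
split; first exact: D_of_submodule.
  move=> D0; have S_R : S = R :> {set _} by rewrite -ES D0 S_of_0.
  have := cS; rewrite -S_R trivg_quotient cards1 => /esym/eqP.
  by rewrite -(expn0 p) eqn_exp2l ?prime_gt1 // => /eqP n0; rewrite n0 in n_gt0.
move=> D' subD' sD'.
have [D'0 D'D D'Z _] := subD'.
(* The map [ev] is an isomorphism from the row space onto [D_of S]. It turns the submodule [D'] into
   a vector space and so supplies the basis that [S_of_basis] requires. *)
pose ev (w : 'rV['F_p]_n) := \sum_i Fp_scale (w 0 i) (cl (x i)).
have xp k : cl (x k) *+ p = 0 by case: frm => _ _ Fa _; apply: lift_torsion (Fa k).
have evD c u v : ev (c *: u + v) = Fp_scale c (ev u) + ev v.
  rewrite /ev /Fp_scale -sumrMnl -big_split; apply: eq_bigr => k _ /=.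
  by rewrite !mxE mulrn_FpD // mulrC mulrn_FpM.
have ev0 : ev 0 = 0 by rewrite /ev big1 // => i _; rewrite mxE /Fp_scale mulr0n.
have ev_sum m (c : 'I_m -> 'F_p) (u : 'I_m -> 'rV_n) :
    ev (\sum_i c i *: u i) = \sum_i Fp_scale (c i) (ev (u i)).
  by elim/big_rec2: _ => // i y1 y2 _ <-; rewrite evD.
have ev_inj : injective ev.
  move=> u v Euv; apply/eqP; rewrite -subr_eq0; apply/eqP/rowP => i.
  have : ev (-1 *: v + u) = 0.
    by rewrite evD Euv /Fp_scale mulrn_FpN ?mulr1n ?addNr // /ev -sumrMnl big1 // => k _;
       rewrite /Fp_scale -mulrnA mulnC mulrnA xp mul0rn.
  move/(frame_free frm (c := fun i => (-1 *: v + u) 0 i))/(_ i).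
  by rewrite scaleN1r addrC => ->; rewrite mxE.
have [U UP] : exists U : {vspace 'rV['F_p]_n}, forall w, w \in U <-> D' (ev w).
  apply: vspace_of_pred; first by rewrite ev0.
  by move=> c u v Du Dv; rewrite evD; apply: D'D => //; apply: D'Z.
have dimD' : has_dim (@Fp_scale p (coker f)) D' (\dim U).
  exists (fun i => ev (vbasis U)`_i); split.
    by move=> i; apply/UP/vbasis_mem/mem_nth; rewrite size_tuple.
  move=> v D'v; have [c Ec] := frame_span frm SP (sD' _ D'v).
  have Ev : v = ev (\row_i c i) by rewrite Ec; apply: eq_bigr => i _; rewrite mxE.
  have wU : \row_i c i \in U by apply/UP; rewrite -Ev.
  exists [ffun i => coord (vbasis U) i (\row_i c i)]; split.
    rewrite Ev {1}(coord_vbasis wU) ev_sum; apply: eq_bigr => i _; by rewrite ffunE.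
  move=> d; rewrite -ev_sum Ev => /ev_inj Ed; apply/ffunP => i; rewrite ffunE Ed.
  by rewrite coord_sum_free // (basis_free (vbasisP U)).
have liftD' : has_lifts D' by move=> y /sD'; apply: D_of_lifts.
have [_ _ DS'] := S_of_basis subD' liftD' dimD'.
have sS : S \subset S_of D' by rewrite -ES; apply: S_of_anti.
have [E|E] := maxS (S_of_group D') (S_of_normal subD') sS (S_of_sub D').
  by right; rewrite -DS' /= E.
by left; rewrite -DS' /= E D_of_R.
Qed.

Lemma lifts_of_basis D n (b : 'I_n -> coker f) (x : 'I_n -> A0) (a : 'I_n -> A) :
    (forall v, D v -> exists c : {ffun 'I_n -> 'F_p}, v = \sum_i Fp_scale (c i) (b i)) ->
    (forall i, b i = cl (x i)) -> (forall i, F (a i) = i0 (x i)) -> has_lifts D.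
Proof.
move=> bP xP aP y /bP[c Ec].
apply: (lift_class (x := \sum_i x i *+ c i) (a := \sum_i a i *+ c i)).
  rewrite Ec raddf_sum; apply: eq_bigr => i _; by rewrite raddfMn xP.
by rewrite !raddf_sum; apply: eq_bigr => i _; rewrite !raddfMn aP.
Qed.

End AbstractKummer.

Section KummerDatum.
Variables (p : nat) (K Ks : fieldType) (iota : {rmorphism K -> Ks}) (E : subext iota).
Variables (A0 : zmodType) (f : {additive A0 -> A0}) (Q : Ks -> A0 -> Prop).
Variable actV : Defs.Gal E -> coker f -> coker f.

(* [kd_F] is the p-th power map or [x ^+ p - x] on the model [L], [kd_i0] the inclusion
   of [E], and [Q y x] says that [y] is a preimage of [x] under this map, in [Ks]. *)
Record kummer_datum (L : splittingFieldType K) (j : {rmorphism L -> Ks}) := KummerDatum {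
  kd_A : zmodType;
  kd_act : gal_of {:L} -> {additive kd_A -> kd_A};
  kd_F : {additive kd_A -> kd_A};
  kd_i0 : {additive A0 -> kd_A};
  kd_c0 : kd_A;
  kd_val : kd_A -> L;
  kd_act1 : forall a, kd_act 1%g a = a;
  kd_actM : forall g h a, kd_act (g * h)%g a = kd_act h (kd_act g a);
  kd_actF : forall g a, kd_F (kd_act g a) = kd_act g (kd_F a);
  kd_c0p : kd_c0 *+ p = 0;
  kd_c0_neq0 : kd_c0 != 0;
  kd_Fc0 : kd_F kd_c0 = 0;
  kd_kerF : forall a, kd_F a = 0 -> exists k : 'F_p, a = kd_c0 *+ k;
  kd_fixc0 : forall g, g \in gp j E -> kd_act g kd_c0 = kd_c0;
  kd_hilbert90 : forall psi : gal_of {:L} -> 'F_p, hom_on (gp_group j E) psi ->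
    exists a, forall g, g \in gp j E -> kd_act g a = a + kd_c0 *+ psi g;
  kd_i0_inj : injective kd_i0;
  kd_i0F : forall x, kd_i0 (f x) = kd_F (kd_i0 x);
  kd_i0P : forall a, (forall g, g \in gp j E -> kd_act g a = a) <-> exists x, a = kd_i0 x;
  kd_actG : forall g, g \in 'Gal({:L} / 1)%g -> exists s, forall x y,
    kd_i0 y = kd_act g (kd_i0 x) -> actV s (coker_class f x) = coker_class f y;
  kd_Gact : forall s, exists2 g, g \in 'Gal({:L} / 1)%g & forall x y,
    kd_i0 y = kd_act g (kd_i0 x) -> actV s (coker_class f x) = coker_class f y;
  kd_valJ : forall g a, kd_val (kd_act g a) = g (kd_val a);
  kd_val_inj : injective kd_val;
  kd_Q : forall x u, Q (j u) x <-> exists2 a, kd_val a = u & kd_F a = kd_i0 x;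
  kd_Qmodel : forall x a y, kd_F a = kd_i0 x -> Q y x -> exists u, j u = y
}.

Arguments kd_act {L j} _.
Arguments kd_F {L j} _.
Arguments kd_i0 {L j} _.
Arguments kd_c0 {L j} _.
Arguments kd_val {L j} _.
Arguments kd_act1 {L j} _.
Arguments kd_actM {L j} _.
Arguments kd_actF {L j} _.
Arguments kd_c0p {L j} _.
Arguments kd_c0_neq0 {L j} _.
Arguments kd_Fc0 {L j} _.
Arguments kd_kerF {L j} _.
Arguments kd_fixc0 {L j} _.
Arguments kd_hilbert90 {L j} _.
Arguments kd_i0_inj {L j} _.
Arguments kd_i0F {L j} _.
Arguments kd_i0P {L j} _.
Arguments kd_actG {L j} _.
Arguments kd_Gact {L j} _.
Arguments kd_valJ {L j} _.
Arguments kd_val_inj {L j} _.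
Arguments kd_Q {L j} _.
Arguments kd_Qmodel {L j} _.

(** Written so that [kummer_ext] and [as_ext] are instances by conversion. *)
Definition cl_ext (D : set (coker f)) : subext iota :=
  adjoin E [set y | exists x, D (coker_class f x) /\ Q y x]%classic.

Hypotheses (p_pr : prime p) (Q_ex : forall x, exists y, Q y x).
Variables (L : splittingFieldType K) (j : {rmorphism L -> Ks}).
Hypotheses (jK : forall a : K, j a%:A = iota a) (galL : galois 1 {:L}).
Hypotheses (Em : in_model j E) (nEG : (gp j E <| 'Gal({:L} / 1))%g).
Local Notation G := ('Gal({:L} / 1))%G.
Local Notation R := (gp_group j E).
Variable kd : kummer_datum j.
Local Notation S_of := (S_of_group R (kd_F kd) (f := f) (kd_i0 kd) (kd_act1 kd) (kd_actM kd)).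
Local Notation D_of := (D_of (kd_act kd) (kd_F kd) (f := f) (kd_i0 kd)).
Local Notation has_lifts := (has_lifts (kd_F kd) (f := f) (kd_i0 kd)).

Lemma in_model_lifts D : in_model j (cl_ext D) -> has_lifts D.
Proof.
move=> Dm x Dx; have [y Qy] := Q_ex x.
have [u Du] : exists u, j u = y.
  by apply: Dm => F' _; apply; exists x.
by rewrite -Du in Qy; have [a _ Fa] := (kd_Q kd x u).1 Qy; exists a.
Qed.

Lemma lifts_gens D : has_lifts D ->
  forall y, (exists x, D (coker_class f x) /\ Q y x) -> exists u, j u = y.
Proof. by move=> liftD y [x [/liftD[a Fa] Qy]]; have := kd_Qmodel kd _ _ _ Fa Qy. Qed.

Lemma lifts_in_model D : has_lifts D -> in_model j (cl_ext D).
Proof.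
by move=> liftD; apply: (adjoin_in_model jK Em) => y; apply: lifts_gens.
Qed.

Lemma gp_cl_ext D : has_lifts D -> gp j (cl_ext D) = S_of D.
Proof.
move=> liftD; apply/setP => g; apply/idP/idP.
  move/(gp_adjoinP jK g Em (lifts_gens liftD)) => [gR gD].
  apply/S_ofP; split=> // x a Dx Fa; apply: (kd_val_inj kd); rewrite kd_valJ.
  by apply: gD; exists x; split=> //; apply/(kd_Q kd); exists a.
move=> /S_ofP[gR gD]; apply/(gp_adjoinP jK g Em (lifts_gens liftD)); split=> // u [x [Dx]].
by case/(kd_Q kd) => a <- Fa; rewrite -kd_valJ (gD x).
Qed.

Lemma cl_ext_chief D n : simple_submodules p actV n D -> in_model j (cl_ext D) ->
  elementary_chief p n G R (gp_group j (cl_ext D)) /\ D_of (gp j (cl_ext D)) = D.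
Proof.
move=> simpleD /in_model_lifts liftD.
have ES := gp_cl_ext liftD.
have -> : gp_group j (cl_ext D) = S_of D by apply: val_inj.
rewrite ES.
by have := simple_chief p_pr nEG (kd_act1 kd) (kd_actM kd) (kd_actF kd) (kd_c0p kd)
  (kd_c0_neq0 kd) (kd_Fc0 kd) (kd_kerF kd) (kd_fixc0 kd) (kd_hilbert90 kd)
  (kd_i0_inj kd) (kd_i0F kd) (kd_i0P kd) (kd_actG kd) (kd_Gact kd) simpleD liftD.
Qed.

Lemma cl_ext_inj D D' n : simple_submodules p actV n D -> in_model j (cl_ext D) ->
  simple_submodules p actV n D' -> in_model j (cl_ext D') ->
  gp j (cl_ext D) = gp j (cl_ext D') -> D = D'.
Proof.
move=> sD Dm sD' Dm' EDD'.
by rewrite -(cl_ext_chief sD Dm).2 EDD' (cl_ext_chief sD' Dm').2.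
Qed.

Lemma chief_cl_ext (S : {group gal_of {:L}}) n : (0 < n)%N -> elementary_chief p n G R S ->
  exists D, [/\ simple_submodules p actV n D, in_model j (cl_ext D) & gp j (cl_ext D) = S].
Proof.
move=> n_gt0 chS.
have [sD ES] := chief_simple p_pr nEG (kd_act1 kd) (kd_actM kd) (kd_actF kd) (kd_c0p kd)
  (kd_c0_neq0 kd) (kd_Fc0 kd) (kd_kerF kd) (kd_fixc0 kd) (kd_hilbert90 kd)
  (kd_i0_inj kd) (kd_i0F kd) (kd_i0P kd) (kd_actG kd) (kd_Gact kd) n_gt0 chS.
have liftD : has_lifts (D_of S) by apply: D_of_lifts; apply: kd_i0F.
exists (D_of S); split=> //; first exact: lifts_in_model.
by rewrite gp_cl_ext.
Qed.

Lemma basis_in_model D n (b : 'I_n -> coker f) (x : 'I_n -> A0) (y : 'I_n -> Ks) :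
    (forall v, D v -> exists c : {ffun 'I_n -> 'F_p}, v = \sum_i Fp_scale (c i) (b i)) ->
    (forall i, b i = coker_class f (x i)) -> (forall i, Q (y i) (x i)) ->
    (forall i, exists u, j u = y i) -> in_model j (cl_ext D).
Proof.
move=> bP bx Qy ym; apply: lifts_in_model.
have /choice[a aP] : forall i, exists a, kd_F kd a = kd_i0 kd (x i).
  move=> i; have [u Du] := ym i; have := Qy i; rewrite -Du => /(kd_Q kd)[a _ Fa].
  by exists a.
exact: (lifts_of_basis (kd_i0F kd) bP bx aP).
Qed.
End KummerDatum.

(** * The correspondence *)

Lemma K_isomorphic_refl (K Ks : fieldType) (iota : {rmorphism K -> Ks}) (E : subext iota) :
  K_isomorphic E E.
Proof. by exists idfun; split=> //; exists idfun. Qed.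

Lemma K_isomorphic_trans (K Ks : fieldType) (iota : {rmorphism K -> Ks})
    (E F M : subext iota) : K_isomorphic E F -> K_isomorphic F M -> K_isomorphic E M.
Proof.
move=> [f [fbij fK]] [g [gbij gK]]; exists (g \o f); split; first exact: bij_comp.
by move=> a x /fK/gK.
Qed.

Section Correspondence.
Variables (p n : nat) (K Ks : fieldType) (iota : {rmorphism K -> Ks}) (z : Ks).
Hypotheses (p_pr : prime p) (n_gt0 : (0 < n)%N) (hK : is_p_field p K)
  (sepKs : is_separable_closure iota) (prim_z : ((p ^ n).-1)%N.-primitive_root z).
Local Notation e := ((p ^ n).-1)%N.
Local Notation Ln := (L_ iota e z).
Variables (A0 : zmodType) (f : {additive A0 -> A0}) (Q : Ks -> A0 -> Prop).
Variable actV : Defs.Gal Ln -> coker f -> coker f.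
Hypotheses (Q_ex : forall x, exists y, Q y x)
  (data : forall (L : splittingFieldType K) (j : {rmorphism L -> Ks}),
     (forall a : K, j a%:A = iota a) -> galois 1 {:L} -> in_model j Ln ->
     (gp j Ln <| 'Gal({:L} / 1))%g -> inhabited (kummer_datum p Q actV j)).
Implicit Types (E F : subext iota) (D : set (coker f)).
Local Notation simple := (simple_submodules p actV n).
Local Notation ext := (@cl_ext _ _ _ Ln _ f Q).

Lemma model_ex (s : seq Ks) : exists (L : splittingFieldType K) (j : {rmorphism L -> Ks})
    (kd : kummer_datum p Q actV j) (zL : L),
  [/\ forall a : K, j a%:A = iota a, galois 1 {:L}, j zL = z,
      in_model j Ln & (gp j Ln <| 'Gal({:L} / 1))%g] /\
  (forall x, x \in s -> exists y, j y = x).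
Proof.
have [s0 s0P] := Ln_finite p_pr n_gt0 hK prim_z sepKs.
have [L [j [jK galL js]]] := galois_model sepKs (valued_field_large iota hK) (s0 ++ s).
have [|[zL jz] Lm] := s0P L j jK galL.
  by move=> x xs0; apply: js; rewrite mem_cat xs0.
have nR := gp_Ln_normal prim_z jK galL jz Lm.
have [kd] := data jK galL Lm nR.
exists L, j, kd, zL; split; first by split.
by move=> x xs; apply: js; rewrite mem_cat xs orbT.
Qed.

Lemma gp_eq (L : splittingFieldType K) (j : {rmorphism L -> Ks}) E F :
  se_set E = se_set F -> gp j E = gp j F.
Proof. by move=> EF; apply/setP => g; apply/gpP/gpP => gE y; [rewrite -EF | rewrite EF]; apply: gE. Qed.

Lemma ext_gens D : has_dim (@Fp_scale p (coker f)) D n -> exists s : seq Ks,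
  forall (L : splittingFieldType K) (j : {rmorphism L -> Ks}),
    (forall a : K, j a%:A = iota a) -> in_model j Ln -> kummer_datum p Q actV j ->
    (forall x, x \in s -> exists y, j y = x) -> in_model j (ext D).
Proof.
move=> [b [_ bP]].
have /choice[x xP] : forall i, exists x, b i = coker_class f x.
  by move=> i; apply: coker_class_surj.
have /choice[y yP] : forall i, exists y, Q y (x i) by move=> i; apply: Q_ex.
exists [seq y i | i <- enum 'I_n] => L j jK Lm kd js.
apply: (basis_in_model jK Lm kd _ xP yP) => [v /bP[c [Ec _]]|i]; first by exists c.
by apply/js/map_f/mem_enum.
Qed.

(** One model contains all four fields. There isomorphic [E] and [E'] have groups with the same
    intersection with that of L_n, and this intersection determines [D]. *)
Lemma corr_D_uniq E E' D D' : K_isomorphic E E' ->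
    primitive_ext E -> ext_degree E (p ^ n) -> ext_degree E' (p ^ n) ->
    simple D -> simple D' ->
    adjoin Ln E = ext D :> set Ks -> adjoin Ln E' = ext D' :> set Ks -> D = D'.
Proof.
move=> iso pE dE dE' sD sD' ED ED'.
have [s1 s1P] := ext_degree_gens dE; have [s2 s2P] := ext_degree_gens dE'.
have [s3 s3P] := ext_gens sD.2; have [s4 s4P] := ext_gens sD'.2.
have [L [j [kd [zL [[jK galL jz Lm nR] js]]]]] := model_ex (s1 ++ s2 ++ s3 ++ s4).
have Em : in_model j E.
  by apply: s1P => // x xs; apply: js; rewrite mem_cat xs.
have Em' : in_model j E'.
  by apply: s2P => // x xs; apply: js; rewrite !mem_cat xs orbT.
have Dm : in_model j (ext D).
  by apply: s3P => // x xs; apply: js; rewrite !mem_cat xs !orbT.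
have Dm' : in_model j (ext D').
  by apply: s4P => // x xs; apply: js; rewrite !mem_cat xs !orbT.
apply: (cl_ext_inj p_pr Q_ex jK Lm nR kd sD Dm sD' Dm').
rewrite -(gp_eq j ED) -(gp_eq j ED') !(gp_adjoin jK) //.
rewrite setIC [RHS]setIC.
exact/esym/(iso_chief p_pr n_gt0 hK prim_z jK galL jz Lm Em Em' iso pE dE).
Qed.

Lemma corr_D_ex E : primitive_ext E -> ext_degree E (p ^ n) ->
  exists2 D, simple D & adjoin Ln E = ext D :> set Ks.
Proof.
move=> pE dE; have [s sP] := ext_degree_gens dE.
have [L [j [kd [zL [[jK galL jz Lm nR] js]]]]] := model_ex s.
have Em := sP L j jK js.
have [chE _] := primitive_chief p_pr n_gt0 hK prim_z jK galL jz Lm Em pE dE.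
have [D [sD Dm gD]] := chief_cl_ext p_pr jK Lm nR kd n_gt0 chE.
exists D => //; apply: (gp_inj jK galL) => //.
  by apply: adjoin_in_model => // x xE; apply: Em.
by rewrite (gp_adjoin jK) // gD setIC.
Qed.

Lemma corr_E_ex D : simple D ->
  exists E, [/\ primitive_ext E, ext_degree E (p ^ n) & adjoin Ln E = ext D :> set Ks].
Proof.
move=> sD; have [s sP] := ext_gens sD.2.
have [L [j [kd [zL [[jK galL jz Lm nR] js]]]]] := model_ex s.
have Dm := sP L j jK Lm kd js.
have [chD _] := cl_ext_chief p_pr Q_ex jK Lm nR kd sD Dm.
have [E [Em pE dE gE]] := chief_primitive p_pr n_gt0 hK prim_z jK galL jz Lm chD.
exists E; split=> //; apply: (gp_inj jK galL) => //.
  by apply: adjoin_in_model => // x xE; apply: Em.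
by rewrite (gp_adjoin jK) // setIC.
Qed.

Lemma corr_iso E E' D : primitive_ext E -> ext_degree E (p ^ n) ->
    primitive_ext E' -> ext_degree E' (p ^ n) ->
    adjoin Ln E = ext D :> set Ks -> adjoin Ln E' = ext D :> set Ks -> K_isomorphic E E'.
Proof.
move=> pE dE pE' dE' ED ED'.
have [s1 s1P] := ext_degree_gens dE; have [s2 s2P] := ext_degree_gens dE'.
have [L [j [kd [zL [[jK galL jz Lm nR] js]]]]] := model_ex (s1 ++ s2).
have Em : in_model j E.
  by apply: s1P => // x xs; apply: js; rewrite mem_cat xs.
have Em' : in_model j E'.
  by apply: s2P => // x xs; apply: js; rewrite !mem_cat xs orbT.
apply: (chief_primitive_iso p_pr n_gt0 hK prim_z jK galL jz Lm) => //.
have := gp_eq j (etrans ED (esym ED')).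
by rewrite !(gp_adjoin jK) // setIC => ->; rewrite setIC.
Qed.

(** The union of all modules matched with members of the class. By [corr_D_ex] and [corr_D_uniq]
    there is exactly one when the class is that of a primitive extension of degree p^n, so no
    representative has to be chosen. *)
Definition corr_map (c : set (subext iota)) : set (coker f) :=
  [set v | exists E D, [/\ c E, primitive_ext E & ext_degree E (p ^ n)] /\
     [/\ simple D, adjoin Ln E = ext D :> set Ks & D v]]%classic.

Lemma corr_mapE E D : primitive_ext E -> ext_degree E (p ^ n) -> simple D ->
  adjoin Ln E = ext D :> set Ks -> corr_map (iso_class E) = D.
Proof.
move=> pE dE sD ED; apply/seteqP; split=> v.
  move=> [E' [D' [[iso pE' dE'] [sD' ED' D'v]]]].
  by rewrite (corr_D_uniq iso pE dE dE' sD sD' ED ED').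
by move=> Dv; exists E, D; do 2?[split=> //]; apply: K_isomorphic_refl.
Qed.

Theorem correspondence_of_data : primitive_correspondence p n actV ext.
Proof.
exists corr_map; split; last first.
  move=> E D pE dE sD; split=> [ED|]; last exact: corr_mapE.
  have [D1 sD1 ED1] := corr_D_ex pE dE.
  by rewrite -ED (corr_mapE pE dE sD1 ED1).
split.
- move=> _ [E [pE dE] <-]; have [D sD ED] := corr_D_ex pE dE.
  by rewrite (corr_mapE pE dE sD ED).
- move=> _ _ /set_mem[E [pE dE] <-] /set_mem[E' [pE' dE'] <-].
  have [D sD ED] := corr_D_ex pE dE; have [D' sD' ED'] := corr_D_ex pE' dE'.
  rewrite (corr_mapE pE dE sD ED) (corr_mapE pE' dE' sD' ED') => DD'.
  rewrite -DD' in ED'.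
  have iso := corr_iso pE dE pE' dE' ED ED'; have iso' := corr_iso pE' dE' pE dE ED' ED.
  by apply/seteqP; split=> F; apply: K_isomorphic_trans.
move=> D sD; have [E [pE dE ED]] := corr_E_ex sD.
by exists (iso_class E); [exists E | apply: corr_mapE].
Qed.
End Correspondence.

(** * Concrete data for the two cases of the duality *)

Section ModelEmbedding.
Variables (K Ks : fieldType) (iota : {rmorphism K -> Ks}).
Variables (L : splittingFieldType K) (j : {rmorphism L -> Ks}).
Hypotheses (jK : forall a : K, j a%:A = iota a) (galL : galois 1 {:L}).
Variable E : subext iota.
Hypotheses (Em : in_model j E) (nEG : (gp j E <| 'Gal({:L} / 1))%g).
Implicit Types g : gal_of {:L}.

Lemma model_embedding : exists k : {rmorphism field_of E -> L}, forall x, j (k x) = se_val x.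
Proof.
have /choice[k kP] : forall x : field_of E, exists y, j y = se_val x.
  by move=> x; apply: Em; apply: field_of_mem.
have kB : zmod_morphism k.
  by move=> x y; apply: (fmorph_inj j); rewrite rmorphB !kP.
have kM : monoid_morphism k.
  by split=> [|x y]; apply: (fmorph_inj j); rewrite ?rmorph1 ?rmorphM !kP.
pose kR : {rmorphism field_of E -> L} :=
  HB.pack k (GRing.isZmodMorphism.Build _ _ k kB) (GRing.isMonoidMorphism.Build _ _ k kM).
by exists kR.
Qed.

Variable k : {rmorphism field_of E -> L}.
Hypothesis jk : forall x, j (k x) = se_val x.

Lemma embedding_fixedP y : (forall g, g \in gp j E -> g y = y) <-> exists x, y = k x.
Proof.
split=> [/(model_fixedP jK galL)/asboolP yE|[x ->]].
  by exists (SubExtType yE); apply: (fmorph_inj j); rewrite jk.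
by apply/(model_fixedP jK galL); rewrite jk; apply: field_of_mem.
Qed.

Lemma gal_restriction g : g \in 'Gal({:L} / 1)%g ->
  exists s : Defs.Gal E, forall x, k (s x) = g (k x).
Proof.
move=> gG.
have Eg : gp j E = (gp j E :^ g)%g by rewrite (normsP (normal_norm nEG)).
have [s [sbij sK sP]] := restrict_gal jK galL Em Em Eg.
exists (GalAut sbij sK) => x /=; apply: (fmorph_inj j).
by rewrite jk -(sP _ (k x)).
Qed.

Lemma gal_extension (s : Defs.Gal E) :
  exists2 g, g \in 'Gal({:L} / 1)%g & forall x, k (s x) = g (k x).
Proof.
have [g gG gs] := extend_iso jK galL Em (@gal_fix _ _ _ _ s).
exists g => // x; apply: (fmorph_inj j); rewrite jk.
have kx : j (k x) \in se_pred E by rewrite jk (valP x).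
by rewrite -(gs _ kx); congr (se_val (s _)); apply: val_inj; rewrite /= jk.
Qed.
End ModelEmbedding.

Section Hilbert90.
Variables (p : nat) (p_pr : prime p) (K : fieldType) (L : splittingFieldType K).
Variables (R : {group gal_of {:L}}) (psi : gal_of {:L} -> 'F_p).
Hypothesis psiM : hom_on R psi.
Implicit Types g : gal_of {:L}.

(** The element [b] is the sum over [R] of the h(a) weighted by the inverses of the character; by
    independence of automorphisms some [a] makes it nonzero. *)
Lemma hilbert90_mul (c : L) : c ^+ p = 1 -> (forall g, g \in R -> g c = c) ->
  exists2 b : L, b != 0 & forall g, g \in R -> g b = b * c ^+ psi g.
Proof.
move=> cp fixc; pose chi g := c ^+ psi g.
have c0 : c != 0.
  by apply: contra_eq_neq cp => ->; rewrite expr0n eqn0Ngt prime_gt0 //= eq_sym oner_eq0.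
have chi0 g : chi g != 0 by rewrite expf_neq0.
have chiM g h : g \in R -> h \in R -> chi (g * h)%g = chi g * chi h.
  move=> gR hR; rewrite /chi psiM // -exprD.
  rewrite -[in RHS](natr_Zp (psi g)) -[in RHS](natr_Zp (psi h)).
  rewrite -[psi g in LHS]natr_Zp -[psi h in LHS]natr_Zp -natrD val_Fp_nat //.
  by rewrite !natr_Zp expr_mod.
have nz : (chi 1%g)^-1 != 0 by rewrite invr_eq0.
have [a _] := gal_independent_contra (P := [in R]) (c_ := fun g => (chi g)^-1) (group1 R) nz.
set b := \sum_(_ in _) _ => b0; exists b => // g gR.
rewrite rmorph_sum /b [in RHS](reindex_inj (mulIg g)) /= mulr_suml.
apply: eq_big => [h|h hR]; first by rewrite groupMr.
rewrite rmorphM fmorphV /= -galM ?memvf // chiM // -/(chi g) rmorphXn /= fixc //.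
by rewrite -/(chi h) invfM -!mulrA; congr (_ * _); rewrite mulrCA mulVf ?mulr1.
Qed.

(** Choose [a] with nonzero trace [t] over [R]. The conjugates of a / t sum to 1, and weighting them
    by minus the character gives [b]. *)
Lemma hilbert90_add : p \in [pchar L] ->
  exists b : L, forall g, g \in R -> g b = b + (psi g)%:R.
Proof.
move=> charL.
have psiR g h : g \in R -> h \in R -> (psi (g * h)%g)%:R = (psi g)%:R + (psi h)%:R :> L.
  move=> gR hR; rewrite psiM //.
  have := @mulrn_FpD p p_pr L 1 (psi g) (psi h); apply; exact: pcharf0.
have [a _] := gal_independent_contra (P := [in R]) (c_ := fun=> 1) (group1 R) (oner_neq0 L).
set t := \sum_(_ in _) _ => t0.
have fixt g : g \in R -> g t = t.
  move=> gR; rewrite rmorph_sum [RHS](reindex_inj (mulIg g)) /=.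
  by apply: eq_big => [h|h hR]; rewrite ?groupMr // !mul1r galM ?memvf.
have Et : \sum_(h in R) h (a / t) = 1.
  rewrite -(divff t0) {2}/t mulr_suml; apply: eq_bigr => h hR.
  by rewrite mul1r rmorphM fmorphV /= fixt.
exists (- \sum_(h in R) (psi h)%:R * h (a / t)) => g gR.
have Eg : (psi g)%:R = \sum_(h in R) (psi g)%:R * g (h (a / t)).
  by rewrite -mulr_sumr -rmorph_sum /= Et rmorph1 mulr1.
have Es : \sum_(h in R) (psi h)%:R * h (a / t) =
    \sum_(h in R) ((psi h)%:R * g (h (a / t)) + (psi g)%:R * g (h (a / t))).
  rewrite (reindex_inj (mulIg g)) /=; apply: eq_big => [h|h]; rewrite groupMr // => hR.
  by rewrite psiR // galM ?memvf // mulrDl.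
rewrite [in RHS]Es big_split /= -Eg opprD subrK rmorphN rmorph_sum /=.
by congr (- _); apply: eq_bigr => h hR; rewrite rmorphM rmorph_nat.
Qed.
End Hilbert90.

Section Roots.
Variables (p : nat) (p_pr : prime p).

Lemma pchar_Artin_Schreier_roots (F : fieldType) (x : F) : p \in [pchar F] -> x ^+ p = x ->
  exists k : 'F_p, x = k%:R.
Proof.
move=> charF /(pchar_frob_fixed charF)[m ->].
by exists (m%:R : 'F_p); apply/esym/(mulrn_nat_Fp p_pr); apply: pcharf0.
Qed.

Variables (K Ks : fieldType) (iota : {rmorphism K -> Ks}).
Hypothesis sepKs : is_separable_closure iota.

Lemma sep_closed_pth_root (v : Ks) : (p%:R : Ks) != 0 -> v != 0 -> exists y, y ^+ p = v.
Proof.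
move=> p0 v0; pose q : {poly Ks} := 'X^p - v%:P.
have sq : size q = p.+1 by rewrite size_XnsubC ?prime_gt0.
have [||y] := sepKs.2 q; last 1 first.
- by rewrite rootE !hornerE subr_eq0 => /eqP <-; exists y.
- rewrite separable_poly.unlock derivB derivC subr0 derivXn -scaler_nat coprimepZr //.
  rewrite coprimep_expr // coprimepX rootE !hornerE expr0n.
  by rewrite eqn0Ngt prime_gt0 // add0r oppr_eq0.
by rewrite sq ltnS prime_gt0.
Qed.

Lemma sep_closed_Artin_Schreier_root (v : Ks) : p \in [pchar Ks] -> exists y, y ^+ p - y = v.
Proof.
move=> charK; pose q : {poly Ks} := 'X^p - ('X + v%:P).
have p1 := prime_gt1 p_pr.
have sq : size q = p.+1.
  rewrite size_polyDl ?size_polyXn // size_polyN size_XaddC ltnS //.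
have [||y] := sepKs.2 q; last 1 first.
- by rewrite rootE !hornerE opprD addrA subr_eq0 => /eqP <-; exists y.
- rewrite separable_poly.unlock derivB derivD derivX derivC addr0 derivXn.
  rewrite -mulr_natl -polyC_natr pcharf0 // polyC0 mul0r sub0r.
  by rewrite -[X in coprimep _ X]scaleN1r coprimepZr ?oppr_eq0 ?oner_eq0 // coprimep1.
by rewrite sq ltnS prime_gt0.
Qed.
End Roots.

Section Data.
Variables (p : nat) (p_pr : prime p) (K Ks : fieldType) (iota : {rmorphism K -> Ks}).
Variable E : subext iota.
Variables (L : splittingFieldType K) (j : {rmorphism L -> Ks}).
Hypotheses (jK : forall a : K, j a%:A = iota a) (galL : galois 1 {:L}).
Hypotheses (Em : in_model j E) (nEG : (gp j E <| 'Gal({:L} / 1))%g).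

Section ArtinSchreier.
Variable charK : p \in [pchar K].

Lemma pchar_model : p \in [pchar L].
Proof. by rewrite -(fmorph_pchar j) (fmorph_pchar iota). Qed.

Lemma as_datum : inhabited (kummer_datum p
  (fun (y : Ks) (x : field_of E) => y ^+ p - y = se_val x) (@as_act K Ks iota p charK E) j).
Proof.
have charL := pchar_model.
have [k jk] := model_embedding Em.
pose F (x : L) := x ^+ p - x.
have FB : zmod_morphism F.
  move=> x y; rewrite /F -!(pFrobenius_autE charL) rmorphB /=.
  by rewrite opprD addrACA -opprD.
pose FA : {additive L -> L} := HB.pack F (GRing.isZmodMorphism.Build L L F FB).
have k_inj : injective k by apply: fmorph_inj.
apply: inhabits.
refine (@KummerDatum p K Ks iota E _ _ _ _ L j L (fun g : gal_of {:L} => g) FA k 1 id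
  _ _ _ _ _ _ _ _ _ _ _ _ _ _ _ _ _ _).
- by move=> a /=; rewrite gal_id.
- by move=> g h a /=; rewrite galM ?memvf.
- by move=> g a; rewrite /= /F rmorphB rmorphXn.
- exact: pcharf0.
- exact: oner_neq0.
- by rewrite /= /F expr1n subrr.
- by move=> a /eqP; rewrite subr_eq0 => /eqP; apply: pchar_Artin_Schreier_roots.
- by move=> g _ /=; rewrite rmorph1.
- by move=> psi psiM; have [b bP] := hilbert90_add p_pr psiM charL; exists b.
- exact: fmorph_inj.
- by move=> x; rewrite /= /F /wp rmorphB rmorphXn.
- exact: (embedding_fixedP jK galL jk).
- move=> g gG; have [s sP] := gal_restriction jK galL Em nEG jk gG.
  exists s => x y /=; rewrite -sP => /fmorph_inj ->; exact: as_actE.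
- move=> s; have [g gG gP] := gal_extension jK galL Em jk s.
  exists g => // x y /=; rewrite -gP => /fmorph_inj ->; exact: as_actE.
- by [].
- by move=> x y.
- move=> x u /=; split=> [|[a <- Fa]].
    by rewrite -jk -rmorphXn -rmorphB => /fmorph_inj Fu; exists u.
  by rewrite -jk -rmorphXn -rmorphB -[_ - _]/(F a) Fa.
(* Two preimages differ by an element of the prime field, so the model contains all of them as soon
   as it contains one. *)
move=> x a y Fa Qy.
have charKs : p \in [pchar Ks] by rewrite (fmorph_pchar iota).
have : (y - j a) ^+ p = y - j a.
  rewrite -(pFrobenius_autE charKs) rmorphB /= !pFrobenius_autE -rmorphXn.
  have -> : a ^+ p = k x + a by rewrite -Fa subrK.
  by rewrite rmorphD jk -Qy opprD addrA subKr.
case/(pchar_Artin_Schreier_roots p_pr charKs) => i Ei.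
by exists (i%:R + a); rewrite rmorphD rmorph_nat -Ei subrK.
Qed.
End ArtinSchreier.

Section Kummer.
Variable c : Ks.
Hypotheses (prim_c : p.-primitive_root c) (cE : se_set E c).

Lemma mg_map_is_zmod_morphism (F F' : fieldType) (s : {rmorphism F -> F'}) :
  zmod_morphism (mg_map s).
Proof. by move=> x y; apply: val_inj; rewrite /= rmorphM fmorphV. Qed.
HB.instance Definition _ (F F' : fieldType) (s : {rmorphism F -> F'}) :=
  GRing.isZmodMorphism.Build (mul_group F) (mul_group F') (mg_map s)
    (mg_map_is_zmod_morphism s).

Lemma kummer_datum_ex : inhabited (kummer_datum p
  (fun (y : Ks) (x : mul_group (field_of E)) => y ^+ p = se_val (mg_val x))
  (@kummer_act K Ks iota p E) j).
Proof.
have [k jk] := model_embedding Em.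
pose F (x : mul_group L) := x *+ p.
have FB : zmod_morphism F by move=> x y; rewrite /F mulrnBl.
pose FA : {additive mul_group L -> mul_group L} :=
  HB.pack F (GRing.isZmodMorphism.Build (mul_group L) (mul_group L) F FB).
have [cL jc] := Em cE.
have prim_cL : p.-primitive_root cL by rewrite -(fmorph_primitive_root j) jc.
have cL0 : cL != 0.
  apply/eqP => c0; have := prim_expr_order prim_cL.
  by rewrite c0 expr0n eqn0Ngt prime_gt0 // => /esym/eqP; rewrite oner_eq0.
pose c0 := MulGroup cL0.
apply: inhabits.
refine (@KummerDatum p K Ks iota E _ _ _ _ L j (mul_group L)
  (fun g : gal_of {:L} => mg_map g) FA (mg_map k) c0 (@mg_val L)
  _ _ _ _ _ _ _ _ _ _ _ _ _ _ _ _ _ _).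
- by move=> a; apply: val_inj; rewrite /= gal_id.
- by move=> g h a; apply: val_inj; rewrite /= galM ?memvf.
- by move=> g a; rewrite /= /F raddfMn.
- by apply: val_inj; rewrite /= mg_valMn prim_expr_order.
- apply/eqP => /(congr1 (@mg_val L)) /= c1.
  by have := prim_cL; rewrite c1 => /prim_order_dvd/(_ 1%N); rewrite expr1n eqxx dvdn1;
     apply/negP; rewrite neq_ltn prime_gt1 ?orbT.
- by apply: val_inj; rewrite /= mg_valMn prim_expr_order.
- move=> a /(congr1 (@mg_val L)); rewrite /= mg_valMn => /(prim_rootP prim_cL)[i Ei].
  exists (i%:R : 'F_p); apply: val_inj.
  by rewrite /= mg_valMn val_Fp_nat // modn_small.
- move=> g /gpP gE; apply: val_inj => /=; apply: gE; by rewrite jc.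
- move=> psi psiM.
  have [|g gE|b b0 bP] := hilbert90_mul p_pr psiM (c := cL).
  + exact: prim_expr_order.
  + by move/gpP: gE; apply; rewrite jc.
  exists (MulGroup b0) => g gE; apply: val_inj.
  by rewrite /= bP // mg_valMn.
- by move=> x y /(congr1 (@mg_val L)) /fmorph_inj; apply: val_inj.
- by move=> x; rewrite /= /F /mg_pow raddfMn.
- move=> a; split=> [fa|[x ->] g gE].
    have [|x Ex] := (embedding_fixedP jK galL jk (mg_val a)).1.
      by move=> g gE; have := congr1 (@mg_val L) (fa g gE).
    have x0 : x != 0 by rewrite -(fmorph_eq0 k) -Ex mg_neq0.
    by exists (MulGroup x0); apply: val_inj.
  apply: val_inj => /=; apply: (embedding_fixedP jK galL jk _).2 gE.
  by exists (mg_val x).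
- move=> g gG; have [s sP] := gal_restriction jK galL Em nEG jk gG.
  exists s => x y /(congr1 (@mg_val L)) /=; rewrite -sP => /fmorph_inj Ey.
  by rewrite kummer_actE; congr coker_class; apply: val_inj.
- move=> s; have [g gG gP] := gal_extension jK galL Em jk s.
  exists g => // x y /(congr1 (@mg_val L)) /=; rewrite -gP => /fmorph_inj Ey.
  by rewrite kummer_actE; congr coker_class; apply: val_inj.
- by [].
- exact: val_inj.
- move=> x u; split=> [|[a <- /(congr1 (@mg_val L))]].
    rewrite -jk -rmorphXn => /fmorph_inj Fu.
    have u0 : u != 0.
      apply: contraTneq (mg_neq0 x) => u0; rewrite negbK -(fmorph_eq0 k) -Fu u0.
      by rewrite expr0n eqn0Ngt prime_gt0.
    by exists (MulGroup u0) => //; apply: val_inj; rewrite /= mg_valMn.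
  by rewrite /= mg_valMn => Fa; rewrite -jk -Fa rmorphXn.
move=> x a y /(congr1 (@mg_val L)); rewrite /= mg_valMn => Fa Qy.
have ja0 : j (mg_val a) != 0 by rewrite fmorph_eq0 mg_neq0.
have : (y / j (mg_val a)) ^+ p = 1.
  by rewrite expr_div_n Qy -jk -Fa rmorphXn divff // expf_neq0.
case/(prim_rootP prim_c) => i Ei.
by exists (cL ^+ i * mg_val a); rewrite rmorphM rmorphXn /= jc -Ei divfK.
Qed.
End Kummer.
End Data.

Local Open Scope classical_set_scope.
Local Open Scope ring_scope.

Theorem mainTheorem1 (p : nat) (hp : prime p) (K : fieldType)
    (hK : is_p_field p K) (Ks : fieldType) (iota : {rmorphism K -> Ks})
    (hKs : is_separable_closure iota) (n : nat) (hn : (0 < n)%N)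
    (z : Ks) (hz : (p ^ n - 1)%N.-primitive_root z) :
  let Ln := L_ iota (p ^ n - 1) z in
  ([pchar K] =i pred0 ->
     primitive_correspondence p n (@kummer_act K Ks iota p Ln)
       (@kummer_ext K Ks iota p Ln)) /\
  (forall charK : p \in [pchar K],
     primitive_correspondence p n (@as_act K Ks iota p charK Ln)
       (@as_ext K Ks iota p charK Ln)).
Proof.
move: hz; rewrite subn1 => hz Ln; split=> [char0|charK].
  have pKs : (p%:R : Ks) != 0.
    apply/negP => p0; have /= := char0 p.
    by rewrite -(fmorph_pchar iota) !inE hp p0.
  have [c prim_c cLn] := zeta_in_Ln hp hn hK hz hKs char0.
  apply: (correspondence_of_data hp hn hK hKs hz (Q := fun y x => y ^+ p = se_val (mg_val x))).
    move=> x; apply: (sep_closed_pth_root hp hKs pKs).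
    by have := mg_neq0 x; rewrite -(fmorph_eq0 (\val : {rmorphism field_of Ln -> Ks})).
  by move=> L j jK galL Lm nR; apply: (kummer_datum_ex hp jK galL Lm nR prim_c cLn).
apply: (correspondence_of_data hp hn hK hKs hz (Q := fun y x => y ^+ p - y = se_val x)).
  move=> x; apply: (sep_closed_Artin_Schreier_root hp hKs).
  by rewrite (fmorph_pchar iota).
by move=> L j jK galL Lm nR; apply: (as_datum hp jK galL Lm nR).
Qed.
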